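(* For every integer $n\ge 0$, \begin{align*} t(3,\{2\}^n,3) &= \Big({-}\frac{1}{4}\Big)^{n+2} \Big\{ {-}\frac{9+6n}{2} \zeta(2) \zeta(2n+4) \\ & \quad\quad+ \sum_{\substack{q+r+s=n+2 \\ q,r,s\geq 1}} 2 r s (2 - 2^{-2r} - 2^{-2s}) \zeta(2r + 1)\zeta(2s+1) \cdot (-1)^q \frac{\pi^{2q}}{(2q)!} \\ & \quad\quad + \sum_{\substack{r+s = n+2 \\ r,s \geq 1}}2 r s (2 - 2^{-2r})(2 - 2^{-2s}) \zeta(2r+1) \zeta(2s+1) \Big\} \,. \end{align*} In particular $t(3,\{2\}^n,3)$ is a polynomial in Riemann zeta values.
   Context: The multiple $t$-value is $t(n_1,\dots,n_\ell)=\sum_{1\le k_1<\dots<k_\ell}\prod_{i}(2k_i-1)^{-n_i}$ (convergent for $n_\ell>1$), $\zeta$ denotes the Riemann zeta function, and $\{2\}^n$ denotes the string $2,\dots,2$ with $n$ repetitions. *)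

(* Defs.v *)
From mathcomp Require Import all_boot all_order all_algebra.
From mathcomp Require Import all_classical all_reals all_analysis.
(* Not imported: the notations of mpoly clash with those of the analysis library. *)
From mathcomp Require mpoly.

Set Implicit Arguments.
Unset Strict Implicit.
Unset Printing Implicit Defensive.

Import Order.TTheory GRing.Theory Num.Theory.
Import numFieldNormedType.Exports.

Local Open Scope classical_set_scope.
Local Open Scope ring_scope.

(* The summation indices are the tuples k with 0 < k_1 < ... < k_l.  All terms
   are positive, so the sum is taken unconditionally in the extended reals and
   a divergent one has value +oo; an equation multiple_t R ns = x%:E therefore
   also asserts convergence. *)
Definition multiple_t (R : realType) (ns : seq nat) : \bar R :=
  \esum_(k in [set k : (size ns).-tuple nat | path ltn 0%N k])
    (\prod_(i < size ns) (2 * (tnth k i)%:R - 1) ^- nth 0%N ns i)%:E.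

(* The series converges, and this is the Riemann zeta value, for 1 < s; the
   limit is not meaningful for s = 0 and s = 1. *)
Definition zeta (R : realType) (s : nat) : R :=
  limn (series (fun k : nat => (k.+1%:R : R) ^- s)).

(* x = P(zeta(k_1), ..., zeta(k_m)) for a polynomial P with rational
   coefficients; mmap evaluates P after embedding its coefficients by ratr. *)
Definition polynomial_in_zeta_values (R : realType) (x : R) : Prop :=
  exists (m : nat) (P : mpoly.mpoly m rat) (k : 'I_m -> nat),
    (forall i : 'I_m, (1 < k i)%N) /\
    x = mpoly.mmap (@ratr R) (fun i : 'I_m => zeta R (k i)) P.

(* Main.v *)
Require Import Defs.
From mathcomp Require Import all_boot all_order all_algebra.
From mathcomp Require Import all_classical all_reals all_analysis.
From mathcomp Require Import ring lra zify.
Import Order.TTheory GRing.Theory Num.Theory.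
Import numFieldNormedType.Exports.
Local Open Scope ring_scope.
Set Implicit Arguments.
Unset Strict Implicit.
Unset Printing Implicit Defensive.

(** Write t_n for t(3,{2}^n,3).  The generating function S(x) = sum_n (-x^2)^n t_n
and two auxiliary functions Z(x), W(x) are the limits of truncations
[tsum], [zsum], [wsum] given by first order recurrences over the odd integers.
Telescoping the truncations relates S(x+2), Z(x+2), W(x+2) to S(x), Z(x), W(x),
with cos(pi x / 2) = prod (1 - x^2/(2i+1)^2) appearing in the coefficients.
Explicit functions of x = 2y, polynomials of degree at most 2 in
  alpha(y) = (psi'(1-y) - psi'(1+y)) / 2  and  beta(y) = alpha(y) - alpha(y/2) / 2
with coefficients in y, cos(pi y) and 1/sin(pi y)^2, satisfy the same relations, so each difference is
(anti)periodic; it is then identified by its limit along x + 2k.  These limits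
come from Lagrange interpolation: a truncation is a polynomial in x^2, it is
determined by its values at the odd integers, and these are easily estimated.
Finally, y alpha(y) and y beta(y) have zeta values at odd integers as Taylor
coefficients, and comparing coefficients of y^(2n+4) gives the formula. *)

(** * Truncations and their shift relations *)

Section OddRecurrences.
Variable R : realType.
Implicit Types (x w : R) (i j N : nat).

(* Locked, so that ring and field treat [odd_nat i] as an atom. *)
Fact odd_nat_key : unit. Proof. by []. Qed.
Definition odd_nat := locked_with odd_nat_key (fun i => (2 * i + 1)%:R : R).
Local Notation o := odd_nat.

Lemma odd_natE i : o i = 2 * i%:R + 1.
Proof. by rewrite /odd_nat unlock natrD natrM. Qed.

Lemma odd_nat0 : o 0 = 1. Proof. by rewrite odd_natE mulr0 add0r. Qed.

Lemma odd_natS i : o i.+1 = o i + 2.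
Proof. by rewrite !odd_natE -natr1; ring. Qed.

Lemma odd_nat_ge1 i : 1 <= o i.
Proof. by rewrite odd_natE lerDr mulr_ge0. Qed.

Lemma odd_nat_gt0 i : 0 < o i.
Proof. exact: lt_le_trans (odd_nat_ge1 i). Qed.

Lemma odd_nat_neq0 i : o i != 0.
Proof. by rewrite gt_eqF ?odd_nat_gt0. Qed.

Fixpoint oddprod x i : R :=
  if i is j.+1 then oddprod x j * (1 - x ^+ 2 / o j ^+ 2) else 1.

Fixpoint zsum x i : R :=
  if i is j.+1 then zsum x j + oddprod x j / o j ^+ 3 else 0.

Fixpoint wsum x i : R :=
  if i is j.+1 then (1 - x ^+ 2 / o j ^+ 2) * wsum x j + (o j ^+ 3)^-1 else 0.

Fixpoint tsum x i : R :=
  if i is j.+1 then tsum x j + wsum x j / o j ^+ 3 else 0.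

Fixpoint oddsq i : R :=
  if i is j.+1 then oddsq j + (o j ^+ 2)^-1 else 0.

Lemma oddprodS x i : oddprod x i.+1 = oddprod x i * (1 - x ^+ 2 / o i ^+ 2).
Proof. by []. Qed.

Lemma zsumS x i : zsum x i.+1 = zsum x i + oddprod x i / o i ^+ 3.
Proof. by []. Qed.

Lemma wsumS x i : wsum x i.+1 = (1 - x ^+ 2 / o i ^+ 2) * wsum x i + (o i ^+ 3)^-1.
Proof. by []. Qed.

Lemma tsumS x i : tsum x i.+1 = tsum x i + wsum x i / o i ^+ 3.
Proof. by []. Qed.

Lemma oddsqS i : oddsq i.+1 = oddsq i + (o i ^+ 2)^-1.
Proof. by []. Qed.

Lemma oddprod_shift x i :
  (o i - (x + 2)) * oddprod (x + 2) i = - (o i + x) * oddprod x i.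
Proof.
elim: i => [|i IH]; first by rewrite /= odd_nat0; ring.
rewrite odd_natS /=; have o0 := odd_nat_neq0 i.
have -> : (o i + 2 - (x + 2)) *
  (oddprod (x + 2) i * (1 - (x + 2) ^+ 2 / o i ^+ 2)) =
  ((o i - (x + 2)) * oddprod (x + 2) i) * ((o i - x) * (o i + x + 2) / o i ^+ 2).
  by field.
by rewrite IH; field.
Qed.

Lemma wsum_shift x i : 0 < x ->
  (o i - (x + 2)) * ((x + 2) ^+ 2 * wsum (x + 2) i) =
  (o i + x) * (- x * (x + 2) * wsum x i + ((x + 2) / x ^+ 2 - (x + 2)^-1)
    - oddprod x i * ((x + 2) ^+ 2 + x ^+ 2) / (x ^+ 2 * (x + 2)))
  + 2 * (x + 1) / (x + 2).
Proof.
move=> x0; have xn0 : x != 0 by rewrite gt_eqF.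
have w0 : x + 2 != 0 by rewrite gt_eqF ?addr_gt0.
elim: i => [|i IH]; first by rewrite /= odd_nat0; field; rewrite ?xn0 ?w0.
rewrite odd_natS /=; have o0 := odd_nat_neq0 i.
have -> : (o i + 2 - (x + 2)) * ((x + 2) ^+ 2 *
   ((1 - (x + 2) ^+ 2 / o i ^+ 2) * wsum (x + 2) i + (o i ^+ 3)^-1)) =
  ((o i - (x + 2)) * ((x + 2) ^+ 2 * wsum (x + 2) i)) *
    ((o i - x) * (o i + x + 2) / o i ^+ 2) + (o i - x) * (x + 2) ^+ 2 / o i ^+ 3.
  by field.
by rewrite IH; field; rewrite ?o0 ?xn0 ?w0.
Qed.

Lemma zsum_shift x i : 0 < x ->
  (x + 2) * zsum (x + 2) i - x * zsum x i =
  - (2 * (x + 1) / (x + 2) ^+ 2) * ((1 - oddprod x i) / x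
     + oddprod (x + 2) i / (o i + x) - (1 + x)^-1)
  + 2 * (x + 1) * (1 - oddprod x i) / ((x + 2) * x ^+ 2).
Proof.
move=> x0; have xn0 : x != 0 by rewrite gt_eqF.
have w0 : x + 2 != 0 by rewrite gt_eqF ?addr_gt0.
have x10 : 1 + x != 0 by rewrite gt_eqF ?addr_gt0.
elim: i => [|i IH]; first by rewrite /= odd_nat0; field; rewrite ?xn0 ?w0 ?x10.
rewrite odd_natS /=; have o0 := odd_nat_neq0 i; have ogt := odd_nat_gt0 i.
have ox : o i + x != 0 by rewrite gt_eqF ?addr_gt0.
have o2x : o i + 2 + x != 0 by rewrite gt_eqF ?addr_gt0.
set P' := oddprod (x + 2) i in IH *; set P := oddprod x i in IH *.
have E : (o i - (x + 2)) * P' = - (o i + x) * P by exact: oddprod_shift.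
have PE : P = - ((o i - (x + 2)) * P') / (o i + x) by rewrite E; field; rewrite ?ox.
set LHS := (X in X = _).
have -> : LHS = ((x + 2) * zsum (x + 2) i - x * zsum x i)
    + ((x + 2) * P' - x * P) / o i ^+ 3 by rewrite /LHS; field; rewrite ?o0.
rewrite IH PE; field.
by rewrite ?o0 ?xn0 ?w0 ?x10 ?ox ?o2x.
Qed.

Lemma tsum_shift x i : 0 < x ->
  (x + 2) ^+ 2 * tsum (x + 2) i - x ^+ 2 * tsum x i =
  zsum x i * (x^-1 + x / (x + 2) ^+ 2) + wsum x i * (- x^-1 + x / (x + 2) ^+ 2)
  - 2 / (x ^+ 2 * (x + 2) ^+ 2) - oddsq i * ((x ^+ 2)^-1 - ((x + 2) ^+ 2)^-1)
  - ((x + 2) ^+ 2 + x ^+ 2) * 2 * (x + 1) / (x ^+ 2 * (x + 2)) *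
    (((x + 2) ^+ 3)^-1 * ((1 - oddprod x i) / x - (1 + x)^-1)
      - (1 - oddprod x i) / ((x + 2) ^+ 2 * x ^+ 2))
  - 2 * (x + 1) / (x + 2) ^+ 2 * ((x + 2) ^+ 2 * wsum (x + 2) i + (x + 2)^-1)
      / ((x + 2) * (o i + x)).
Proof.
move=> x0; have xn0 : x != 0 by rewrite gt_eqF.
have w0 : x + 2 != 0 by rewrite gt_eqF ?addr_gt0.
have x10 : 1 + x != 0 by rewrite gt_eqF ?addr_gt0.
elim: i => [|i IH]; first by rewrite /= odd_nat0; field; rewrite ?xn0 ?w0 ?x10.
rewrite odd_natS /=; have o0 := odd_nat_neq0 i; have ogt := odd_nat_gt0 i.
have ox : o i + x != 0 by rewrite gt_eqF ?addr_gt0.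
have o2x : o i + 2 + x != 0 by rewrite gt_eqF ?addr_gt0.
have E := wsum_shift i x0.
set Y := wsum (x + 2) i in E IH *; set P := oddprod x i in E IH *.
set y := wsum x i in E IH *.
have yE : y = (- ((o i - (x + 2)) * ((x + 2) ^+ 2 * Y) - 2 * (x + 1) / (x + 2))
   / (o i + x) + ((x + 2) / x ^+ 2 - (x + 2)^-1)
    - P * ((x + 2) ^+ 2 + x ^+ 2) / (x ^+ 2 * (x + 2))) / (x * (x + 2)).
  by rewrite E; field; rewrite ?w0 ?xn0 ?ox.
set LHS := (X in X = _).
have -> : LHS = ((x + 2) ^+ 2 * tsum (x + 2) i - x ^+ 2 * tsum x i)
    + ((x + 2) ^+ 2 * Y - x ^+ 2 * y) / o i ^+ 3 by rewrite /LHS; field; rewrite ?o0.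
rewrite IH yE; field.
by rewrite ?o0 ?xn0 ?w0 ?x10 ?ox ?o2x.
Qed.

End OddRecurrences.

Section Limits.
Local Open Scope classical_set_scope.
Local Open Scope ring_scope.
Variable R : realType.
Implicit Types (x w : R) (i j N : nat) (u v : nat -> R).
Local Notation o := (@odd_nat R).

Lemma cvgn_le u (l b : R) k : u @ \oo --> l ->
  (forall i, (k <= i)%N -> u i <= b) -> l <= b.
Proof.
move=> ul ub; apply: (cvgr_to_le ul); near=> i; apply: ub.
by near: i; exists k.
Unshelve. all: by end_near. Qed.

Lemma cvgn_eq u v (l : R) : u @ \oo --> l -> (forall i, u i = v i) -> v @ \oo --> l.
Proof. by move=> ul uv; suff <- : u = v by []; exact/funext. Qed.

Lemma cvgn_ge u (l b : R) k : u @ \oo --> l ->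
  (forall i, (k <= i)%N -> b <= u i) -> b <= l.
Proof.
move=> ul ub; apply: (cvgr_to_ge ul); near=> i; apply: ub.
by near: i; exists k.
Unshelve. all: by end_near. Qed.

Lemma cvgn_dist_le u (l a b : R) k : u @ \oo --> l ->
  (forall i, (k <= i)%N -> `|a - u i| <= b) -> `|a - l| <= b.
Proof.
move=> ul ub; apply: (@cvgn_le (fun i => `|a - u i|) _ _ k) => //.
by apply: cvg_norm; apply: cvgB => //; exact: cvg_cst.
Qed.

Lemma invr_odd_ge0 i k : 0 <= (o i ^+ k)^-1.
Proof. by rewrite invr_ge0 exprn_ge0 // ltW ?odd_nat_gt0. Qed.

Lemma oddsqB i j : (i <= j)%N ->
  0 <= oddsq R j - oddsq R i <= 3 / 2 * ((o i)^-1 - (o j)^-1).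
Proof.
move=> /subnK <-; elim: (j - i)%N => [|k IH]; first by rewrite add0n !subrr mulr0 lexx.
rewrite addSn /= odd_natS; set m := (k + i)%N in IH *.
have o1 := odd_nat_ge1 R m; have o0 := odd_nat_gt0 R m.
have o20 : 0 < o m + 2 by rewrite addr_gt0.
have : 0 <= (o m ^+ 2)^-1 <= 3 / 2 * ((o m)^-1 - (o m + 2)^-1).
  rewrite invr_odd_ge0 /=.
  have -> : 3 / 2 * ((o m)^-1 - (o m + 2)^-1) = (o m ^+ 2)^-1 * (3 * o m / (o m + 2)).
    by field; rewrite ?gt_eqF.
  by rewrite ler_peMr ?invr_odd_ge0 // ler_pdivlMr // mul1r; lra.
move: IH; set a := oddsq _ _; set b := oddsq _ _; lra.
Qed.

Lemma oddsq_ge0 i : 0 <= oddsq R i.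
Proof. by have /andP[+ _] := oddsqB (leq0n i); rewrite subr0. Qed.

Lemma oddsq_le i : oddsq R i <= 3 / 2.
Proof.
have /andP[_] := oddsqB (leq0n i); rewrite subr0 odd_nat0.
have : 0 < (o i)^-1 by rewrite invr_gt0 odd_nat_gt0.
lra.
Qed.

Lemma nondecreasing_oddsq : nondecreasing_seq (oddsq R).
Proof. by move=> i j ij; have /andP[] := oddsqB ij; rewrite subr_ge0. Qed.

Lemma cvg_oddsq_dom u (A : R) :
  (forall i, `|u i.+1 - u i| <= A / o i ^+ 2) ->
  cvgn u /\ forall i, `|limn u - u i| <= 3 / 2 * A / o i.
Proof.
move=> uA.
have A0 : 0 <= A by have := le_trans (normr_ge0 _) (uA 0); rewrite odd_nat0 expr1n divr1.
have uB i j : (i <= j)%N -> `|u j - u i| <= A * (oddsq R j - oddsq R i).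
  move=> /subnK <-; elim: (j - i)%N => [|k IH].
    by rewrite add0n !subrr mulr0 normr0.
  rewrite addSn /=; have := uA (k + i)%N; move: IH.
  set m := (k + i)%N; rewrite !mulrBr mulrDr.
  have := ler_normD (u m.+1 - u m) (u m - u i); rewrite addrA subrK.
  by set a := `|_|; set b := `|_|; set c := `|_|; lra.
have inc : nondecreasing_seq (fun i => u i + A * oddsq R i).
  move=> i j ij; have := uB _ _ ij; have := ler_norm (u i - u j); rewrite distrC.
  by rewrite mulrBr; set a := `|_|; lra.
have cu : cvgn u.
  have c1 : cvgn (fun i => u i + A * oddsq R i).
    apply: nondecreasing_is_cvgn => //; exists (u 0 + 2 * A * (3 / 2)) => _ [i _ <-].
    have := uB _ _ (leq0n i); have := ler_norm (u i - u 0).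
    rewrite mulrBr /= mulr0 subr0; set a := `|_|.
    have : A * oddsq R i <= A * (3 / 2) by rewrite ler_wpM2l ?oddsq_le.
    by lra.
  have c2 : cvgn (oddsq R).
    apply: nondecreasing_is_cvgn; first exact: nondecreasing_oddsq.
    by exists (3 / 2) => _ [i _ <-]; exact: oddsq_le.
  have -> : u = (fun i => u i + A * oddsq R i) - (fun i => A * oddsq R i).
    by apply/funext => i; rewrite !fctE /= addrK.
  by apply: is_cvgB => //; apply: is_cvgM => //; exact: is_cvg_cst.
split=> // i; rewrite distrC; apply: (@cvgn_dist_le _ _ _ _ i cu) => j ij.
rewrite distrC (le_trans (uB _ _ ij)) // -mulrA mulrCA ler_wpM2l //.
have /andP[_ /le_trans->//] := oddsqB ij.
by rewrite ler_wpM2l // gerBl invr_ge0 ltW ?odd_nat_gt0.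
Qed.

Lemma oddsq_cvg : cvgn (oddsq R) /\
  forall i, `|limn (oddsq R) - oddsq R i| <= 3 / 2 / o i.
Proof.
have [] := @cvg_oddsq_dom (oddsq R) 1; last by move=> ? H; split=> // i; have := H i; rewrite mulr1.
by move=> i /=; rewrite addrAC subrr add0r ger0_norm ?invr_odd_ge0 // mul1r.
Qed.

Lemma invr_odd3_le i : (o i ^+ 3)^-1 <= (o i ^+ 2)^-1.
Proof. by rewrite lef_pV2 ?posrE ?exprn_gt0 ?odd_nat_gt0 // ler_weXn2l ?odd_nat_ge1. Qed.

Lemma oddprod_bound x i : `|oddprod x i| <= expR (x ^+ 2 * (3 / 2)).
Proof.
apply: (@le_trans _ _ (expR (x ^+ 2 * oddsq R i))); last first.
  by rewrite ler_expR ler_wpM2l ?sqr_ge0 ?oddsq_le.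
elim: i => [|i IH] /=; first by rewrite mulr0 expR0 normr1.
rewrite [_ * (oddsq R i + _)]mulrDr expRD normrM ler_pM //.
apply: le_trans (expR_ge1Dx _); rewrite (le_trans (ler_normB _ _)) // normr1.
by rewrite ger0_norm // mulr_ge0 ?sqr_ge0 ?invr_odd_ge0.
Qed.

Lemma wsum_bound x i : `|wsum x i| <= expR ((x ^+ 2 + 1) * (3 / 2)).
Proof.
apply: (@le_trans _ _ (`|wsum x i| + 1)); first by rewrite lerDl.
apply: (@le_trans _ _ (expR ((x ^+ 2 + 1) * oddsq R i))); last first.
  by rewrite ler_expR ler_wpM2l ?addr_ge0 ?sqr_ge0 ?oddsq_le.
elim: i => [|i IH] /=; first by rewrite mulr0 expR0 normr0 add0r.
rewrite [_ * (oddsq R i + _)]mulrDr expRD.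
have h0 := invr_odd_ge0 i 2; have h3 := invr_odd_ge0 i 3; have h1 := invr_odd3_le i.
apply: (@le_trans _ _ ((`|wsum x i| + 1) * (1 + (x ^+ 2 + 1) * (o i ^+ 2)^-1))); last first.
  by apply: ler_pM => //; rewrite ?addr_ge0 ?mulr_ge0 ?sqr_ge0 ?expR_ge1Dx ?addr_ge0 ?sqr_ge0.
have := ler_normD ((1 - x ^+ 2 / o i ^+ 2) * wsum x i) (o i ^+ 3)^-1.
rewrite normrM (ger0_norm h3).
have := ler_normB 1 (x ^+ 2 / o i ^+ 2); rewrite normr1.
have xo : 0 <= x ^+ 2 / o i ^+ 2 by rewrite mulr_ge0 ?sqr_ge0.
rewrite (ger0_norm xo) => /(ler_wpM2r (normr_ge0 (wsum x i))).
have : 0 <= (o i ^+ 2)^-1 * `|wsum x i| by rewrite mulr_ge0.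
move: h0 h1 h3 xo; set q := (o i ^+ 2)^-1; set p := (o i ^+ 3)^-1.
set a := `|wsum _ _|; set s := `|_ + p|; set r := `|_| * a; set X := x ^+ 2.
move=> h0 h1 h3 xo qa rle sle.
have -> : (a + 1) * (1 + (X + 1) * q) = (1 + X * q) * a + q * a + (1 + X * q) + q by ring.
lra.
Qed.

Lemma oddprod_cvg x : cvgn (oddprod x).
Proof.
apply: (proj1 (@cvg_oddsq_dom (oddprod x) (x ^+ 2 * expR (x ^+ 2 * (3 / 2))) _)) => i /=; have -> : oddprod x i * (1 - x ^+ 2 / o i ^+ 2) - oddprod x i =
  - (x ^+ 2 * oddprod x i / o i ^+ 2) by ring.
rewrite normrN normrM (ger0_norm (invr_odd_ge0 i 2)) normrM (ger0_norm (sqr_ge0 x)).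
by rewrite ler_wpM2r ?invr_odd_ge0 // ler_wpM2l ?sqr_ge0 ?oddprod_bound.
Qed.

Lemma wsum_cvg x : cvgn (wsum x).
Proof.
apply: (proj1 (@cvg_oddsq_dom (wsum x) (x ^+ 2 * expR ((x ^+ 2 + 1) * (3 / 2)) + 1) _)) => i /=; have -> : (1 - x ^+ 2 / o i ^+ 2) * wsum x i + (o i ^+ 3)^-1 - wsum x i =
  (o i ^+ 3)^-1 - (x ^+ 2 * wsum x i / o i ^+ 2) by ring.
rewrite (le_trans (ler_normB _ _)) // (ger0_norm (invr_odd_ge0 i _)).
rewrite normrM (ger0_norm (invr_odd_ge0 i 2)) normrM (ger0_norm (sqr_ge0 x)).
rewrite addrC mulrDl mul1r lerD ?invr_odd3_le //.
by rewrite ler_wpM2r ?invr_odd_ge0 // ler_wpM2l ?sqr_ge0 ?wsum_bound.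
Qed.

Lemma cube_sum_cvg u v (M : R) : (forall i, `|v i| <= M) ->
  (forall i, u i.+1 = u i + v i / o i ^+ 3) -> cvgn u.
Proof.
move=> vM uS; apply: (proj1 (@cvg_oddsq_dom u M _)) => i; rewrite uS addrAC subrr add0r normrM (ger0_norm (invr_odd_ge0 i 3)).
apply: ler_pM => //; first exact: invr_odd_ge0.
exact: invr_odd3_le.
Qed.

Lemma zsum_cvg x : cvgn (zsum x).
Proof. by apply: cube_sum_cvg (oddprod_bound x) _. Qed.

Lemma tsum_cvg x : cvgn (tsum x).
Proof. by apply: cube_sum_cvg (wsum_bound x) _. Qed.

Definition zlim x := limn (zsum x).
Definition wlim x := limn (wsum x).
Definition tlim x := limn (tsum x).
Definition oddprod_lim x := limn (oddprod x).
Definition oddsq_lim := limn (oddsq R).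

Lemma cvg_zsum x : zsum x @ \oo --> zlim x. Proof. exact: zsum_cvg. Qed.
Lemma cvg_wsum x : wsum x @ \oo --> wlim x. Proof. exact: wsum_cvg. Qed.
Lemma cvg_tsum x : tsum x @ \oo --> tlim x. Proof. exact: tsum_cvg. Qed.
Lemma cvg_oddprod x : oddprod x @ \oo --> oddprod_lim x. Proof. exact: oddprod_cvg. Qed.
Lemma cvg_oddsq : oddsq R @ \oo --> oddsq_lim. Proof. exact: oddsq_cvg.1. Qed.

End Limits.

Section ShiftLimits.
Local Open Scope classical_set_scope.
Local Open Scope ring_scope.
Variable R : realType.
Implicit Types (x w : R) (i j N : nat) (u : nat -> R).
Local Notation o := (@odd_nat R).

Ltac cvg_arith := lazymatch goal with
  | |- cvg_to (nbhs (fmap (fun _ => ?c) _)) _ => exact: cvg_cst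
  | |- cvg_to (nbhs (fmap (fun i => Algebra.add _ _) _)) _ => apply: cvgD; cvg_arith
  | |- cvg_to (nbhs (fmap (fun i => Algebra.opp _) _)) _ => apply: cvgN; cvg_arith
  | |- cvg_to (nbhs (fmap (fun i => GRing.mul _ _) _)) _ => apply: cvgM; cvg_arith
  | |- _ => eassumption
  end.

Lemma cvg_inv_odd x : 0 < x -> (fun i => (o i + x)^-1) @ \oo --> (0 : R).
Proof.
move=> x0; apply: (@squeeze_cvgr _ _ _ _ (fun=> 0) (@harmonic R)); last 2 first.
- exact: cvg_cst.
- exact: cvg_harmonic.
near=> i; have o0 := odd_nat_gt0 R i; have ox : 0 < o i + x by rewrite addr_gt0.
rewrite invr_ge0 ltW //= /harmonic /= lef_pV2 ?posrE // odd_natE -natr1.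
by have : 0 <= i%:R :> R by []; lra.
Unshelve. all: by end_near. Qed.

Lemma oddprod_lim_shift x : 0 < x -> oddprod_lim (x + 2) = - oddprod_lim x.
Proof.
move=> x0; have e0 := cvg_inv_odd x0.
have c1 := @cvg_oddprod R x; have c2 := @cvg_oddprod R (x + 2).
pose f i := (1 - (2 * x + 2) * (o i + x)^-1) * oddprod (x + 2) i.
have H : f @ \oo --> (1 - (2 * x + 2) * 0) * oddprod_lim (x + 2).
  by rewrite /f; cvg_arith.
pose g i := - oddprod x i.
have H' : g @ \oo --> - oddprod_lim x by rewrite /g; cvg_arith.
have fg : f = g.
  apply/funext => i; have ox : o i + x != 0 by rewrite gt_eqF ?addr_gt0 ?odd_nat_gt0.
  have -> : f i = ((o i - (x + 2)) * oddprod (x + 2) i) / (o i + x) by rewrite /f; field.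
  by rewrite oddprod_shift /g; field.
by rewrite fg in H; rewrite -(cvg_unique _ H H') // mulr0 subr0 mul1r.
Qed.

Lemma wlim_shift x : 0 < x -> (x + 2) * wlim (x + 2) + x * wlim x =
  (1 - oddprod_lim x) / x ^+ 2 - (1 + oddprod_lim x) / (x + 2) ^+ 2.
Proof.
move=> x0; have e0 := cvg_inv_odd x0.
have c1 := @cvg_oddprod R x; have c2 := @cvg_wsum R x; have c3 := @cvg_wsum R (x + 2).
have xn0 : x != 0 by rewrite gt_eqF.
have w0 : x + 2 != 0 by rewrite gt_eqF ?addr_gt0.
pose f i := (1 - (2 * x + 2) * (o i + x)^-1) * ((x + 2) ^+ 2 * wsum (x + 2) i).
have H : f @ \oo --> (1 - (2 * x + 2) * 0) * ((x + 2) ^+ 2 * wlim (x + 2)).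
  by rewrite /f; cvg_arith.
pose g i := (- x * (x + 2) * wsum x i + ((x + 2) / x ^+ 2 - (x + 2)^-1)
    - oddprod x i * (((x + 2) ^+ 2 + x ^+ 2) / (x ^+ 2 * (x + 2)))) +
    2 * (x + 1) / (x + 2) * (o i + x)^-1.
have H' : g @ \oo --> (- x * (x + 2) * wlim x + ((x + 2) / x ^+ 2 - (x + 2)^-1)
    - oddprod_lim x * (((x + 2) ^+ 2 + x ^+ 2) / (x ^+ 2 * (x + 2)))) +
    2 * (x + 1) / (x + 2) * 0 by rewrite /g; cvg_arith.
have fg : f = g.
  apply/funext => i; have ox : o i + x != 0 by rewrite gt_eqF ?addr_gt0 ?odd_nat_gt0.
  have -> : f i = ((o i - (x + 2)) * ((x + 2) ^+ 2 * wsum (x + 2) i)) / (o i + x).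
    by rewrite /f; field.
  by rewrite wsum_shift // /g; field; rewrite ?xn0 ?w0 ?ox.
rewrite fg in H; have := cvg_unique _ H H'; rewrite !mulr0 subr0 mul1r addr0 => E.
have -> : wlim (x + 2) = ((x + 2) ^+ 2 * wlim (x + 2)) / (x + 2) ^+ 2 by field.
by rewrite E //; field; rewrite xn0 w0.
Qed.

Lemma zlim_shift x : 0 < x -> (x + 2) * zlim (x + 2) - x * zlim x =
  (1 - oddprod_lim x) / x ^+ 2 + (1 + oddprod_lim x) / (x + 2) ^+ 2.
Proof.
move=> x0; have e0 := cvg_inv_odd x0.
have c0 := @cvg_oddprod R (x + 2).
have c1 := @cvg_oddprod R x; have c2 := @cvg_zsum R x; have c3 := @cvg_zsum R (x + 2).
have xn0 : x != 0 by rewrite gt_eqF.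
have w0 : x + 2 != 0 by rewrite gt_eqF ?addr_gt0.
have x10 : 1 + x != 0 by rewrite gt_eqF ?addr_gt0.
pose f i := (x + 2) * zsum (x + 2) i - x * zsum x i.
have H : f @ \oo --> (x + 2) * zlim (x + 2) - x * zlim x by rewrite /f; cvg_arith.
pose g i := - (2 * (x + 1) / (x + 2) ^+ 2) * ((1 - oddprod x i) * x^-1
     + oddprod (x + 2) i * (o i + x)^-1 - (1 + x)^-1)
  + 2 * (x + 1) * (1 - oddprod x i) * ((x + 2) * x ^+ 2)^-1.
have H' : g @ \oo --> - (2 * (x + 1) / (x + 2) ^+ 2) * ((1 - oddprod_lim x) * x^-1
     + oddprod_lim (x + 2) * 0 - (1 + x)^-1)
  + 2 * (x + 1) * (1 - oddprod_lim x) * ((x + 2) * x ^+ 2)^-1.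
  by rewrite /g; cvg_arith.
have fg : f = g by apply/funext => i; rewrite /f zsum_shift.
rewrite fg in H; rewrite (cvg_unique _ H H') // mulr0 addr0.
by field; rewrite ?xn0 ?w0 ?x10.
Qed.

Lemma tlim_shift x : 0 < x ->
  (x + 2) ^+ 2 * tlim (x + 2) - x ^+ 2 * tlim x =
  (zlim x - wlim x) / x + x * (zlim x + wlim x) / (x + 2) ^+ 2
  + (1 - oddprod_lim x) / x ^+ 4 + (1 + oddprod_lim x) / (x + 2) ^+ 4
  - oddsq_lim R * ((x ^+ 2)^-1 - ((x + 2) ^+ 2)^-1).
Proof.
move=> x0; have e0 := cvg_inv_odd x0.
have c0 := @cvg_oddsq R; have c1 := @cvg_oddprod R x; have c2 := @cvg_zsum R x.
have c3 := @cvg_wsum R x; have c4 := @cvg_wsum R (x + 2).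
have c5 := @cvg_tsum R x; have c6 := @cvg_tsum R (x + 2).
have xn0 : x != 0 by rewrite gt_eqF.
have w0 : x + 2 != 0 by rewrite gt_eqF ?addr_gt0.
have x10 : 1 + x != 0 by rewrite gt_eqF ?addr_gt0.
pose f i := (x + 2) ^+ 2 * tsum (x + 2) i - x ^+ 2 * tsum x i.
have H : f @ \oo --> (x + 2) ^+ 2 * tlim (x + 2) - x ^+ 2 * tlim x.
  by rewrite /f; cvg_arith.
pose g i :=   zsum x i * (x^-1 + x / (x + 2) ^+ 2) + wsum x i * (- x^-1 + x / (x + 2) ^+ 2)
  - 2 / (x ^+ 2 * (x + 2) ^+ 2) - oddsq R i * ((x ^+ 2)^-1 - ((x + 2) ^+ 2)^-1)
  - ((x + 2) ^+ 2 + x ^+ 2) * 2 * (x + 1) / (x ^+ 2 * (x + 2)) *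
    (((x + 2) ^+ 3)^-1 * ((1 - oddprod x i) * x^-1 - (1 + x)^-1)
      - (1 - oddprod x i) * ((x + 2) ^+ 2 * x ^+ 2)^-1)
  - 2 * (x + 1) / (x + 2) ^+ 2 * ((x + 2) ^+ 2 * wsum (x + 2) i + (x + 2)^-1)
     * (x + 2)^-1 * (o i + x)^-1.
have H' : g @ \oo --> zlim x * (x^-1 + x / (x + 2) ^+ 2) + wlim x * (- x^-1 + x / (x + 2) ^+ 2)
  - 2 / (x ^+ 2 * (x + 2) ^+ 2) - oddsq_lim R * ((x ^+ 2)^-1 - ((x + 2) ^+ 2)^-1)
  - ((x + 2) ^+ 2 + x ^+ 2) * 2 * (x + 1) / (x ^+ 2 * (x + 2)) *
    (((x + 2) ^+ 3)^-1 * ((1 - oddprod_lim x) * x^-1 - (1 + x)^-1)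
      - (1 - oddprod_lim x) * ((x + 2) ^+ 2 * x ^+ 2)^-1)
  - 2 * (x + 1) / (x + 2) ^+ 2 * ((x + 2) ^+ 2 * wlim (x + 2) + (x + 2)^-1)
     * (x + 2)^-1 * 0.
  by rewrite /g; cvg_arith.
have fg : f = g.
  apply/funext => i; rewrite /f tsum_shift // /g; congr (_ - _).
  by rewrite (invfM (x + 2) (o i + x)) mulrA.
rewrite fg in H; rewrite (cvg_unique _ H H') // mulr0 subr0.
by field; rewrite ?xn0 ?w0 ?x10.
Qed.

End ShiftLimits.

(** * Lagrange interpolation at the odd integers *)

Section Sampling.
Variable R : realType.
Implicit Types (x y A L : R) (i j n N : nat) (p : {poly R}).
Local Notation o := (@odd_nat R).

Definition oddfac i : {poly R} := 1 - (o i ^+ 2)^-1 *: 'X.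

Lemma horner_oddfac i x : (oddfac i).[x] = 1 - x / o i ^+ 2.
Proof. by rewrite /oddfac !hornerE mulrC. Qed.

Lemma size_oddfac i : (size (oddfac i) <= 2)%N.
Proof.
rewrite /oddfac (leq_trans (size_polyD _ _)) // geq_max size_poly1 /= size_polyN.
by rewrite (leq_trans (size_scale_leq _ _)) // size_polyX.
Qed.

Fixpoint prodpoly i : {poly R} := if i is j.+1 then prodpoly j * oddfac j else 1.
Fixpoint zpoly i : {poly R} :=
  if i is j.+1 then zpoly j + (o j ^+ 3)^-1 *: prodpoly j else 0.
Fixpoint wpoly i : {poly R} :=
  if i is j.+1 then oddfac j * wpoly j + ((o j ^+ 3)^-1)%:P else 0.
Fixpoint tpoly i : {poly R} :=
  if i is j.+1 then tpoly j + (o j ^+ 3)^-1 *: wpoly j else 0.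

Lemma horner_prodpoly i x : (prodpoly i).[x ^+ 2] = oddprod x i.
Proof. by elim: i => [|i IH] /=; rewrite ?hornerC // hornerM horner_oddfac IH. Qed.

Lemma horner_zpoly i x : (zpoly i).[x ^+ 2] = zsum x i.
Proof.
elim: i => [|i IH] /=; first by rewrite horner0.
by rewrite hornerD hornerZ horner_prodpoly IH mulrC.
Qed.

Lemma horner_wpoly i x : (wpoly i).[x ^+ 2] = wsum x i.
Proof.
elim: i => [|i IH] /=; first by rewrite horner0.
by rewrite hornerD hornerM hornerC horner_oddfac IH.
Qed.

Lemma horner_tpoly i x : (tpoly i).[x ^+ 2] = tsum x i.
Proof.
elim: i => [|i IH] /=; first by rewrite horner0.
by rewrite hornerD hornerZ horner_wpoly IH mulrC.
Qed.

Lemma size_mul_oddfac p i n : (size p <= n)%N -> (size (p * oddfac i)%R <= n.+1)%N.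
Proof.
move=> sp; apply: (leq_trans (size_polyMleq p (oddfac i))).
by have := size_oddfac i; lia.
Qed.

Lemma size_prodpoly i : (size (prodpoly i) <= i.+1)%N.
Proof. by elim: i => [|i IH] /=; rewrite ?size_poly1 // size_mul_oddfac. Qed.

Lemma size_zpoly i : (size (zpoly i) <= i)%N.
Proof.
elim: i => [|i IH] /=; first by rewrite size_poly0.
rewrite (leq_trans (size_polyD _ _)) // geq_max (leq_trans IH) //=.
by rewrite (leq_trans (size_scale_leq _ _)) // size_prodpoly.
Qed.

Lemma size_wpoly i : (size (wpoly i) <= i)%N.
Proof.
elim: i => [|i IH] /=; first by rewrite size_poly0.
rewrite (leq_trans (size_polyD _ _)) // geq_max mulrC size_mul_oddfac //=.
by rewrite (leq_trans (size_polyC_leq1 _)).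
Qed.

Lemma size_tpoly i : (size (tpoly i) <= i.-1)%N.
Proof.
elim: i => [|i IH] /=; first by rewrite size_poly0.
rewrite (leq_trans (size_polyD _ _)) // geq_max (leq_trans IH) ?leq_pred //=.
by rewrite (leq_trans (size_scale_leq _ _)) // size_wpoly.
Qed.

Lemma odd_nat_inj : injective o.
Proof.
move=> i j; rewrite !odd_natE => /addIr /mulfI H.
by apply/eqP; rewrite -(eqr_nat R); apply/eqP/H; rewrite pnatr_eq0.
Qed.

Lemma odd_sqr_inj : injective (fun i => o i ^+ 2).
Proof.
move=> i j /= /eqP; rewrite eqrXn2 ?ltW ?odd_nat_gt0 //.
by move/eqP/odd_nat_inj.
Qed.

Definition oddmiss n i : {poly R} := \prod_(j < n) if j == i :> nat then 1 else oddfac j.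

Lemma oddmissS n i : (i < n)%N -> oddmiss n.+1 i = oddmiss n i * oddfac n.
Proof. by move=> ilt; rewrite /oddmiss big_ord_recr /= gtn_eqF. Qed.

Lemma oddmiss_last n : oddmiss n.+1 n = prodpoly n.
Proof.
rewrite /oddmiss big_ord_recr /= eqxx mulr1.
suff H k : (k <= n)%N ->
  \prod_(j < k) (if j == n :> nat then 1 else oddfac j) = prodpoly k by exact: H.
elim: k => [|k IH] kn; first by rewrite big_ord0.
by rewrite big_ord_recr /= ltn_eqF // IH // ltnW.
Qed.

Lemma oddmiss_prodpoly n i : (i < n)%N -> prodpoly n = oddmiss n i * oddfac i.
Proof.
elim: n => // n IH; rewrite ltnS leq_eqVlt => /orP[/eqP -> | ilt].
  by rewrite oddmiss_last.
by rewrite oddmissS //= IH // -!mulrA [oddfac i * _]mulrC.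
Qed.

Lemma size_oddmiss n i : (i < n)%N -> (size (oddmiss n i) <= n)%N.
Proof.
elim: n => // n IH; rewrite ltnS leq_eqVlt => /orP[/eqP -> | ilt].
  by rewrite oddmiss_last size_prodpoly.
by rewrite oddmissS // size_mul_oddfac ?IH.
Qed.

Lemma root_oddmiss n i k : (k < n)%N -> k != i -> (oddmiss n i).[o k ^+ 2] = 0.
Proof.
move=> kn ki; rewrite /oddmiss horner_prod (bigD1 (Ordinal kn)) //=.
by rewrite (negPf ki) horner_oddfac divff ?subrr ?mul0r // expf_neq0 ?odd_nat_neq0.
Qed.

Definition oddsqprod n : R := \prod_(j < n) o j ^+ 2.

Lemma oddsqprodS n : oddsqprod n.+1 = oddsqprod n * o n ^+ 2.
Proof. by rewrite /oddsqprod big_ord_recr. Qed.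

Lemma oddsqprod_gt0 n : 0 < oddsqprod n.
Proof. by apply: prodr_gt0 => i _; rewrite exprn_gt0 ?odd_nat_gt0. Qed.

Lemma oddprod_at_odd k d :
  oddprod (o (k + d)) k * (d`!)%:R * oddsqprod k = (- 4) ^+ k * ((2 * k + d)`!)%:R.
Proof.
elim: k d => [|k IH] d; first by rewrite /oddsqprod big_ord0 muln0 add0n /=; ring.
rewrite /= oddsqprodS [(-4) ^+ k.+1]exprS.
have -> : (2 * k.+1 + d = (2 * k + d.+1).+1)%N by lia.
have := IH d.+1; have -> : (k + d.+1 = k.+1 + d)%N by lia.
rewrite !factS !natrM; set F := ((2 * k + d.+1)`!)%:R.
set P := oddprod _ _; set S := oddsqprod k; set D := (d`!)%:R => IH1.
have -> : - 4 * (- 4) ^+ k * ((2 * k + d.+1).+1%:R * F) =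
  ((- 4) ^+ k * F) * (- 4 * (2 * k + d.+1).+1%:R) by ring.
rewrite -IH1 !odd_natE; have -> : (2 * k + d.+1).+1%:R = 2 * k%:R + d%:R + 2 :> R by rewrite -natr1 natrD natrM -natr1; ring.
rewrite natrD -!natr1.
have : 2 * k%:R + 1 != 0 :> R by rewrite -odd_natE odd_nat_neq0.
by move=> h; field.
Qed.

Definition node_weight n i : R :=
  4 ^+ n * ((n - i)`!)%:R * ((n.+1 + i)`!)%:R / oddsqprod n.+1.

Lemma node_weight_gt0 n i : 0 < node_weight n i.
Proof. by rewrite !mulr_gt0 ?invr_gt0 ?exprn_gt0 ?oddsqprod_gt0 // ltr0n fact_gt0. Qed.

Lemma oddmiss_node n i : (i <= n)%N ->
  (oddmiss n.+1 i).[o i ^+ 2] = (-1) ^+ i * o i * node_weight n i.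
Proof.
have L m : (oddmiss m.+1 m).[o m ^+ 2] = (-1) ^+ m * o m * node_weight m m.
  rewrite oddmiss_last horner_prodpoly; have := oddprod_at_odd m 0.
  rewrite !addn0 fact0 mulr1 => E.
  have s0 := oddsqprod_gt0 m; have o0 := odd_nat_neq0 R m.
  have -> : oddprod (o m) m = (oddprod (o m) m * oddsqprod m) / oddsqprod m.
    by rewrite mulfK // gt_eqF.
  rewrite E /node_weight subnn fact0 oddsqprodS.
  have -> : (m.+1 + m = (2 * m).+1)%N by lia.
  have -> : ((2 * m).+1`!)%:R = o m * ((2 * m)`!)%:R :> R.
    by rewrite factS natrM odd_natE -[in LHS]natr1 natrM.
  rewrite -[- 4]mulN1r exprMn.
  by field; rewrite o0 gt_eqF.
elim: n => [|n IH]; first by rewrite leqn0 => /eqP ->.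
rewrite leq_eqVlt => /orP[/eqP -> // | ilt].
rewrite oddmissS // hornerM IH // horner_oddfac /node_weight (oddsqprodS n.+1).
rewrite subSn // (factS (n - i)) natrM [4 ^+ n.+1]exprS.
have -> : (n.+2 + i = (n.+1 + i).+1)%N by lia.
rewrite (factS (n.+1 + i)) natrM.
have E : (o n.+1 - o i) * (o n.+1 + o i) = 4 * (n - i).+1%:R * (n.+1 + i).+1%:R.
  rewrite !odd_natE -!natr1 natrB // ?natrD -?natr1; ring.
have s0 := oddsqprod_gt0 n.+1; have o0 := odd_nat_neq0 R n.+1.
set F := (n - i).+1%:R in E *; set G := (n.+1 + i).+1%:R in E *.
have -> : 1 - o i ^+ 2 / o n.+1 ^+ 2 = (o n.+1 - o i) * (o n.+1 + o i) / o n.+1 ^+ 2.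
  by field.
by rewrite E; field; rewrite o0 gt_eqF.
Qed.

Lemma node_weight_mono n i : (i < n)%N -> node_weight n i <= node_weight n i.+1.
Proof.
move=> ilt; rewrite /node_weight ler_pM2r ?invr_gt0 ?oddsqprod_gt0 //.
rewrite -!mulrA ler_pM2l ?exprn_gt0 // -!natrM ler_nat.
have -> : (n - i = (n - i.+1).+1)%N by lia.
have -> : (n.+1 + i.+1 = (n.+1 + i).+1)%N by lia.
rewrite (factS (n - i.+1)) (factS (n.+1 + i)) -mulnA [leqRHS]mulnCA leq_mul //.
lia.
Qed.

Lemma node_weight0 n : n.+2%:R / (2 * n.+1%:R) <= node_weight n 0.
Proof.
elim: n => [|n IH].
  rewrite /node_weight /oddsqprod big_ord_recl big_ord0 odd_nat0 subnn addn0.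
  by rewrite !fact0 factS fact0 expr0 expr1n !mulr1 divr1 divff.
have E : node_weight n.+1 0 = node_weight n 0 * (4 * n.+1%:R * n.+2%:R / o n.+1 ^+ 2).
  rewrite /node_weight !subn0 !addn0 (oddsqprodS n.+1) (factS n.+1) natrM (factS n) natrM
      [4 ^+ n.+1]exprS.
  by field; rewrite odd_nat_neq0 gt_eqF ?oddsqprod_gt0.
rewrite E; set m : R := n%:R in IH *.
have m0 : 0 <= m by [].
have e1 : n.+1%:R = m + 1 :> R by rewrite -natr1.
have e2 : n.+2%:R = m + 2 :> R by rewrite -natr1 e1; ring.
have e3 : n.+3%:R = m + 3 :> R by rewrite -natr1 e2; ring.
rewrite odd_natE e1 e2 e3 in IH *.
have d0 : 0 < 2 * (m + 1) + 1 by lra.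
apply: le_trans (ler_wpM2r _ IH); last first.
  by rewrite mulr_ge0 ?invr_ge0 ?exprn_ge0 ?mulr_ge0 //; lra.
rewrite -subr_ge0.
have -> : (m + 2) / (2 * (m + 1)) * (4 * (m + 1) * (m + 2) / (2 * (m + 1) + 1) ^+ 2)
  - (m + 3) / (2 * (m + 2)) =
  (3 * m + 5) / (2 * (m + 2) * (2 * (m + 1) + 1) ^+ 2).
  by field; apply/and3P; split; apply: lt0r_neq0; lra.
by rewrite divr_ge0 ?mulr_ge0 ?exprn_ge0 //; lra.
Qed.

Lemma node_weight_ge n i : (i <= n)%N -> 2^-1 <= node_weight n i.
Proof.
elim: i => [|i IH] ilt; last by rewrite (le_trans (IH (ltnW ilt))) ?node_weight_mono.
apply: le_trans (node_weight0 n); rewrite ler_pdivlMr ?mulr_gt0 // mulrA mulVf // mul1r.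
by rewrite ler_nat.
Qed.

Lemma odd_interpolation p n x : (size p <= n.+1)%N -> 0 <= x -> (forall i, x != o i) ->
  p.[x ^+ 2] = \sum_(i < n.+1) p.[o i ^+ 2] *
    (oddprod x n.+1 * ((-1) ^+ i / node_weight n i * (o i / (o i ^+ 2 - x ^+ 2)))).
Proof.
move=> sp x0 xo.
have nodeN0 i : (i <= n)%N -> (oddmiss n.+1 i).[o i ^+ 2] != 0.
  move=> ilt; rewrite oddmiss_node //; apply: mulf_neq0; last first.
    by rewrite gt_eqF ?node_weight_gt0.
  by apply: mulf_neq0; rewrite ?odd_nat_neq0 // signr_eq0.
pose r := p - \sum_(i < n.+1) (p.[o i ^+ 2] / (oddmiss n.+1 i).[o i ^+ 2]) *: oddmiss n.+1 i.
have r0 : r = 0.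
  apply: (@roots_geq_poly_eq0 _ _ [seq o i ^+ 2 | i <- iota 0 n.+1]).
  - apply/allP => z /mapP[k]; rewrite mem_iota add0n => /= kn ->.
    rewrite /root /r hornerD hornerN horner_sum (bigD1 (Ordinal kn)) //= big1 ?addr0.
      by rewrite hornerZ divfK ?nodeN0 // subrr.
    move=> i ik; rewrite hornerZ (@root_oddmiss _ i k) ?mulr0 //.
    by move: ik; rewrite -val_eqE eq_sym.
  - by rewrite map_inj_uniq ?iota_uniq //; exact: odd_sqr_inj.
  - rewrite size_map size_iota (leq_trans (size_polyD _ _)) // geq_max sp size_polyN.
    rewrite (leq_trans (size_sum _ _ _)) //; apply/bigmax_leqP => i _.
    by rewrite (leq_trans (size_scale_leq _ _)) // size_oddmiss.
have /(congr1 (fun q => q.[x ^+ 2])) : p = r + \sum_(i < n.+1)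
    (p.[o i ^+ 2] / (oddmiss n.+1 i).[o i ^+ 2]) *: oddmiss n.+1 i.
  by rewrite /r subrK.
rewrite r0 add0r horner_sum => ->; apply: eq_bigr => i _.
have ilt : (i <= n)%N by rewrite -ltnS.
rewrite hornerZ -mulrA; congr (_ * _); rewrite oddmiss_node //.
rewrite -horner_prodpoly (oddmiss_prodpoly (ltn_ord i)) hornerM horner_oddfac.
have o0 := odd_nat_neq0 R i; have w0 := gt_eqF (node_weight_gt0 n i).
have ox : o i ^+ 2 - x ^+ 2 != 0.
  by rewrite subr_eq0 eqrXn2 // ?(ltW (odd_nat_gt0 _ _)) // eq_sym xo.
have -> : ((-1) ^+ i * o i * node_weight n i)^-1 =
   (-1) ^+ i * (o i * node_weight n i)^-1.
  by rewrite -mulrA [LHS]invfM invr_sign.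
by field; rewrite o0 w0 ox.
Qed.

Lemma alternating_sum_le (a : nat -> R) n :
  (forall i, 0 <= a i) -> (forall i, (i < n)%N -> a i.+1 <= a i) ->
  0 <= \sum_(i < n.+1) (-1) ^+ i * a i <= a 0.
Proof.
elim: n a => [|n IH] a a0 adec; first by rewrite big_ord_recl big_ord0 mul1r addr0 a0 lexx.
rewrite big_ord_recl mul1r.
have -> : \sum_(i < n.+1) (-1) ^+ lift ord0 i * a (lift ord0 i) =
  - \sum_(i < n.+1) (-1) ^+ i * a i.+1.
  by rewrite -sumrN; apply: eq_bigr => i _; rewrite lift0 exprS mulN1r mulNr.
have /andP[] := IH (fun i => a i.+1) (fun i => a0 i.+1) (fun i ilt => adec i.+1 ilt).
by have := adec 0 isT; lra.
Qed.

Definition sampling_sum n x : R := \sum_(i < n) (o i * `|o i - x|)^-1.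

Lemma norm_node_term n i x : (i <= n)%N -> 0 <= x -> x != o i ->
  `|(-1) ^+ i / node_weight n i * (o i / (o i ^+ 2 - x ^+ 2))| <=
  2 * (o i / ((o i + x) * `|o i - x|)).
Proof.
move=> ilt x0 xo; have o0 := odd_nat_gt0 R i.
have w2 := node_weight_ge ilt; have w0 := node_weight_gt0 n i.
rewrite normrM normrM normrX normrN1 expr1n mul1r.
have -> : o i ^+ 2 - x ^+ 2 = (o i + x) * (o i - x) by ring.
rewrite normfV (gtr0_norm w0) normrM normfV normrM (gtr0_norm o0).
rewrite (@gtr0_norm _ (o i + x)) ?ltr_wpDr //.
rewrite ler_wpM2r ?divr_ge0 ?mulr_ge0 ?addr_ge0 ?(ltW o0) //.
by rewrite -[2]invrK lef_pV2 ?posrE ?invr_gt0.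
Qed.

Lemma interpolation_bound p n x A : (size p <= n.+1)%N -> 0 <= x ->
  (forall i, x != o i) -> (forall i, (i <= n)%N -> `|p.[o i ^+ 2]| <= A / o i) ->
  `|p.[x ^+ 2]| <= 2 * A * `|oddprod x n.+1| * sampling_sum n.+1 x.
Proof.
move=> sp x0 xo pA; have A0 : 0 <= A.
  by have := le_trans (normr_ge0 _) (pA 0 (leq0n n)); rewrite odd_nat0 divr1.
rewrite (odd_interpolation sp) // (le_trans (ler_norm_sum _ _ _)) // /sampling_sum mulr_sumr.
apply: ler_sum => i _; have ilt : (i <= n)%N by rewrite -ltnS.
have o0 := odd_nat_gt0 R i.
have d0 : 0 < `|o i - x| by rewrite normr_gt0 subr_eq0 eq_sym.
have sx : 0 < o i + x by rewrite ltr_wpDr.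
rewrite normrM (normrM (oddprod x n.+1)) mulrCA.
rewrite [leRHS](_ : _ = `|oddprod x n.+1| * (2 * A * (o i * `|o i - x|)^-1)); last by ring.
rewrite ler_wpM2l //.
apply: (@le_trans _ _ (A / o i * (2 * (o i / ((o i + x) * `|o i - x|))))).
  by apply: ler_pM => //; [exact: pA | exact: norm_node_term].
have -> : A / o i * (2 * (o i / ((o i + x) * `|o i - x|))) =
  2 * A * ((o i + x) * `|o i - x|)^-1 by field; rewrite !gt_eqF.
rewrite ler_wpM2l ?mulr_ge0 // lef_pV2 ?posrE ?mulr_gt0 //.
by rewrite ler_wpM2r // lerDl.
Qed.

Lemma interpolation_limit p n x A L : (size p <= n.+1)%N -> 0 <= x -> 0 <= L ->
  (forall i, x != o i) -> (forall i, (i <= n)%N -> `|L - o i * p.[o i ^+ 2]| <= A / o i) ->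
  `|L - x * p.[x ^+ 2]| <=
    `|oddprod x n.+1| * (2 * L / (1 + x) + 2 * A * sampling_sum n.+1 x).
Proof.
move=> sp x0 L0 xo pA; have A0 : 0 <= A.
  by have := le_trans (normr_ge0 _) (pA 0 (leq0n n)); rewrite odd_nat0 divr1.
have := @odd_interpolation 1 n x; rewrite size_poly1 => /(_ isT x0 xo).
under eq_bigr do rewrite hornerC mul1r.
rewrite hornerC -mulr_sumr => E1.
rewrite (odd_interpolation sp) //.
pose c i := (-1) ^+ i / node_weight n i * (o i / (o i ^+ 2 - x ^+ 2)).
have -> : L - x * (\sum_(i < n.+1) p.[o i ^+ 2] * (oddprod x n.+1 * c i)) =
  oddprod x n.+1 * (L * (\sum_(i < n.+1) (-1) ^+ i * ((node_weight n i) * (o i + x))^-1)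
    + \sum_(i < n.+1) c i * (x / o i * (L - o i * p.[o i ^+ 2]))).
  have EL : L = oddprod x n.+1 * \sum_(i < n.+1) L * c i.
    by rewrite -mulr_sumr mulrCA -E1 mulr1.
  rewrite [in LHS]EL.
  have -> : x * \sum_(i < n.+1) p.[o i ^+ 2] * (oddprod x n.+1 * c i) =
    oddprod x n.+1 * \sum_(i < n.+1) x * p.[o i ^+ 2] * c i.
    by rewrite !mulr_sumr; apply: eq_bigr => i _; ring.
  rewrite -mulrBr; congr (_ * _); rewrite -sumrB [in RHS]mulr_sumr -big_split /=.
  apply: eq_bigr => i _; rewrite /c.
  have o0 := odd_nat_gt0 R i; have sx : 0 < o i + x by rewrite ltr_wpDr.
  have w0 := node_weight_gt0 n i.
  have dx : o i - x != 0 by rewrite subr_eq0 eq_sym.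
  have -> : o i ^+ 2 - x ^+ 2 = (o i + x) * (o i - x) by ring.
  by field; rewrite dx !gt_eqF.
rewrite normrM ler_wpM2l //; apply: le_trans (ler_normD _ _) _; apply: lerD.
  rewrite normrM (ger0_norm L0) [2 * L]mulrC -mulrA ler_wpM2l //.
  have ox0 i : 0 < o i + x by rewrite ltr_wpDr // odd_nat_gt0.
  have a0 i : 0 <= (node_weight n i * (o i + x))^-1.
    by rewrite invr_ge0 mulr_ge0 // ltW ?node_weight_gt0.
  have adec i : (i < n)%N ->
      (node_weight n i.+1 * (o i.+1 + x))^-1 <= (node_weight n i * (o i + x))^-1.
    move=> ilt; rewrite lef_pV2 ?posrE; try by apply: mulr_gt0; rewrite ?node_weight_gt0.
    apply: ler_pM (node_weight_mono ilt) _; rewrite ?ltW ?node_weight_gt0 //.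
    by rewrite odd_natS ltrD2r ltrDl.
  have /andP[s0 s1] := alternating_sum_le a0 adec.
  rewrite ger0_norm // (le_trans s1) // odd_nat0 invfM ler_wpM2r //.
    by rewrite invr_ge0 addr_ge0.
  by rewrite -[2]invrK lef_pV2 ?posrE ?invr_gt0 ?node_weight_gt0 ?node_weight_ge.
apply: le_trans (ler_norm_sum _ _ _) _; rewrite /sampling_sum mulr_sumr.
apply: ler_sum => i _; have ilt : (i <= n)%N by rewrite -ltnS.
have o0 := odd_nat_gt0 R i.
have d0 : 0 < `|o i - x| by rewrite normr_gt0 subr_eq0 eq_sym.
have sx : 0 < o i + x by rewrite ltr_wpDr.
apply: (@le_trans _ _ ((2 * (o i / ((o i + x) * `|o i - x|))) * (x / o i * (A / o i)))).
  rewrite normrM; apply: ler_pM => //; first exact: norm_node_term.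
  rewrite normrM ger0_norm ?divr_ge0 ?(ltW o0) // ler_wpM2l ?divr_ge0 ?(ltW o0) //.
  exact: pA.
have -> : (2 * (o i / ((o i + x) * `|o i - x|))) * (x / o i * (A / o i)) =
  2 * A * (o i * `|o i - x|)^-1 * (x / (o i + x)) by field; rewrite !gt_eqF.
by rewrite ler_piMr ?mulr_ge0 ?invr_ge0 ?mulr_ge0 ?(ltW o0) // ler_pdivrMr // mul1r lerDr ltW.
Qed.

End Sampling.

Section NodeValues.
Local Open Scope classical_set_scope.
Local Open Scope ring_scope.
Variable R : realType.
Implicit Types (x y A L : R) (i j n N k : nat).
Local Notation o := (@odd_nat R).

Definition odd_harmonic k : R := \sum_(j < k) (o j)^-1.

Lemma odd_harmonicD n k : odd_harmonic (n + k) =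
  odd_harmonic n + \sum_(j < k) (o (n + j))^-1.
Proof. by rewrite /odd_harmonic big_split_ord. Qed.

Lemma odd_harmonic_mono n k : odd_harmonic n <= odd_harmonic (n + k).
Proof.
by rewrite odd_harmonicD lerDl sumr_ge0 // => i _; rewrite invr_ge0 ltW ?odd_nat_gt0.
Qed.

Lemma odd_natD i j : o (i + j) = o i + 2 * j%:R.
Proof. by rewrite !odd_natE natrD; ring. Qed.

Lemma sampling_sum_le x n k : 0 <= x < 1 ->
  sampling_sum n (x + 2 * k.+1%:R) <=
  (1 + (2 * (1 - x))^-1) * (odd_harmonic k.+1 / k.+1%:R).
Proof.
move=> /andP[x0 x1]; set K := k.+1; set w := x + 2 * K%:R.
have K0 : 0 < K%:R :> R by rewrite ltr0n.
have w0 : 0 < w by rewrite /w ltr_wpDl ?mulr_gt0.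
have term_ge0 j : 0 <= (o j * `|o j - w|)^-1.
  by rewrite invr_ge0 mulr_ge0 // ltW ?odd_nat_gt0.
apply: (@le_trans _ _ (sampling_sum (K + n) w)).
  rewrite addnC /sampling_sum big_split_ord /= lerDl sumr_ge0 // => j _.
rewrite /sampling_sum big_split_ord /= mulrDl mul1r; apply: lerD.
  have -> : odd_harmonic K / K%:R = (2 * K%:R)^-1 * (\sum_(j < K) (o j)^-1 +
     \sum_(j < K) (o (rev_ord j))^-1).
    have <- : \sum_(j < K) (o j)^-1 = \sum_(j < K) (o (rev_ord j))^-1.
      by rewrite [LHS](reindex_inj rev_ord_inj).
    by rewrite /odd_harmonic; field; rewrite gt_eqF.
  rewrite -big_split /= mulr_sumr; apply: ler_sum => j _.
  have oj := odd_nat_gt0 R j; set r := o (K - j.+1).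
  have r0 : 0 < r := odd_nat_gt0 R _.
  have E : o j + r = 2 * K%:R.
    by rewrite /r !odd_natE natrB // -natr1; ring.
  have -> : `|o j - w| = r + x.
    have -> : o j - w = - (r + x) by rewrite /w -E; ring.
    by rewrite normrN ger0_norm // addr_ge0 // ltW.
  rewrite -E; have -> : (o j + r)^-1 * ((o j)^-1 + r^-1) = (o j * r)^-1.
    by field; rewrite !gt_eqF ?addr_gt0.
  rewrite lef_pV2 ?posrE ?mulr_gt0 ?ltr_wpDr // ler_wpM2l ?(ltW oj) //.
  by rewrite lerDl.
have x1' : 0 < 1 - x by rewrite subr_gt0.
apply: (@le_trans _ _ ((1 - x)^-1 * ((2 * K%:R)^-1 *
   \sum_(j < n) ((o j)^-1 - (o (K + j))^-1)))).
  rewrite !mulr_sumr; apply: ler_sum => j _ /=.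
  have oj := odd_nat_gt0 R j; have oj1 := odd_nat_ge1 R j.
  have -> : o (K + j) = o j + 2 * K%:R by rewrite addnC odd_natD.
  set a := o j in oj oj1 *; have a2 : 0 < a + 2 * K%:R by rewrite addr_gt0 ?mulr_gt0.
  have -> : (1 - x)^-1 * ((2 * K%:R)^-1 * (a^-1 - (a + 2 * K%:R)^-1)) =
    ((a + 2 * K%:R) * ((1 - x) * a))^-1 by field; rewrite !gt_eqF.
  have h : (1 - x) * a <= a + 2 * K%:R - w.
    by rewrite /w -subr_ge0; have := mulr_ge0 x0 (ltW oj); nra.
  have h0 : 0 < (1 - x) * a by rewrite mulr_gt0.
  rewrite ger0_norm; last by rewrite (le_trans (ltW h0)).
  by rewrite lef_pV2 ?posrE ?mulr_gt0 ?(lt_le_trans h0 h) // ler_wpM2l // ltW.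
rewrite sumrB.
have -> : \sum_(j < n) (o (K + j))^-1 = odd_harmonic (n + K) - odd_harmonic K.
  by rewrite addnC odd_harmonicD addrC addKr.
have -> : (2 * (1 - x))^-1 * (odd_harmonic K / K%:R) =
  (1 - x)^-1 * ((2 * K%:R)^-1 * odd_harmonic K) by field; rewrite !gt_eqF.
rewrite ler_wpM2l ?invr_ge0 ?(ltW x1') // ler_wpM2l ?invr_ge0 ?mulr_ge0 //.
by have := odd_harmonic_mono n K; rewrite {1}/odd_harmonic; lra.
Qed.

Lemma odd_harmonic_mean : (fun k => odd_harmonic k.+1 / k.+1%:R) @ \oo --> (0 : R).
Proof.
have h : (fun i => (o i)^-1) @ \oo --> (0 : R).
  apply: (@squeeze_cvgr _ _ _ _ (fun=> 0) (@harmonic R)); last 2 first.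
  - exact: cvg_cst.
  - exact: cvg_harmonic.
  near=> i; have o0 := odd_nat_gt0 R i.
  rewrite invr_ge0 (ltW o0) /= /harmonic /= lef_pV2 ?posrE // odd_natE -natr1.
  by have : 0 <= i%:R :> R by []; lra.
have := cesaro h; rewrite /arithmetic_mean.
under eq_fun do rewrite mulrC /series /= big_mkord -/(odd_harmonic _).
by [].
Unshelve. all: by end_near. Qed.

Lemma oddprod_node i d : oddprod (o i) (i.+1 + d) = 0.
Proof.
elim: d => [|d IH]; last by rewrite addnS oddprodS IH mul0r.
by rewrite addn0 oddprodS divff ?subrr ?mulr0 // expf_neq0 ?odd_nat_neq0.
Qed.

Lemma zsum_node_cst i d : zsum (o i) (i.+1 + d) = zsum (o i) i.+1.
Proof.
by elim: d => [|d IH]; rewrite ?addn0 // addnS zsumS oddprod_node mul0r addr0 IH.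
Qed.

Lemma zsum_node i : o i * zsum (o i) i.+1 = 2 * oddsq R i.+1 - (o i ^+ 2)^-1.
Proof.
elim: i => [|i IH]; first by rewrite /= odd_nat0 expr1n; field.
have o0 := odd_nat_gt0 R i.
have := zsum_shift i.+2 o0; rewrite -odd_natS.
have := oddprod_node i 1; rewrite addn1 => ->.
have := oddprod_node i.+1 0; rewrite addn0 => ->.
have := zsum_node_cst i 1; rewrite addn1 => ->.
move=> /eqP; rewrite subr_eq => /eqP ->; rewrite IH odd_natS.
rewrite (oddsqS R i.+1) (oddsqS R i) !odd_natS.
by field; rewrite !gt_eqF ?addr_gt0.
Qed.

Lemma odd_cube_telescope i : (o i ^+ 3)^-1 <= 2 * ((o i ^+ 2)^-1 - (o i.+1 ^+ 2)^-1).
Proof.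
have o1 := odd_nat_ge1 R i; rewrite odd_natS; set a := o i in o1 *.
have a0 : 0 < a by lra.
rewrite -subr_ge0.
have -> : 2 * ((a ^+ 2)^-1 - ((a + 2) ^+ 2)^-1) - (a ^+ 3)^-1 =
  (7 * a ^+ 2 + 4 * (a - 1)) / (a ^+ 3 * (a + 2) ^+ 2).
  by field; rewrite !gt_eqF ?addr_gt0.
rewrite divr_ge0 ?mulr_ge0 ?exprn_ge0 ?addr_ge0 ?sqr_ge0 ?mulr_ge0 ?subr_ge0 //.
all: lra.
Qed.

Lemma node_factor i j : (i <= j)%N -> 0 <= 1 - o i ^+ 2 / o j ^+ 2 <= 1.
Proof.
move=> ij; have oj := odd_nat_gt0 R j; have oi := odd_nat_gt0 R i.
rewrite gerBl divr_ge0 ?sqr_ge0 // andbT subr_ge0 ler_pdivrMr ?exprn_gt0 // mul1r.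
rewrite ler_pXn2r ?nnegrE ?(ltW oi) ?(ltW oj) //.
by rewrite !odd_natE lerD2r ler_wpM2l // ler_nat.
Qed.

Lemma wsum_node i d : 0 <= wsum (o i) (i.+1 + d) <=
  2 * ((o i ^+ 2)^-1 - (o (i.+1 + d) ^+ 2)^-1).
Proof.
elim: d => [|d IH].
  rewrite addn0 wsumS divff ?subrr ?mul0r ?add0r ?expf_neq0 ?odd_nat_neq0 //.
  by rewrite invr_odd_ge0 odd_cube_telescope.
rewrite addnS; set j := (i.+1 + d)%N in IH *.
have ij : (i <= j)%N by rewrite /j; lia.
have /andP[f0 f1] := node_factor ij; have := odd_cube_telescope j.
have := invr_odd_ge0 R j 3; move: IH => /andP[w0 w1]; rewrite wsumS.
set f := 1 - _ in f0 f1 *; set w := wsum _ _ in w0 w1 *.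
have := ler_piMl w0 f1; have := mulr_ge0 f0 w0; lra.
Qed.

Lemma wsum_node_le i d : 0 <= wsum (o i) (i.+1 + d) <= 2 / o i ^+ 2.
Proof.
have /andP[-> /le_trans->//] := wsum_node i d.
by rewrite ler_wpM2l // gerBl invr_odd_ge0.
Qed.

Lemma tsum_node i d : 0 <= tsum (o i) (i.+1 + d) - tsum (o i) i.+1 <=
  4 / o i ^+ 2 * ((o i.+1 ^+ 2)^-1 - (o (i.+1 + d) ^+ 2)^-1).
Proof.
elim: d => [|d IH]; first by rewrite addn0 !subrr mulr0 lexx.
rewrite addnS; set j := (i.+1 + d)%N in IH *.
have /andP[w0 w1] := wsum_node_le i d; rewrite -/j in w0 w1.
have c := odd_cube_telescope j; have c0 := invr_odd_ge0 R j 3.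
have h0 := mulr_ge0 w0 c0.
have h1 : wsum (o i) j / o j ^+ 3 <= 2 / o i ^+ 2 * (2 * ((o j ^+ 2)^-1 - (o j.+1 ^+ 2)^-1)).
  exact: ler_pM.
move: IH h1; rewrite (tsumS _ j); lra.
Qed.

Definition tnode i : R := o i ^+ 2 * tsum (o i) i.+1.

Lemma tnode_near i d :
  0 <= o i ^+ 2 * tsum (o i) (i.+1 + d) - tnode i <= 4 / o i ^+ 2.
Proof.
have /andP[t0 t1] := tsum_node i d; have o2 := exprn_gt0 2 (odd_nat_gt0 R i).
rewrite /tnode -mulrBr mulr_ge0 ?(ltW o2) //= -ler_pdivlMl // (le_trans t1) //.
rewrite [leRHS]mulrC ler_wpM2l ?divr_ge0 ?(ltW o2) //.
apply: (@le_trans _ _ (o i.+1 ^+ 2)^-1); first by rewrite gerBl invr_odd_ge0.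
rewrite lef_pV2 ?posrE ?exprn_gt0 ?odd_nat_gt0 // ler_pXn2r ?nnegrE //; try exact: ltW (odd_nat_gt0 R _).
by rewrite odd_natS lerDl.
Qed.

Lemma tnode_step i : `|tnode i.+1 - tnode i| <= 30 / o i ^+ 2.
Proof.
have /andP[n0 n1] := tnode_near i 1; rewrite addn1 in n0 n1.
have x1 := odd_nat_ge1 R i.
have := tsum_shift i.+2 (odd_nat_gt0 R i); rewrite -odd_natS -/(tnode i.+1).
have := oddprod_node i 1; rewrite addn1 => ->.
have /andP[y0 y1] := wsum_node_le i 1; rewrite addn1 in y0 y1.
have /andP[Y0 Y1] := wsum_node_le i.+1 0; rewrite addn0 in Y0 Y1.
have z1 : 0 <= zsum (o i) i.+2 <= 3 / o i.
  have := zsum_node_cst i 1; rewrite addn1 => ->.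
  have -> : zsum (o i) i.+1 = (2 * oddsq R i.+1 - (o i ^+ 2)^-1) / o i.
    by rewrite -zsum_node; field; rewrite odd_nat_neq0.
  have := oddsq_le R i.+1; have := oddsq_ge0 R i; rewrite oddsqS.
  have := invr_odd_ge0 R i 2; set q := (_ ^-1); set s := oddsq _ _ => q0 s0 sq.
  rewrite divr_ge0 ?(ltW (odd_nat_gt0 R i)) ?ler_pM2r ?invr_gt0 ?odd_nat_gt0 //=; lra.
have s0 := oddsq_ge0 R i.+2; have s1 := oddsq_le R i.+2.
move: n0 n1 y0 y1 Y0 Y1 z1 s0 s1; rewrite !odd_natS.
set x := o i in x1 *; set y := wsum x _; set Y := wsum (x + 2) _.
set z := zsum x _; set s := oddsq _ _; set S1 := tsum x _ => n0 n1 y0 y1 Y0 Y1 /andP[z0 z1] s0 s1.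
clearbody y Y z s S1; clearbody x.
have x0 : 0 < x by lra.
have u0 : 0 < x^-1 by rewrite invr_gt0.
have u2 : 0 < (x ^+ 2)^-1 by rewrite invr_gt0 exprn_gt0.
have w0 : 0 < x + 2 by lra.
have h : x / (x + 2) ^+ 2 <= x^-1.
  rewrite -subr_ge0.
  have -> : x^-1 - x / (x + 2) ^+ 2 = (4 * x + 4) / (x * (x + 2) ^+ 2).
    by field; rewrite !gt_eqF.
  by rewrite divr_ge0 ?mulr_ge0 ?exprn_ge0 ?(ltW x0) ?(ltW w0) //; lra.
have t1 : 0 <= z * (x^-1 + x / (x + 2) ^+ 2) <= 6 / x ^+ 2.
  have h0 : 0 <= x / (x + 2) ^+ 2 by rewrite divr_ge0 ?exprn_ge0 // ltW.
  rewrite mulr_ge0 ?addr_ge0 ?(ltW u0) //=.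
  have -> : 6 / x ^+ 2 = 3 / x * (2 / x) by field; rewrite gt_eqF.
  by apply: ler_pM => //; rewrite ?addr_ge0 ?(ltW u0) //; lra.
have t2 : `|y * (- x^-1 + x / (x + 2) ^+ 2)| <= 2 / x ^+ 2.
  have h0 : 0 <= x / (x + 2) ^+ 2 by rewrite divr_ge0 ?exprn_ge0 // ltW.
  have h1 : x^-1 <= 1 by rewrite invf_le1.
  rewrite normrM (ger0_norm y0) -[leRHS]mulr1; apply: ler_pM => //.
  by rewrite ler_norml; lra.
have t3 : 0 <= 2 / (x ^+ 2 * (x + 2) ^+ 2) <= 2 / x ^+ 2.
  rewrite divr_ge0 ?mulr_ge0 ?exprn_ge0 ?(ltW x0) ?(ltW w0) //= ler_wpM2l //.
  rewrite lef_pV2 ?posrE ?mulr_gt0 ?exprn_gt0 // ler_peMr ?exprn_ge0 ?(ltW x0) //.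
  by rewrite exprn_ege1 //; lra.
have t4 : 0 <= s * ((x ^+ 2)^-1 - ((x + 2) ^+ 2)^-1) <= 3 / 2 / x ^+ 2.
  have h' : ((x + 2) ^+ 2)^-1 <= (x ^+ 2)^-1.
    by rewrite lef_pV2 ?posrE ?exprn_gt0 // ler_pXn2r ?nnegrE ?(ltW x0) ?(ltW w0) // lerDl.
  have h0 : 0 < ((x + 2) ^+ 2)^-1 by rewrite invr_gt0 exprn_gt0.
  by rewrite mulr_ge0 ?subr_ge0 //=; apply: ler_pM => //; lra.
have t5 : `|((x + 2) ^+ 2 + x ^+ 2) * 2 * (x + 1) / (x ^+ 2 * (x + 2)) *
    (((x + 2) ^+ 3)^-1 * ((1 - 0) / x - (1 + x)^-1)
      - (1 - 0) / ((x + 2) ^+ 2 * x ^+ 2))| <= 8 / x ^+ 2.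
  have -> : ((x + 2) ^+ 2 + x ^+ 2) * 2 * (x + 1) / (x ^+ 2 * (x + 2)) *
    (((x + 2) ^+ 3)^-1 * ((1 - 0) / x - (1 + x)^-1)
      - (1 - 0) / ((x + 2) ^+ 2 * x ^+ 2)) =
    - (2 * ((x + 2) ^+ 2 + x ^+ 2) * ((x + 1) * (x + 2) - x) /
       (x ^+ 4 * (x + 2) ^+ 4)).
    by field; rewrite !gt_eqF // addr_gt0.
  have hA : 0 <= (x + 1) * (x + 2) - x by nra.
  rewrite normrN ger0_norm; last first.
    apply: divr_ge0; last by rewrite mulr_ge0 ?exprn_ge0 ?(ltW x0) ?(ltW w0).
    by apply: mulr_ge0 => //; rewrite mulr_ge0 ?addr_ge0 ?sqr_ge0.
  rewrite ler_pdivrMr ?mulr_gt0 ?exprn_gt0 //.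
  have -> : 8 / x ^+ 2 * (x ^+ 4 * (x + 2) ^+ 4) = 8 * (x ^+ 2 * (x + 2) ^+ 2) * (x + 2) ^+ 2.
    by field; rewrite gt_eqF.
  have h1 : (x + 2) ^+ 2 + x ^+ 2 <= 2 * (x + 2) ^+ 2 by nra.
  have h2 : 0 <= (x + 1) * (x + 2) - x <= 2 * (x ^+ 2 * (x + 2) ^+ 2).
    by apply/andP; split; nra.
  have -> : 8 * (x ^+ 2 * (x + 2) ^+ 2) * (x + 2) ^+ 2 =
    2 * (2 * (x + 2) ^+ 2) * (2 * (x ^+ 2 * (x + 2) ^+ 2)) by ring.
  have /andP[h20 h21] := h2.
  apply: ler_pM => //; first by rewrite mulr_ge0 ?addr_ge0 ?sqr_ge0.
  by rewrite ler_wpM2l.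
have t6 : 0 <= 2 * (x + 1) / (x + 2) ^+ 2 * ((x + 2) ^+ 2 * Y + (x + 2)^-1)
      / ((x + 2) * (x + 2 + 2 + x)) <= 6 / x ^+ 2.
  have h0 : 0 <= (x + 2) ^+ 2 * Y by rewrite mulr_ge0 ?sqr_ge0.
  have h1 : (x + 2) ^+ 2 * Y <= 2.
    by rewrite mulrC -ler_pdivlMr ?exprn_gt0.
  have h2 : 0 < (x + 2)^-1 <= 1 by rewrite invr_gt0 w0 invf_le1 //; lra.
  have /andP[h20 h21] := h2.
  have h3 : 0 <= (x + 2) ^+ 2 * Y + (x + 2)^-1 <= 3 by lra.
  have /andP[h30 h31] := h3.
  set V := _ + (x + 2)^-1 in h30 h31 *; clearbody V; clear h3.
  have -> : 2 * (x + 1) / (x + 2) ^+ 2 * V / ((x + 2) * (x + 2 + 2 + x)) =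
    V * ((x + 1) / ((x + 2) ^+ 4)).
    by field; rewrite ?gt_eqF //; lra.
  rewrite mulr_ge0 ?divr_ge0 ?exprn_ge0 ?(ltW w0) ?addr_ge0 ?(ltW x0) //=.
  apply: (@le_trans _ _ (3 * (x ^+ 2)^-1)); last by lra.
  apply: ler_pM => //; first by rewrite divr_ge0 ?exprn_ge0 ?(ltW w0) ?addr_ge0 ?(ltW x0).
  rewrite ler_pdivrMr ?exprn_gt0 // mulrC ler_pdivlMr ?exprn_gt0 //.
  have : x ^+ 2 <= (x + 2) ^+ 2 by rewrite ler_pXn2r ?nnegrE ?(ltW x0) ?(ltW w0) // lerDl.
  have : x + 1 <= (x + 2) ^+ 2 by nra.
  have -> : (x + 2) ^+ 4 = (x + 2) ^+ 2 * (x + 2) ^+ 2 by ring.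
  by move=> ? ?; apply: ler_pM; rewrite ?sqr_ge0 ?addr_ge0 ?(ltW x0).
move: t1 t2 t3 t4 t5 t6 n0 n1.
rewrite !ler_norml => /andP[a1 b1] /andP[a2 b2] /andP[a3 b3] /andP[a4 b4] /andP[a5 b5] /andP[a6 b6] n0 n1 E.
by apply/andP; split; lra.
Qed.

Definition tnode_lim := limn tnode.

Lemma tnode_dist i d : `|tnode_lim - o i ^+ 2 * tsum (o i) (i.+1 + d)| <= 49 / o i.
Proof.
have [_ /(_ i)] := cvg_oddsq_dom tnode_step; rewrite -/tnode_lim.
have := tnode_near i d; have o1 := odd_nat_ge1 R i; have o0 := odd_nat_gt0 R i.
have : 4 / o i ^+ 2 <= 4 / o i.
  by rewrite ler_wpM2l // lef_pV2 ?posrE ?exprn_gt0 // expr2 ler_peMr // ltW.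
rewrite !ler_norml; lra.
Qed.

End NodeValues.

Section LimitsAlong.
Local Open Scope classical_set_scope.
Local Open Scope ring_scope.
Variable R : realType.
Implicit Types (x y A L : R) (i j n N k : nat).
Local Notation o := (@odd_nat R).

Lemma oddprod_lim_shiftn x k : 0 < x ->
  oddprod_lim (x + 2 * k%:R) = (-1) ^+ k * oddprod_lim x.
Proof.
move=> x0; elim: k => [|k IH]; first by rewrite mulr0 addr0 mul1r.
have -> : x + 2 * k.+1%:R = (x + 2 * k%:R) + 2 by rewrite -natr1; ring.
by rewrite oddprod_lim_shift ?ltr_wpDr ?mulr_ge0 // IH exprS mulN1r mulNr.
Qed.

Lemma shifted_neq_odd x k i : 0 < x < 1 -> x + 2 * k%:R != o i.
Proof.
move=> /andP[x0 x1]; rewrite odd_natE; case: (leqP k i) => ki.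
  have : k%:R <= i%:R :> R by rewrite ler_nat.
  by move=> ?; rewrite lt_eqF //; lra.
have : i.+1%:R <= k%:R :> R by rewrite ler_nat.
by rewrite -natr1 => ?; rewrite gt_eqF //; lra.
Qed.

Definition sampling_rate x k : R := (1 + (2 * (1 - x))^-1) * (odd_harmonic R k.+1 / k.+1%:R).

Lemma cvg_sampling_rate x : sampling_rate x @ \oo --> (0 : R).
Proof.
rewrite /sampling_rate -(mulr0 (1 + (2 * (1 - x))^-1)).
by apply: cvgM; [exact: cvg_cst | exact: odd_harmonic_mean].
Qed.

Lemma cvg_bound0 x (u : nat -> R) (L a b : R) : 0 < x ->
  (forall k, `|L - u k| <= a * (b / (1 + (x + 2 * k.+1%:R)) + 8 * sampling_rate x k)) ->
  u @ \oo --> L.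
Proof.
move=> x0 uL.
have c0 : (fun k => (1 + (x + 2 * k.+1%:R))^-1) @ \oo --> (0 : R).
  apply: (@squeeze_cvgr _ _ _ _ (fun=> 0) (@harmonic R)); last 2 first.
  - exact: cvg_cst.
  - exact: cvg_harmonic.
  near=> k; have k0 : 0 < k.+1%:R :> R by [].
  have d0 : 0 < 1 + (x + 2 * k.+1%:R) by rewrite ?addr_gt0 ?mulr_gt0.
  rewrite invr_ge0 (ltW d0) /= /harmonic /= lef_pV2 ?posrE //; lra.
have c1 : (fun k => a * (b / (1 + (x + 2 * k.+1%:R)) + 8 * sampling_rate x k)) @ \oo
    --> a * (b * 0 + 8 * 0).
  apply: cvgM; first exact: cvg_cst.
  apply: cvgD; first by apply: cvgM => //; exact: cvg_cst.
  by apply: cvgM (cvg_sampling_rate x); exact: cvg_cst.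
rewrite !mulr0 addr0 mulr0 in c1.
have c2 : (fun k => `|L - u k|) @ \oo --> (0 : R).
  apply: (squeeze_cvgr _ _ c1); last exact: cvg_cst.
  by near=> k; rewrite normr_ge0 uL.
have c3 : (fun k => L - u k) @ \oo --> (0 : R) by apply/norm_cvg0P.
have -> : u = (fun k => L - (L - u k)) by apply/funext => k; rewrite subKr.
have : (fun k => L - (L - u k)) @ \oo --> L - 0 by apply: cvgB c3; exact: cvg_cst.
by rewrite subr0.
Unshelve. all: by end_near. Qed.

Lemma limit_oddprod_bound x (f : nat -> R) (F L a B : R) : 0 <= B ->
  f @ \oo --> F ->
  (forall n, `|L - a * f n.+1| <= `|oddprod x n.+1| * B) ->
  `|L - a * F| <= `|oddprod_lim x| * B.
Proof.
move=> B0 fF H.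
have c1 : (fun n => `|L - a * f n|) @ \oo --> `|L - a * F|.
  apply: cvg_norm; apply: cvgB; first exact: cvg_cst.
  by apply: cvgM => //; exact: cvg_cst.
have c2 : (fun n => `|oddprod x n| * B) @ \oo --> `|oddprod_lim x| * B.
  by apply: cvgM; [apply: cvg_norm; exact: cvg_oddprod | exact: cvg_cst].
apply: ler_cvg_to c1 c2 _; near=> n.
have n0 : (0 < n)%N by near: n; exists 1%N.
by rewrite -(prednK n0).
Unshelve. all: by end_near. Qed.

Section Along.
Variable x : R.
Hypothesis x01 : 0 < x < 1.
Let xk k := x + 2 * k.+1%:R.

Let xk_gt0 k : 0 < xk k.
Proof. by have /andP[x0 _] := x01; rewrite /xk ltr_wpDr ?mulr_ge0. Qed.

Let xk_neq k i : xk k != o i. Proof. exact: shifted_neq_odd. Qed.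

Let rate_ge0 k : 0 <= sampling_rate x k.
Proof.
have /andP[x0 x1] := x01.
rewrite mulr_ge0 ?addr_ge0 ?invr_ge0 ?mulr_ge0 ?divr_ge0 ?sumr_ge0 ?subr_ge0 ?(ltW x1) //.
by move=> i _; rewrite invr_ge0 ltW ?odd_nat_gt0.
Qed.

Let bound_ge0 b k : 0 <= b -> 0 <= b / (1 + xk k) + 8 * sampling_rate x k.
Proof.
move=> b0; apply: addr_ge0; last exact: mulr_ge0.
by apply: divr_ge0 => //; apply: addr_ge0 => //; exact: ltW.
Qed.

Let sampling_le n k : sampling_sum n (xk k) <= sampling_rate x k.
Proof. by have /andP[x0 x1] := x01; apply: sampling_sum_le; rewrite ltW. Qed.

Lemma cvg_zlim_along : (fun k => xk k * zlim (xk k)) @ \oo --> 2 * oddsq_lim R.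
Proof.
have /andP[x0 x1] := x01; have [_ sq] := @oddsq_cvg R.
have L0 : 0 <= 2 * oddsq_lim R.
  rewrite mulr_ge0 //; apply: (@cvgn_ge _ (oddsq R) _ _ 0); first exact: cvg_oddsq.
  by move=> i _; exact: oddsq_ge0.
apply: (@cvg_bound0 x _ _ `|oddprod_lim x| (2 * (2 * oddsq_lim R)) x0) => k.
have -> : `|oddprod_lim x| = `|oddprod_lim (xk k)|.
  by rewrite /xk oddprod_lim_shiftn // normrM normrX normrN1 expr1n mul1r.
apply: (@limit_oddprod_bound _ (zsum (xk k))).
- by apply: bound_ge0; exact: mulr_ge0.
- exact: cvg_zsum.
move=> n; rewrite -horner_zpoly.
apply: le_trans (@interpolation_limit _ (zpoly _ n.+1) n (xk k) 4 _ _ _ L0 _ _) _.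
- exact: size_zpoly.
- exact: ltW.
- exact: xk_neq.
- move=> i ilt; rewrite horner_zpoly -(subnKC ilt) -addSn zsum_node_cst zsum_node.
  have o0 := odd_nat_gt0 R i; have o1 := odd_nat_ge1 R i.
  have -> : 2 * oddsq_lim R - (2 * oddsq R i.+1 - o i ^- 2) =
     2 * (oddsq_lim R - oddsq R i.+1) + o i ^- 2 by ring.
  have h1 : (o i ^+ 2)^-1 <= (o i)^-1.
    by rewrite lef_pV2 ?posrE ?exprn_gt0 // expr2 ler_peMr // ltW.
  have h2 : 3 / 2 / o i.+1 <= 3 / 2 / o i.
    by rewrite ler_wpM2l ?lef_pV2 ?posrE ?odd_nat_gt0 // odd_natS lerDl.
  have := sq i.+1; have := invr_odd_ge0 R i 2; rewrite -/(oddsq_lim R).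
  by rewrite !ler_norml; lra.
rewrite ler_wpM2l // lerD2l; have := sampling_le n.+1 k; lra.
Qed.

Lemma cvg_wlim_along : (fun k => xk k * wlim (xk k)) @ \oo --> (0 : R).
Proof.
have /andP[x0 x1] := x01.
apply: (@cvg_bound0 x _ _ `|oddprod_lim x| (2 * 0) x0) => k.
have -> : `|oddprod_lim x| = `|oddprod_lim (xk k)|.
  by rewrite /xk oddprod_lim_shiftn // normrM normrX normrN1 expr1n mul1r.
apply: (@limit_oddprod_bound _ (wsum (xk k))).
- by apply: bound_ge0; exact: mulr_ge0.
- exact: cvg_wsum.
move=> n; rewrite -horner_wpoly.
apply: le_trans (@interpolation_limit _ (wpoly _ n.+1) n (xk k) 4 _ _ _ (lexx _) _ _) _.
- exact: size_wpoly.
- exact: ltW.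
- exact: xk_neq.
- move=> i ilt; rewrite horner_wpoly -(subnKC ilt) -addSn sub0r normrN.
  have o0 := odd_nat_gt0 R i; have /andP[w0 w1] := wsum_node_le R i (n - i).
  rewrite ger0_norm ?mulr_ge0 ?(ltW o0) //.
  apply: (@le_trans _ _ (o i * (2 / o i ^+ 2))); first by rewrite ler_wpM2l ?(ltW o0).
  have -> : o i * (2 / o i ^+ 2) = 2 / o i by field; rewrite gt_eqF.
  by rewrite ler_wpM2r ?invr_ge0 ?(ltW o0) // ler_nat.
rewrite ler_wpM2l // lerD2l; have := sampling_le n.+1 k; lra.
Qed.

Lemma cvg_tlim_along : (fun k => xk k ^+ 2 * tlim (xk k)) @ \oo --> tnode_lim R.
Proof.
have /andP[x0 x1] := x01.
apply: (@cvg_bound0 x _ _ (`|oddprod_lim x| * (49 / 4)) 0 x0) => k.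
have -> : `|oddprod_lim x| = `|oddprod_lim (xk k)|.
  by rewrite /xk oddprod_lim_shiftn // normrM normrX normrN1 expr1n mul1r.
rewrite [leRHS](_ : _ = `|oddprod_lim (xk k)| * (49 / 4 * (8 * sampling_rate x k))); last first.
  by rewrite mul0r add0r -[LHS]mulrA.
apply: (@limit_oddprod_bound _ (tsum (xk k))).
- by apply: mulr_ge0 => //; exact: mulr_ge0.
- exact: cvg_tsum.
move=> n; rewrite -horner_tpoly.
pose p := 'X * tpoly R n.+1 - (tnode_lim R)%:P.
have E y : p.[y] = y * (tpoly R n.+1).[y] - tnode_lim R.
  by rewrite /p hornerD hornerN hornerM hornerX hornerC.
rewrite distrC -E; apply: le_trans (@interpolation_bound _ p n (xk k) 49 _ _ _ _) _.
- rewrite /p (leq_trans (size_polyD _ _)) // geq_max size_polyN.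
  rewrite (leq_trans (size_polyC_leq1 _)) // andbT.
  apply: (leq_trans (size_polyMleq _ _)); rewrite size_polyX.
  by have := size_tpoly R n.+1; rewrite /=; lia.
- exact: ltW.
- exact: xk_neq.
- move=> i ilt; rewrite E horner_tpoly -(subnKC ilt) -addSn distrC.
  exact: tnode_dist.
have h := sampling_le n.+1 k.
have -> : 2 * 49 * `|oddprod (xk k) n.+1| * sampling_sum n.+1 (xk k) =
  `|oddprod (xk k) n.+1| * (2 * 49 * sampling_sum n.+1 (xk k)) by ring.
rewrite ler_wpM2l //; lra.
Qed.

End Along.
End LimitsAlong.

(** * The trigamma function and the cosine product *)

Section Trigamma.
Local Open Scope classical_set_scope.
Local Open Scope ring_scope.
Variable R : realType.
Implicit Types (x y t A L : R) (i j n N k : nat).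
Local Notation o := (@odd_nat R).

Lemma mvt_ge0 (f df : R -> R) t : 0 <= t -> (forall u : R, is_derive u 1 f (df u)) ->
  (forall u, 0 <= u <= t -> 0 <= df u) -> f 0 <= f t.
Proof.
move=> t0 fdf df0.
have fd (u : R) : u \in `]0, t[%R -> is_derive u 1 f (df u) by move=> _; exact: fdf.
have fc : {within `[0, t], continuous f}.
  apply: continuous_subspaceT => u; apply/differentiable_continuous/derivable1_diffP.
  by have [] := fdf u.
have [c ct E] := MVT_segment t0 fd fc.
by rewrite -subr_ge0 E subr0 mulr_ge0 // df0 //; move: ct; rewrite in_itv.
Qed.

Lemma sin_le t : 0 <= t -> sin t <= t.
Proof.
move=> t0; have := @mvt_ge0 (fun u => u - sin u) (fun u => 1 - cos u) t t0 _ _.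
rewrite sin0 subrr subr_ge0; apply.
by move=> u _; rewrite subr_ge0 cos_le1.
Qed.

Lemma mul_cos_le_sin t : 0 <= t <= pi -> t * cos t <= sin t.
Proof.
move=> /andP[t0 tpi].
have := @mvt_ge0 (fun u => sin u - u * cos u) (fun u => u * sin u) t t0 _ _.
rewrite sin0 mul0r subrr subr_ge0; apply.
  move=> u; have D1 : is_derive u (1 : R) (id : R -> R) 1 by exact: is_derive_id.
  have D := is_deriveB (is_derive_sin u) (is_deriveM D1 (is_derive_cos u)).
  apply: is_derive_eq D _; rewrite /GRing.scale /=; ring.
move=> u /andP[u0 ut]; rewrite mulr_ge0 // sin_ge0_pi // u0 (le_trans ut) //.
Qed.

Lemma sin_sqr_bounds t : 0 < t <= pi / 2 -> 0 <= (sin t ^+ 2)^-1 - (t ^+ 2)^-1 <= 1.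
Proof.
move=> /andP[t0 th].
have s0 : 0 < sin t by apply: sin_gt0_pi; rewrite t0 (le_lt_trans th) //; have := @pi_gt0 R; lra.
have st := sin_le (ltW t0).
have ct : t * cos t <= sin t by apply: mul_cos_le_sin; have := @pi_gt0 R; lra.
have c0 : 0 <= cos t by apply: cos_ge0_pihalf; have := @pi_gt0 R; lra.
have h : t ^+ 2 * cos t ^+ 2 <= sin t ^+ 2.
  by rewrite -exprMn ler_pXn2r ?nnegrE ?mulr_ge0 ?(ltW t0) ?(ltW s0).
have h2 : sin t ^+ 2 <= t ^+ 2 by rewrite ler_pXn2r ?nnegrE ?(ltW t0) ?(ltW s0).
have -> : (sin t ^+ 2)^-1 - (t ^+ 2)^-1 = (t ^+ 2 - sin t ^+ 2) / (sin t ^+ 2 * t ^+ 2).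
  by field; rewrite !gt_eqF.
have d0 : 0 < sin t ^+ 2 * t ^+ 2 by rewrite mulr_gt0 ?exprn_gt0.
apply/andP; split; first by rewrite divr_ge0 ?subr_ge0 // ltW.
rewrite ler_pdivrMr // mul1r.
have := cos2sin2 t => C; rewrite C in h; nra.
Qed.

Definition trigamma_sum y n : R := \sum_(k < n) ((k%:R + y) ^+ 2)^-1.
Definition trigamma y := limn (trigamma_sum y).

Lemma trigamma_sumS y n : trigamma_sum y n.+1 = trigamma_sum y n + ((n%:R + y) ^+ 2)^-1.
Proof. by rewrite /trigamma_sum big_ord_recr. Qed.

Lemma trigamma_sum_recl y n : trigamma_sum y n.+1 = (y ^+ 2)^-1 + trigamma_sum (y + 1) n.
Proof.
rewrite /trigamma_sum big_ord_recl add0r; congr (_ + _); apply: eq_bigr => k _.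
by rewrite lift0 -natr1 -addrA [1 + y]addrC.
Qed.

Lemma trigamma_sum_mono y : nondecreasing_seq (trigamma_sum y).
Proof.
apply/nondecreasing_seqP => n; rewrite trigamma_sumS lerDl invr_ge0 sqr_ge0 //.
Qed.

Lemma trigamma_sum_ge0 y n : 0 <= trigamma_sum y n.
Proof. by rewrite sumr_ge0 // => k _; rewrite invr_ge0 sqr_ge0. Qed.

Lemma trigamma_sum_le y n : 0 < y -> trigamma_sum y n <= (y ^+ 2)^-1 + y^-1.
Proof.
move=> y0; have : trigamma_sum (y + 1) n <= y^-1 - (n%:R + y)^-1.
  elim: n => [|n IH]; first by rewrite /trigamma_sum big_ord0 add0r subrr.
  rewrite trigamma_sumS; set a : R := n%:R + y in IH *.
  have a0 : 0 < a by rewrite ltr_wpDl.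
  have -> : n.+1%:R + y = a + 1 by rewrite -natr1 /a; ring.
  have -> : n%:R + (y + 1) = a + 1 by rewrite /a; ring.
  have : ((a + 1) ^+ 2)^-1 <= a^-1 - (a + 1)^-1.
    clearbody a; have a1 : 0 < a + 1 by rewrite addr_gt0.
    have -> : a^-1 - (a + 1)^-1 = (a * (a + 1))^-1 by field; rewrite !gt_eqF.
    rewrite lef_pV2 ?posrE ?exprn_gt0 ?mulr_gt0 // expr2 ler_pM2r //.
    by rewrite lerDl.
  by move: IH; lra.
have : 0 <= (n%:R + y)^-1 by rewrite invr_ge0 addr_ge0 // ltW.
move=> h0 h1; apply: le_trans (trigamma_sum_mono _ (leqnSn n)) _.
by rewrite trigamma_sum_recl lerD2l; lra.
Qed.

Lemma cvg_trigamma y : 0 < y -> trigamma_sum y @ \oo --> trigamma y.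
Proof.
move=> y0; apply: nondecreasing_is_cvgn; first exact: trigamma_sum_mono.
by exists ((y ^+ 2)^-1 + y^-1) => _ [n _ <-]; exact: trigamma_sum_le.
Qed.

Lemma trigamma_ge0 y : 0 < y -> 0 <= trigamma y.
Proof.
by move=> y0; apply: (cvgn_ge (k := 0)) (cvg_trigamma y0) _ => n _; exact: trigamma_sum_ge0.
Qed.

Lemma trigamma_le y : 0 < y -> trigamma y <= (y ^+ 2)^-1 + y^-1.
Proof.
by move=> y0; apply: (cvgn_le (k := 0)) (cvg_trigamma y0) _ => n _; exact: trigamma_sum_le.
Qed.

Lemma trigamma_shift y : 0 < y -> trigamma y = (y ^+ 2)^-1 + trigamma (y + 1).
Proof.
move=> y0; have y10 : 0 < y + 1 by rewrite addr_gt0.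
have c1 : (fun n => trigamma_sum y n.+1) @ \oo --> trigamma y.
  by rewrite (cvg_shiftS (trigamma_sum y)); exact: cvg_trigamma.
have c2 : (fun n => trigamma_sum y n.+1) @ \oo --> (y ^+ 2)^-1 + trigamma (y + 1).
  under eq_fun do rewrite trigamma_sum_recl.
  by apply: cvgD; [exact: cvg_cst | exact: cvg_trigamma].
exact: cvg_unique c1 c2.
Qed.

Lemma trigamma_sum_duplication y n : 0 < y ->
  trigamma_sum (y / 2) n + trigamma_sum ((y + 1) / 2) n = 4 * trigamma_sum y (n + n).
Proof.
move=> y0; elim: n => [|n IH]; first by rewrite /trigamma_sum !big_ord0 addr0 mulr0.
rewrite addnS addSn !trigamma_sumS addrACA IH -[(n + n).+1%:R]natr1.
rewrite [(n + n)%:R]natrD -addrA mulrDr; congr (_ + _).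
have n0 : 0 <= n%:R :> R by [].
by field; rewrite !gt_eqF //; lra.
Qed.

Lemma trigamma_duplication y : 0 < y ->
  trigamma (y / 2) + trigamma ((y + 1) / 2) = 4 * trigamma y.
Proof.
move=> y0.
have c1 : (fun n => trigamma_sum (y / 2) n + trigamma_sum ((y + 1) / 2) n) @ \oo -->
    trigamma (y / 2) + trigamma ((y + 1) / 2).
  by apply: cvgD; apply: cvg_trigamma; rewrite divr_gt0 ?addr_gt0.
have c3 : (fun n => trigamma_sum y (n + n)) @ \oo --> trigamma y.
  apply: (squeeze_cvgr _ (cvg_trigamma y0)); last exact: (cvg_cst (trigamma y)).
  near=> n; rewrite trigamma_sum_mono ?leq_addr //=.
  by apply: nondecreasing_cvgn_le; [exact: trigamma_sum_mono | exact: cvg_trigamma].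
have c2 : (fun n => trigamma_sum (y / 2) n + trigamma_sum ((y + 1) / 2) n) @ \oo -->
    4 * trigamma y.
  under eq_fun do rewrite trigamma_sum_duplication //.
  by apply: cvgM => //; exact: cvg_cst.
exact: cvg_unique c1 c2.
Unshelve. all: by end_near. Qed.

Lemma sin_pi_gt0 y : 0 < y < 1 -> 0 < sin (pi * y) :> R.
Proof.
move=> /andP[y0 y1]; have p0 := @pi_gt0 R.
by apply: sin_gt0_pi; rewrite mulr_gt0 //= -ltr_pdivlMl // mulVf ?gt_eqF.
Qed.

Let defect y := (pi / sin (pi * y)) ^+ 2 - trigamma y - trigamma (1 - y).

Let defect_half y : 0 < y < 1 -> defect y = (defect (y / 2) + defect ((y + 1) / 2)) / 4.
Proof.
move=> y01; have /andP[y0 y1] := y01.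
have h1 := trigamma_duplication y0.
have y1' : 0 < 1 - y by lra.
have h2 := trigamma_duplication y1'.
have e1 : 1 - (y + 1) / 2 = (1 - y) / 2 by field.
have e2 : 1 - y / 2 = (1 - y + 1) / 2 by field.
rewrite /defect e1 e2.
have s1 : 0 < sin (pi * (y / 2)) by apply: sin_pi_gt0; lra.
have s2 : 0 < sin (pi * ((y + 1) / 2)) by apply: sin_pi_gt0; lra.
have e3 : sin (pi * ((y + 1) / 2)) = cos (pi * (y / 2)).
  by rewrite -sinDpihalf; congr sin; field.
have e4 : sin (pi * y) = 2 * sin (pi * (y / 2)) * cos (pi * (y / 2)).
  have -> : pi * y = (pi * (y / 2)) *+ 2 :> R by rewrite mulr2n; field.
  by rewrite sin_mulr2n mulr2n; ring.
have := cos2sin2 (pi * (y / 2)).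
rewrite e3 in s2 *; rewrite e4.
set S := sin _ in s1 *; set C := cos _ in s2 * => E.
have -> : (pi / (2 * S * C)) ^+ 2 = ((pi / S) ^+ 2 + (pi / C) ^+ 2) / 4.
  have -> : (pi / S) ^+ 2 + (pi / C) ^+ 2 = pi ^+ 2 * (C ^+ 2 + S ^+ 2) / (S * C) ^+ 2.
    by field; rewrite !gt_eqF.
  by rewrite E subrK; field; rewrite !gt_eqF.
lra.
Qed.

Let defect_half_bound y : 0 < y <= 1 / 2 -> `|defect y| <= pi ^+ 2 + 100.
Proof.
move=> /andP[y0 yh]; have p0 := @pi_gt0 R.
have y1 : 0 < 1 - y by lra.
have [a0 a1] := (trigamma_ge0 y1, trigamma_le y1).
have y2 : 0 < y + 1 by lra.
have [b0 b1] := (trigamma_ge0 y2, trigamma_le y2).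
have i1 : (1 - y)^-1 <= 2 by rewrite -[leRHS]invrK lef_pV2 ?posrE ?invr_gt0 //; lra.
have i10 : 0 < (1 - y)^-1 by rewrite invr_gt0.
have i2 : (y + 1)^-1 <= 1 by rewrite invf_le1 //; lra.
have i20 : 0 < (y + 1)^-1 by rewrite invr_gt0.
have t : 0 < pi * y <= pi / 2.
  by rewrite mulr_gt0 //= ler_pM2l //; lra.
have := sin_sqr_bounds t.
rewrite /defect (trigamma_shift y0) expr_div_n.
have -> : ((pi * y) ^+ 2)^-1 = (y ^+ 2)^-1 / pi ^+ 2 by rewrite exprMn invfM mulrC.
set q := (y ^+ 2)^-1; set s := (sin _ ^+ 2)^-1; move=> /andP[s0 s1].
have p2 : 0 < pi ^+ 2 :> R by rewrite exprn_gt0.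
have g0 : 0 <= pi ^+ 2 * s - q.
  have -> : pi ^+ 2 * s - q = pi ^+ 2 * (s - q / pi ^+ 2).
    by rewrite mulrBr [_ * (q / _)]mulrCA divff ?mulr1 // gt_eqF.
  by rewrite mulr_ge0 // ltW.
have g1 : pi ^+ 2 * s - q <= pi ^+ 2.
  have -> : pi ^+ 2 * s - q = pi ^+ 2 * (s - q / pi ^+ 2).
    by rewrite mulrBr [_ * (q / _)]mulrCA divff ?mulr1 // gt_eqF.
  by rewrite ler_piMr // ltW.
have j1 : ((1 - y) ^+ 2)^-1 <= 4 by rewrite -exprVn; nra.
have j2 : ((y + 1) ^+ 2)^-1 <= 1 by rewrite -exprVn; nra.
by rewrite ler_norml; lra.
Qed.

Let defect_bound y : 0 < y < 1 -> `|defect y| <= pi ^+ 2 + 100.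
Proof.
move=> /andP[y0 y1]; case: (lerP y (1 / 2)) => yh; first by apply: defect_half_bound; rewrite y0.
have -> : defect y = defect (1 - y).
  rewrite /defect subKr; have -> : pi * (1 - y) = pi - pi * y :> R by ring.
  rewrite sinB sinpi cospi mul0r sub0r mulN1r opprK; ring.
by apply: defect_half_bound; lra.
Qed.

(* Herglotz trick: the defect d satisfies d(y) = (d(y/2) + d((y+1)/2)) / 4 and is
   bounded, hence vanishes. *)
Lemma trigamma_reflection y : 0 < y < 1 ->
  trigamma y + trigamma (1 - y) = (pi / sin (pi * y)) ^+ 2.
Proof.
move=> y01.
have H n : forall z, 0 < z < 1 -> `|defect z| <= (pi ^+ 2 + 100) / 2 ^+ n.
  elim: n => [|n IH] z z01; first by rewrite expr0 divr1 defect_bound.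
  have /andP[z0 z1] := z01.
  have h1 : `|defect (z / 2)| <= (pi ^+ 2 + 100) / 2 ^+ n by apply: IH; lra.
  have h2 : `|defect ((z + 1) / 2)| <= (pi ^+ 2 + 100) / 2 ^+ n by apply: IH; lra.
  have -> : (pi ^+ 2 + 100) / 2 ^+ n.+1 = (pi ^+ 2 + 100) / 2 ^+ n / 2 :> R.
    by rewrite [2 ^+ n.+1]exprS [(2 * _)^-1]invfM mulrA mulrAC.
  rewrite defect_half // normrM (@ger0_norm R 4^-1) //.
  have := ler_normD (defect (z / 2)) (defect ((z + 1) / 2)).
  by lra.
have d0 : `|defect y| <= 0.
  have c : (fun n => (pi ^+ 2 + 100) / 2 ^+ n) @ \oo --> (0 : R).
    rewrite -(mulr0 (pi ^+ 2 + 100)); apply: cvgM; first exact: cvg_cst.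
    under eq_fun do rewrite -exprVn.
    by apply: cvg_expr; rewrite ger0_norm // invf_lt1 // ltr1n.
  by apply: (cvgn_ge (k := 0)) c _ => n _; exact: H.
move: d0; rewrite normr_le0 /defect => /eqP; lra.
Qed.

Lemma trigamma_half : trigamma (1 / 2) = pi ^+ 2 / 2.
Proof.
have := @trigamma_reflection (1 / 2); have -> : 1 - 1 / 2 = 1 / 2 :> R by field.
have -> : pi * (1 / 2) = pi / 2 :> R by field.
rewrite sin_pihalf divr1 => /(_ _) E.
have : trigamma (1 / 2) + trigamma (1 / 2) = pi ^+ 2 by apply: E; lra.
lra.
Qed.

Lemma trigamma1 : trigamma 1 = pi ^+ 2 / 6.
Proof.
have := @trigamma_duplication 1 ltr01.
have -> : (1 + 1) / 2 = 1 :> R by field.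
rewrite trigamma_half; lra.
Qed.

Lemma oddsq_limE : oddsq_lim R = pi ^+ 2 / 8.
Proof.
have E n : trigamma_sum (1 / 2) n = 4 * oddsq R n.
  elim: n => [|n IH]; first by rewrite /trigamma_sum big_ord0 mulr0.
  rewrite trigamma_sumS IH oddsqS odd_natE; field.
  have n0 : 0 <= n%:R :> R by [].
  by rewrite !gt_eqF //; lra.
have c1 : (fun n => 4 * oddsq R n) @ \oo --> 4 * oddsq_lim R.
  by apply: cvgM; [exact: cvg_cst | exact: cvg_oddsq].
have c2 : (fun n => 4 * oddsq R n) @ \oo --> trigamma (1 / 2).
  by under eq_fun do rewrite -E; apply: cvg_trigamma; lra.
have := cvg_unique _ c1 c2; rewrite trigamma_half => /(_ _) H.
have : 4 * oddsq_lim R = pi ^+ 2 / 2 by exact: H.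
lra.
Qed.

Definition eta_trigamma y := trigamma y - trigamma ((y + 1) / 2) / 2.

Lemma eta_trigamma_shift y : 0 < y -> eta_trigamma y + eta_trigamma (y + 1) = (y ^+ 2)^-1.
Proof.
move=> y0; have h := trigamma_shift y0.
have y1 : 0 < y + 1 by lra.
have := trigamma_duplication y1; rewrite /eta_trigamma; lra.
Qed.

Lemma trigamma_along (y : R) : 0 < y -> (fun k => trigamma (y + k.+1%:R)) @ \oo --> (0 : R).
Proof.
move=> y0.
have c : (fun k => 2 * (harmonic k : R)) @ \oo --> (0 : R).
  by rewrite -(mulr0 2); apply: cvgM; [exact: cvg_cst | exact: cvg_harmonic].
apply: (squeeze_cvgr _ _ c); last exact: cvg_cst.
near=> k; set z := y + k.+1%:R; have k1 : 1 <= k.+1%:R :> R by rewrite ler1n.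
have z0 : 0 < z by rewrite /z; lra.
rewrite trigamma_ge0 //= (le_trans (trigamma_le z0)) //.
change (harmonic k) with (k.+1%:R^-1 : R).
have i1 : z^-1 <= k.+1%:R^-1 by rewrite lef_pV2 ?posrE //; rewrite /z; lra.
have i2 : (z ^+ 2)^-1 <= z^-1.
  by rewrite lef_pV2 ?posrE ?exprn_gt0 // expr2 ler_peMr ?(ltW z0) // /z; lra.
move: i1 i2; set a := z^-1; set b := (z ^+ 2)^-1; set d := k.+1%:R^-1.
clearbody a b d; lra.
Unshelve. all: by end_near. Qed.

End Trigamma.

Section CosineProduct.
Local Open Scope classical_set_scope.
Local Open Scope ring_scope.
Variable R : realType.
Implicit Types (x y t A L : R) (i j n N k : nat).
Local Notation o := (@odd_nat R).

(* [cheb n] is the polynomial with value cos(2nt) at sin(t)^2. Its factorisation is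
   a finite form of the cosine product. *)
Fixpoint cheb n : {poly R} :=
  if n is k.+1 then
    if k is m.+1 then (1 - 2 *: 'X) * cheb k *+ 2 - cheb m else 1 - 2 *: 'X
  else 1.

Lemma chebSS n : cheb n.+2 = (1 - 2 *: 'X) * cheb n.+1 *+ 2 - cheb n.
Proof. by []. Qed.

Lemma cheb_sin t n : (cheb n).[sin t ^+ 2] = cos (2 * n%:R * t).
Proof.
have c2 : cos (2 * t) = 1 - 2 * sin t ^+ 2.
  have -> : 2 * t = t *+ 2 by rewrite mulr2n; ring.
  by rewrite cos_mulr2n cos2sin2 mulr2n; ring.
have h1 : (1 - 2 *: 'X : {poly R}).[sin t ^+ 2] = cos (2 * t).
  by rewrite c2 !hornerE.
suff : (cheb n).[sin t ^+ 2] = cos (2 * n%:R * t) /\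
       (cheb n.+1).[sin t ^+ 2] = cos (2 * n.+1%:R * t) by case.
elim: n => [|n [IH1 IH2]].
  by rewrite mulr0 mul0r cos0 mulr1 /= h1 hornerC.
split=> //; rewrite chebSS hornerD hornerN hornerMn hornerM h1 IH1 IH2.
have -> : 2 * n.+2%:R * t = 2 * n.+1%:R * t + 2 * t by rewrite -(natr1 n.+1); ring.
have -> : 2 * n%:R * t = 2 * n.+1%:R * t - 2 * t by rewrite -(natr1 n); ring.
by rewrite [cos (_ - _)]cosB cosD mulr2n; ring.
Qed.

Lemma size_cheb n : (size (cheb n) <= n.+1)%N.
Proof.
have s1 : (size (1 - 2 *: 'X : {poly R})%R <= 2)%N.
  rewrite (leq_trans (size_polyD _ _)) // geq_max size_poly1 /= size_polyN.
  by rewrite (leq_trans (size_scale_leq _ _)) // size_polyX.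
suff : (size (cheb n) <= n.+1)%N /\ (size (cheb n.+1) <= n.+2)%N by case.
elim: n => [|n [IH1 IH2]]; first by rewrite size_poly1.
split=> //; rewrite chebSS (leq_trans (size_polyD _ _)) // geq_max size_polyN.
apply/andP; split; last by rewrite (leq_trans IH1) // -addn2 leq_addr.
rewrite mulr2n (leq_trans (size_polyD _ _)) // maxnn.
apply: (leq_trans (size_polyMleq _ _)).
by move: (size _) (size _) s1 IH2 => a b; lia.
Qed.

Definition cheb_angle n j : R := pi * o j / (4 * n%:R).

Lemma cheb_angle_itv n j : (j < n)%N -> 0 < cheb_angle n j < pi / 2.
Proof.
move=> jn; have p0 := @pi_gt0 R; have n0 : 0 < n%:R :> R by rewrite ltr0n (leq_trans _ jn).
have jn' : j.+1%:R <= n%:R :> R by rewrite ler_nat.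
rewrite /cheb_angle divr_gt0 ?mulr_gt0 ?odd_nat_gt0 //= ltr_pdivrMr ?mulr_gt0 //.
rewrite -mulrA ltr_pM2l // odd_natE; rewrite -natr1 in jn'; lra.
Qed.

Lemma cheb_angle_sin_gt0 n j : (j < n)%N -> 0 < sin (cheb_angle n j).
Proof. by move/cheb_angle_itv; exact: sin_gt0_pihalf. Qed.

Lemma cos_odd_pihalf j : cos (pi * o j / 2) = 0 :> R.
Proof.
elim: j => [|j IH]; first by rewrite odd_nat0 mulr1 cos_pihalf.
have -> : pi * o j.+1 / 2 = pi * o j / 2 + pi by rewrite odd_natS; field.
by rewrite cosDpi IH oppr0.
Qed.

Lemma cheb_root n j : (j < n)%N -> (cheb n).[sin (cheb_angle n j) ^+ 2] = 0.
Proof.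
move=> jn; rewrite cheb_sin -[RHS](cos_odd_pihalf j); congr cos.
have n0 : n%:R != 0 :> R by rewrite pnatr_eq0; case: n jn.
rewrite /cheb_angle; set p := pi; clearbody p; field; exact: n0.
Qed.

Lemma cheb_angle_inj n i j : (i < n)%N -> (j < n)%N ->
  sin (cheb_angle n i) ^+ 2 = sin (cheb_angle n j) ^+ 2 -> i = j.
Proof.
move=> ilt jlt /eqP; have p0 := @pi_gt0 R.
rewrite eqrXn2 ?(ltW (cheb_angle_sin_gt0 _)) // => /eqP E.
have /andP[i0 i1] := cheb_angle_itv ilt; have /andP[j0 j1] := cheb_angle_itv jlt.
have : cheb_angle n i = cheb_angle n j.
  by apply: sin_inj E; rewrite in_itv /=; lra.
rewrite /cheb_angle => /mulIf -/(_ _) E2.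
have n0 : n%:R != 0 :> R by rewrite pnatr_eq0; case: n ilt {jlt E i0 i1 j0 j1 E2}.
have : pi * o i = pi * o j by apply: E2; rewrite invr_eq0 mulf_neq0.
by move/mulfI => H; apply/odd_nat_inj/H; rewrite gt_eqF.
Qed.

Lemma cheb_factor n y : (cheb n).[y] =
  \prod_(j < n) (1 - y / sin (cheb_angle n j) ^+ 2).
Proof.
pose q : {poly R} := \prod_(j < n) (1 - (sin (cheb_angle n j) ^+ 2)^-1 *: 'X).
have hq z : q.[z] = \prod_(j < n) (1 - z / sin (cheb_angle n j) ^+ 2).
  by rewrite horner_prod; apply: eq_bigr => j _; rewrite !hornerE mulrC.
have sq m : (size (\prod_(j < m) (1 - (sin (cheb_angle n j) ^+ 2)^-1 *: 'X : {poly R}))%R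
    <= m.+1)%N.
  elim: m => [|m IH]; first by rewrite big_ord0 size_poly1.
  rewrite big_ord_recr /=; apply: (leq_trans (size_polyMleq _ _)).
  have h : (size (1 - (sin (cheb_angle n m) ^+ 2)^-1 *: 'X : {poly R})%R <= 2)%N.
    rewrite (leq_trans (size_polyD _ _)) // geq_max size_poly1 /= size_polyN.
    by rewrite (leq_trans (size_scale_leq _ _)) // size_polyX.
  by rewrite -subn1 leq_subLR add1n (leq_trans (leq_add IH h)) // addn2.
pose rs := 0 :: [seq sin (cheb_angle n j) ^+ 2 | j <- iota 0 n].
have : cheb n - q = 0.
  apply: (@roots_geq_poly_eq0 _ _ rs).
  - rewrite /= rootE hornerD hornerN hq big1 ?subr0; last by move=> j _; rewrite mul0r subr0.
    have -> : 0 = sin 0 ^+ 2 :> R by rewrite sin0 expr0n.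
    rewrite cheb_sin mulr0 cos0 sin0 expr0n subrr eqxx /=.
    apply/allP => z /mapP[k]; rewrite mem_iota add0n => /= kn ->.
    rewrite rootE hornerD hornerN hq cheb_root // (bigD1 (Ordinal kn)) //=.
    rewrite divff ?subrr ?mul0r ?subr0 // expf_neq0 // gt_eqF //.
    exact: cheb_angle_sin_gt0.
  - rewrite /= map_inj_in_uniq ?iota_uniq ?andbT.
      apply/negP => /mapP[k]; rewrite mem_iota add0n => /= kn /eqP.
      by rewrite eq_sym gt_eqF // exprn_gt0 // cheb_angle_sin_gt0.
    move=> i j; rewrite !mem_iota !add0n /= => ilt jlt.
    exact: cheb_angle_inj.
  - by rewrite /= size_map size_iota (leq_trans (size_polyD _ _)) // geq_max size_cheb size_polyN sq.
by move=> /eqP; rewrite subr_eq0 => /eqP ->.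
Qed.

Lemma prod_diff_le n (a b d : nat -> R) :
  (forall j, (j < n)%N -> `|a j| <= 1 + d j /\ `|b j| <= 1 + d j) ->
  (forall j, 0 <= d j) ->
  `|\prod_(j < n) a j - \prod_(j < n) b j| <=
  expR (\sum_(j < n) d j) * \sum_(j < n) `|a j - b j|.
Proof.
move=> H d0.
suff : [/\ `|\prod_(j < n) a j - \prod_(j < n) b j| <=
  expR (\sum_(j < n) d j) * \sum_(j < n) `|a j - b j|,
  `|\prod_(j < n) a j| <= expR (\sum_(j < n) d j) &
  `|\prod_(j < n) b j| <= expR (\sum_(j < n) d j)] by case.
elim: n H => [|n IH] H.
  by rewrite !big_ord0 subrr normr0 mulr0 normr1 expR0 lexx.
have [IH1 IH2 IH3] : [/\ `|\prod_(j < n) a j - \prod_(j < n) b j| <=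
  expR (\sum_(j < n) d j) * \sum_(j < n) `|a j - b j|,
  `|\prod_(j < n) a j| <= expR (\sum_(j < n) d j) &
  `|\prod_(j < n) b j| <= expR (\sum_(j < n) d j)].
  by apply: IH => j jn; apply: H; rewrite ltnS ltnW.
have [Ha Hb] := H n (ltnSn n).
have He : 1 + d n <= expR (d n) by exact: expR_ge1Dx.
rewrite !big_ord_recr /= expRD; split.
- set A := \prod_(j < n) a j in IH1 IH2 *; set B := \prod_(j < n) b j in IH1 IH3 *.
  set E := expR (\sum_(j < n) d j) in IH1 IH2 IH3 *.
  set D := \sum_(j < n) _ in IH1 *.
  have -> : A * a n - B * b n = (A - B) * a n + B * (a n - b n) by ring.
  have E0 : 0 <= E by apply: expR_ge0.
  have e1 : 1 <= expR (d n) by rewrite (le_trans _ He) // lerDl.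
  apply: le_trans (ler_normD _ _) _; rewrite [leRHS]mulrDr !normrM; apply: lerD.
    rewrite mulrAC; apply: ler_pM => //; exact: le_trans He.
  rewrite -mulrA; apply: ler_pM => //; rewrite ler_peMl //.
- by rewrite normrM; apply: ler_pM => //; exact: le_trans He.
- by rewrite normrM; apply: ler_pM => //; exact: le_trans He.
Qed.

Lemma sin_ratio_approx (u v : R) : 0 < u <= pi / 2 -> 0 < v <= pi / 2 ->
  `|sin u ^+ 2 / sin v ^+ 2 - u ^+ 2 / v ^+ 2| <= u ^+ 2 + u ^+ 4 / v ^+ 2.
Proof.
move=> hu hv; have /andP[u0 _] := hu; have /andP[v0 _] := hv.
have p0 := @pi_gt0 R.
have /andP[a0 a1] := sin_sqr_bounds hu; have /andP[b0 b1] := sin_sqr_bounds hv.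
have su : 0 < sin u by apply: sin_gt0_pi; lra.
have sv : 0 < sin v by apply: sin_gt0_pi; lra.
move: a0 a1 b0 b1; set S := sin u in su *; set V := sin v in sv *.
have SE : u ^+ 2 - S ^+ 2 = u ^+ 2 * S ^+ 2 * ((S ^+ 2)^-1 - (u ^+ 2)^-1).
  by field; rewrite !gt_eqF.
set e := (S ^+ 2)^-1 - _ in SE *; set f := (V ^+ 2)^-1 - _ => e0 e1 f0 f1.
have fE : (V ^+ 2)^-1 = (v ^+ 2)^-1 + f by rewrite /f addrC subrK.
have u2 : 0 < u ^+ 2 by rewrite exprn_gt0.
have S2 : 0 < S ^+ 2 by rewrite exprn_gt0.
have v2 : 0 < (v ^+ 2)^-1 by rewrite invr_gt0 exprn_gt0.
have g0 : 0 <= u ^+ 2 * S ^+ 2 * e by rewrite mulr_ge0 // mulr_ge0 // ltW.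
have Su : S ^+ 2 <= u ^+ 2 by lra.
have g1 : u ^+ 2 * S ^+ 2 * e <= u ^+ 4.
  have -> : u ^+ 4 = u ^+ 2 * u ^+ 2 * 1 by ring.
  by apply: ler_pM => //; [rewrite mulr_ge0 // ltW | rewrite ler_pM2l].
rewrite fE; have -> : S ^+ 2 * ((v ^+ 2)^-1 + f) - u ^+ 2 / v ^+ 2 =
  S ^+ 2 * f - (u ^+ 2 - S ^+ 2) / v ^+ 2 by ring.
rewrite SE; apply: le_trans (ler_normB _ _) _; apply: lerD.
  have s2 := ltW S2; rewrite ger0_norm; last exact: mulr_ge0.
  by rewrite -[leRHS]mulr1; apply: ler_pM.
rewrite ger0_norm; last by apply: mulr_ge0 => //; exact: ltW.
by rewrite ler_wpM2r // ltW.
Qed.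

Lemma cos_oddprod_dist x n : 0 < x < 1 ->
  `|cos (pi * x / 2) - oddprod x n.+1| <= expR 40 * 20 / n.+1%:R.
Proof.
move=> /andP[x0 x1]; set N := n.+1; have p0 := @pi_gt0 R.
have p4 : pi < 4 :> R by have := @pihalf_lt2 R; lra.
have N1 : 1 <= N%:R :> R by rewrite ler1n.
have N0 : 0 < N%:R :> R by lra.
pose u : R := pi * x / (4 * N%:R).
have u0 : 0 < u by rewrite divr_gt0 ?mulr_gt0.
have uN : u <= N%:R^-1.
  rewrite /u ler_pdivrMr ?mulr_gt0 // mulrCA mulVf ?gt_eqF // mulr1; nra.
have uh : u <= pi / 2.
  rewrite /u ler_pdivrMr ?mulr_gt0 //; nra.
pose a j := 1 - sin u ^+ 2 / sin (cheb_angle N j) ^+ 2.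
pose b j := 1 - x ^+ 2 / o j ^+ 2.
have -> : cos (pi * x / 2) = \prod_(j < N) a j.
  rewrite -cheb_factor cheb_sin /u; congr cos; set p := pi; clearbody p.
  by field; rewrite gt_eqF.
have -> : oddprod x N = \prod_(j < N) b j.
  by elim: N {N1 N0 u u0 uN uh a} => [|m IH]; rewrite ?big_ord0 // big_ord_recr /= IH.
have D j : (j < N)%N -> `|a j - b j| <= 2 / N%:R ^+ 2.
  move=> jn; have /andP[v0 v1] := cheb_angle_itv jn.
  have h := @sin_ratio_approx u (cheb_angle N j) _ _.
  have -> : a j - b j = - (sin u ^+ 2 / sin (cheb_angle N j) ^+ 2 - x ^+ 2 / o j ^+ 2).
    by rewrite /a /b; ring.
  have E : u ^+ 2 / cheb_angle N j ^+ 2 = x ^+ 2 / o j ^+ 2.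
    rewrite /u /cheb_angle; have := gt_eqF p0; set p := pi; clearbody p => pn0.
    by field; rewrite pn0 odd_nat_neq0 gt_eqF.
  have E4 : u ^+ 4 / cheb_angle N j ^+ 2 = u ^+ 2 * (x ^+ 2 / o j ^+ 2).
    by rewrite -E; ring.
  rewrite E E4 in h; rewrite normrN (le_trans (h _ _)) ?u0 ?v0 ?(ltW v1) //.
  have xo : x ^+ 2 / o j ^+ 2 <= 1.
    rewrite ler_pdivrMr ?exprn_gt0 ?odd_nat_gt0 // mul1r.
    rewrite ler_pXn2r ?nnegrE ?(ltW x0) ?(ltW (odd_nat_gt0 _ _)) //.
    by rewrite (le_trans (ltW x1)) // odd_nat_ge1.
  have u2 : u ^+ 2 <= (N%:R ^+ 2)^-1.
    by rewrite -exprVn ler_pXn2r ?nnegrE ?(ltW u0) ?invr_ge0 ?(ltW N0).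
  have : u ^+ 2 * (x ^+ 2 / o j ^+ 2) <= (N%:R ^+ 2)^-1.
    rewrite -[leRHS]mulr1; apply: ler_pM => //; rewrite ?sqr_ge0 //.
    by rewrite divr_ge0 ?sqr_ge0.
  by move: u2; lra.
pose d j := (o j ^+ 2)^-1 + 2 / N%:R ^+ 2.
have d0 j : 0 <= d j by rewrite addr_ge0 ?invr_odd_ge0 // divr_ge0 ?sqr_ge0.
have H j : (j < N)%N -> `|a j| <= 1 + d j /\ `|b j| <= 1 + d j.
  move=> jn; have hb : `|b j| <= 1 + (o j ^+ 2)^-1.
    rewrite /b (le_trans (ler_normB _ _)) // normr1 lerD2l ger0_norm ?divr_ge0 ?sqr_ge0 //.
    by rewrite ler_piMl ?invr_odd_ge0 // expr_le1 // ltW.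
  have dN : 0 <= 2 / N%:R ^+ 2 :> R by rewrite divr_ge0 ?sqr_ge0.
  split; last by rewrite /d; lra.
  have := ler_normD (a j - b j) (b j); rewrite subrK; have := D j jn; rewrite /d; lra.
apply: le_trans (prod_diff_le H d0) _; rewrite -mulrA; apply: ler_pM.
- exact: expR_ge0.
- exact: sumr_ge0.
- rewrite ler_expR big_split /= sumr_const card_ord.
  have -> : \sum_(j < N) (o j ^+ 2)^-1 = oddsq R N.
    by elim: N {N1 N0 u u0 uN uh a b D d d0 H} => [|m IH]; rewrite ?big_ord0 // big_ord_recr /= IH.
  have := oddsq_le R N; have -> : 2 / N%:R ^+ 2 *+ N = 2 / N%:R :> R.
    by rewrite -mulr_natr; field; rewrite gt_eqF.
  have : 2 / N%:R <= 2 :> R by rewrite ler_pdivrMr // ler_peMr.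
  lra.
apply: (@le_trans _ _ (\sum_(j < N) 2 / N%:R ^+ 2)).
  by apply: ler_sum => j _; exact: D.
rewrite sumr_const card_ord; have -> : 2 / N%:R ^+ 2 *+ N = 2 / N%:R :> R.
  by rewrite -mulr_natr; field; rewrite gt_eqF.
by rewrite ler_wpM2r ?invr_ge0 ?(ltW N0) // ler_nat.
Qed.

Lemma oddprod_lim_cos x k : 0 < x < 1 ->
  oddprod_lim (x + 2 * k%:R) = cos (pi * (x + 2 * k%:R) / 2).
Proof.
move=> x01; have /andP[x0 x1] := x01; rewrite oddprod_lim_shiftn //.
have -> : oddprod_lim x = cos (pi * x / 2).
  have c : (fun n => expR 40 * 20 * (harmonic n : R)) @ \oo --> (0 : R).
    rewrite -(mulr0 (expR 40 * 20)).
    by apply: cvgM; [exact: cvg_cst | exact: cvg_harmonic].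
  have c1 : (fun n => cos (pi * x / 2) - oddprod x n.+1) @ \oo --> cos (pi * x / 2) - oddprod_lim x.
    apply: cvgB; first exact: cvg_cst.
    by rewrite (cvg_shiftS (oddprod x)); exact: cvg_oddprod.
  have c2 : (fun n => cos (pi * x / 2) - oddprod x n.+1) @ \oo --> (0 : R).
    apply/norm_cvg0P; apply: (squeeze_cvgr _ _ c); last exact: cvg_cst.
    by near=> n; rewrite normr_ge0 cos_oddprod_dist.
  have := cvg_unique _ c1 c2 => /(_ _) H.
  have : cos (pi * x / 2) - oddprod_lim x = 0 by exact: H.
  by move/eqP; rewrite subr_eq0 => /eqP.
elim: k => [|k IH]; first by rewrite mulr0 addr0 mul1r.
have -> : pi * (x + 2 * k.+1%:R) / 2 = pi * (x + 2 * k%:R) / 2 + pi.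
  by rewrite -natr1; field.
by rewrite cosDpi -IH exprS mulN1r mulNr.
Unshelve. all: by end_near. Qed.

End CosineProduct.

(** * Closed forms *)

Section PeriodicIdentities.
Local Open Scope classical_set_scope.
Local Open Scope ring_scope.
Variable R : realType.
Implicit Types (x y : R) (k n : nat).

Let cvgn_unique (u : nat -> R) (a b : R) : u @ \oo --> a -> u @ \oo --> b -> a = b.
Proof. by move=> ua ub; exact: cvg_unique ua ub. Qed.

Definition csc2 y : R := (pi / sin (pi * y)) ^+ 2.
Definition alphaf y : R := (csc2 y - (y ^+ 2)^-1) / 2 - trigamma (y + 1).
Definition betaf y : R :=
  (- cos (pi * y) * csc2 y + (y ^+ 2)^-1) / 2 - eta_trigamma (y + 1).

Lemma csc2_shift y : csc2 (y + 1) = csc2 y.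
Proof. by rewrite /csc2 mulrDr mulr1 sinDpi invrN mulrN sqrrN. Qed.

Lemma cospi_shift y : cos (pi * (y + 1)) = - cos (pi * y) :> R.
Proof. by rewrite mulrDr mulr1 cosDpi. Qed.

Lemma alphaf_shift y : 0 < y ->
  alphaf (y + 1) = alphaf y + ((y ^+ 2)^-1 + ((y + 1) ^+ 2)^-1) / 2.
Proof.
move=> y0; have y1 : 0 < y + 1 by rewrite addr_gt0.
rewrite /alphaf csc2_shift (trigamma_shift y1); lra.
Qed.

Lemma betaf_shift y : 0 < y ->
  betaf (y + 1) = - betaf y + ((y ^+ 2)^-1 - ((y + 1) ^+ 2)^-1) / 2.
Proof.
move=> y0; have y1 : 0 < y + 1 by rewrite addr_gt0.
have := eta_trigamma_shift y1.
by rewrite /betaf csc2_shift cospi_shift; lra.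
Qed.

Lemma eta_trigamma_le y : 0 < y -> `|eta_trigamma y| <= 3 * trigamma y.
Proof.
move=> y0; have g0 := trigamma_ge0 y0; have := trigamma_duplication y0.
have y2 : 0 < y / 2 by lra. have y3 : 0 < (y + 1) / 2 by lra.
have := trigamma_ge0 y2; have := trigamma_ge0 y3; rewrite /eta_trigamma.
by rewrite ler_norml; lra.
Qed.

Section Base.
Variable y : R.
Hypothesis y01 : 0 < y < 1 / 2.
Let x := 2 * y.
Let yk k := y + k%:R.

Let x01 : 0 < x < 1. Proof. by have /andP[a b] := y01; rewrite /x; lra. Qed.
Let y0 : 0 < y. Proof. by case/andP: y01. Qed.
Let yk0 k : 0 < yk k. Proof. by rewrite /yk ltr_wpDr. Qed.
Let ykS k : yk k.+1 = yk k + 1. Proof. by rewrite /yk -natr1 addrA. Qed.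
Let xk k : 2 * yk k = x + 2 * k%:R. Proof. by rewrite /yk mulrDr. Qed.
Let c k := cos (pi * yk k).

Let ck k : oddprod_lim (2 * yk k) = c k.
Proof.
by rewrite xk oddprod_lim_cos // -xk /c; congr cos; set p := pi; clearbody p; field.
Qed.

Let csc2_yk k : csc2 (yk k) = csc2 y.
Proof.
elim: k => [|k IH]; first by rewrite /yk addr0.
by rewrite ykS csc2_shift.
Qed.

Let cE k : c k = (-1) ^+ k * cos (pi * y).
Proof.
elim: k => [|k IH]; first by rewrite /c /yk addr0 mul1r.
by rewrite /c ykS cospi_shift -/(c k) IH exprS mulN1r mulNr.
Qed.

Let csc2_cos : csc2 y * (1 - cos (pi * y) ^+ 2) = pi ^+ 2.
Proof.
rewrite -sin2cos2 /csc2 expr_div_n divfK // expf_neq0 // gt_eqF //.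
by apply: sin_pi_gt0; have /andP[a b] := y01; lra.
Qed.

Let cvg_inv_sq : (fun k => (yk k.+1 ^+ 2)^-1) @ \oo --> (0 : R).
Proof.
apply: (squeeze_cvgr _ _ (@cvg_harmonic R)); last exact: cvg_cst.
near=> k; change (harmonic k) with (k.+1%:R^-1 : R).
have k1 : 1 <= k.+1%:R :> R by rewrite ler1n.
rewrite invr_ge0 sqr_ge0 /= lef_pV2 ?posrE ?exprn_gt0 //.
have : k.+1%:R <= yk k.+1 by rewrite /yk lerDr ltW.
by move=> h; rewrite expr2 (le_trans h) // ler_peMr ?(ltW (yk0 _)) // (le_trans k1).
Unshelve. all: by end_near. Qed.

Let cvg_trigamma1 : (fun k => trigamma (yk k.+1 + 1)) @ \oo --> (0 : R).
Proof.
have y1 : 0 < y + 1 by rewrite addr_gt0.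
have := trigamma_along y1; move=> H; apply: (cvgn_eq H) => k.
by rewrite /yk addrAC.
Qed.

Let cvg_alphaf : (fun k => alphaf (yk k.+1)) @ \oo --> csc2 y / 2.
Proof.
have : (fun k => (csc2 y - (yk k.+1 ^+ 2)^-1) / 2 - trigamma (yk k.+1 + 1)) @ \oo -->
  (csc2 y - 0) / 2 - 0.
  apply: cvgB => //; apply: cvgM; last exact: cvg_cst.
  by apply: cvgB => //; exact: cvg_cst.
rewrite !subr0; move=> H; apply: (cvgn_eq H) => k.
by rewrite /alphaf csc2_yk.
Qed.

Let cvg_sign (u : nat -> R) : u @ \oo --> (0 : R) ->
  (fun k => (-1) ^+ k.+1 * u k) @ \oo --> (0 : R).
Proof.
move=> h; have u0 : (fun k => `|u k|) @ \oo --> (0 : R) by apply/norm_cvg0P.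
apply/norm_cvg0P; apply: (cvgn_eq u0) => k.
by rewrite normrM normrX normrN1 expr1n mul1r.
Qed.

Let cvg_eta : (fun k => eta_trigamma (yk k.+1 + 1)) @ \oo --> (0 : R).
Proof.
apply/norm_cvg0P.
have c3 : (fun k => 3 * trigamma (yk k.+1 + 1)) @ \oo --> (0 : R).
  by rewrite -(mulr0 3); apply: cvgM => //; exact: cvg_cst.
apply: (squeeze_cvgr _ _ c3); last exact: cvg_cst.
by near=> k; rewrite normr_ge0 eta_trigamma_le // addr_gt0.
Unshelve. all: by end_near. Qed.

Let cvg_betaf : (fun k => (-1) ^+ k.+1 * betaf (yk k.+1)) @ \oo -->
  - cos (pi * y) * csc2 y / 2.
Proof.
have : (fun k => - cos (pi * y) * csc2 y / 2 +
    (-1) ^+ k.+1 * ((yk k.+1 ^+ 2)^-1 * 2^-1 - eta_trigamma (yk k.+1 + 1))) @ \oo -->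
  - cos (pi * y) * csc2 y / 2 + 0.
  apply: cvgD; first exact: cvg_cst.
  apply: (cvg_sign (u := fun k => (yk k.+1 ^+ 2)^-1 * 2^-1 - eta_trigamma (yk k.+1 + 1))).
  have : (fun k => (yk k.+1 ^+ 2)^-1 * 2^-1 - eta_trigamma (yk k.+1 + 1)) @ \oo -->
    (0 * 2^-1 - 0 : R) by apply: cvgB => //; apply: cvgM => //; exact: cvg_cst.
  by rewrite mul0r subr0.
rewrite addr0; move=> H; apply: (cvgn_eq H) => k.
rewrite /betaf csc2_yk -/(c k.+1) cE.
have := sqrr_sign R k.+1; set e := (-1) ^+ k.+1 => e2.
have -> : e * ((- (e * cos (pi * y)) * csc2 y + (yk k.+1 ^+ 2)^-1) / 2 -
   eta_trigamma (yk k.+1 + 1)) =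
   - (e ^+ 2) * cos (pi * y) * csc2 y / 2 +
   e * ((yk k.+1 ^+ 2)^-1 / 2 - eta_trigamma (yk k.+1 + 1)) by ring.
by rewrite e2 mulN1r.
Qed.

Let dz k := 2 * yk k * zlim (2 * yk k) - (alphaf (yk k) + c k * betaf (yk k)) / 2.
Let dw k := 2 * yk k * wlim (2 * yk k) - (c k * alphaf (yk k) + betaf (yk k)) / 2.

Let cS k : c k.+1 = - c k.
Proof. by rewrite !cE exprS mulN1r mulNr. Qed.

Let yk_shift k : 2 * yk k.+1 = 2 * yk k + 2.
Proof. by rewrite ykS; ring. Qed.

Let x2k0 k : 0 < 2 * yk k. Proof. by rewrite mulr_gt0 ?yk0. Qed.

Let dzS k : dz k.+1 = dz k.
Proof.
have y1 : yk k != 0 by rewrite gt_eqF ?yk0.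
have y2 : yk k + 1 != 0 by rewrite -ykS gt_eqF ?yk0.
have := zlim_shift (x2k0 k); rewrite -yk_shift ck yk_shift.
move=> /eqP; rewrite subr_eq => /eqP E.
rewrite /dz yk_shift E cS ykS alphaf_shift // betaf_shift //.
have -> : 2 * yk k + 2 = 2 * (yk k + 1) by ring.
by field; rewrite y1 y2.
Qed.

Let dwS k : dw k.+1 = - dw k.
Proof.
have y1 : yk k != 0 by rewrite gt_eqF ?yk0.
have y2 : yk k + 1 != 0 by rewrite -ykS gt_eqF ?yk0.
have E := wlim_shift (x2k0 k); rewrite -yk_shift ck yk_shift in E.
have {}E : (2 * yk k + 2) * wlim (2 * yk k + 2) = (1 - c k) / (2 * yk k) ^+ 2 -
   (1 + c k) / (2 * yk k + 2) ^+ 2 - 2 * yk k * wlim (2 * yk k) by rewrite -E addrK.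
rewrite /dw yk_shift E cS ykS alphaf_shift // betaf_shift //.
have -> : 2 * yk k + 2 = 2 * (yk k + 1) by ring.
by field; rewrite y1 y2.
Qed.

Let cvg_cbeta : (fun k => c k.+1 * betaf (yk k.+1)) @ \oo -->
  cos (pi * y) * (- cos (pi * y) * csc2 y / 2).
Proof.
have : (fun k => cos (pi * y) * ((-1) ^+ k.+1 * betaf (yk k.+1))) @ \oo -->
  cos (pi * y) * (- cos (pi * y) * csc2 y / 2).
  by apply: cvgM => //; exact: cvg_cst.
move=> H; apply: (cvgn_eq H) => k; rewrite cE; ring.
Qed.

Let dz0 k : dz k = 0.
Proof.
have dzE n : dz n = dz 0 by elim: n => // n <-; rewrite dzS.
rewrite dzE.
have c1 : (fun k => dz k.+1) @ \oo --> 2 * oddsq_lim R -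
   (csc2 y / 2 + cos (pi * y) * (- cos (pi * y) * csc2 y / 2)) / 2.
  apply: cvgB; last by apply: cvgM; [exact: cvgD | exact: cvg_cst].
  have := cvg_zlim_along x01; move=> H; apply: (cvgn_eq H) => i.
  by rewrite -xk.
have c2 : (fun k => dz k.+1) @ \oo --> dz 0.
  by under eq_fun do rewrite dzE; exact: cvg_cst.
by rewrite (cvgn_unique c2 c1) oddsq_limE -csc2_cos; field.
Qed.

Let dw0 k : dw k = 0.
Proof.
have dwE n : dw n = (-1) ^+ n * dw 0.
  by elim: n => [|n IH]; rewrite ?mul1r // dwS IH exprS mulN1r mulNr.
suff H : dw 0 = 0 by rewrite dwE H mulr0.
have c1 : (fun k => (-1) ^+ k.+1 * dw k.+1) @ \oo --> 0 -
   (cos (pi * y) * (csc2 y / 2) + - cos (pi * y) * csc2 y / 2) / 2.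
  have : (fun k => (-1) ^+ k.+1 * (2 * yk k.+1 * wlim (2 * yk k.+1)) -
     (cos (pi * y) * alphaf (yk k.+1) + (-1) ^+ k.+1 * betaf (yk k.+1)) / 2) @ \oo -->
     0 - (cos (pi * y) * (csc2 y / 2) + - cos (pi * y) * csc2 y / 2) / 2.
    apply: cvgB.
      apply: (cvg_sign (u := fun k => 2 * yk k.+1 * wlim (2 * yk k.+1))).
      have := cvg_wlim_along x01; move=> H; apply: (cvgn_eq H) => i.
      by rewrite -xk.
    apply: cvgM; last exact: cvg_cst.
    by apply: cvgD => //; apply: cvgM => //; exact: cvg_cst.
  move=> H; apply: (cvgn_eq H) => i; rewrite /dw cE.
  have := sqrr_sign R i.+1; set e := (-1) ^+ i.+1 => e2.
  have -> : e * (2 * yk i.+1 * wlim (2 * yk i.+1) -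
      (e * cos (pi * y) * alphaf (yk i.+1) + betaf (yk i.+1)) / 2) =
    e * (2 * yk i.+1 * wlim (2 * yk i.+1)) -
     (e ^+ 2 * cos (pi * y) * alphaf (yk i.+1) + e * betaf (yk i.+1)) / 2 by ring.
  by rewrite e2 mul1r.
have c2 : (fun k => (-1) ^+ k.+1 * dw k.+1) @ \oo --> dw 0.
  under eq_fun do rewrite dwE mulrA -expr2 sqrr_sign mul1r.
  exact: cvg_cst.
by rewrite (cvgn_unique c2 c1); ring.
Qed.

Let vform (q a b cc : R) :=
  a ^+ 2 / 2 + b ^+ 2 / 2 + cc * a * b - pi ^+ 2 / 8 * (q - pi ^+ 2 / 3).

Let vf k := vform (csc2 y - (yk k ^+ 2)^-1) (alphaf (yk k)) (betaf (yk k)) (c k).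

Let dj k := 4 * (2 * yk k) ^+ 2 * tlim (2 * yk k) - vf k.

Let djS k : dj k.+1 = dj k.
Proof.
have y1 : yk k != 0 by rewrite gt_eqF ?yk0.
have y2 : yk k + 1 != 0 by rewrite -ykS gt_eqF ?yk0.
have Z : zlim (2 * yk k) = (alphaf (yk k) + c k * betaf (yk k)) / 2 / (2 * yk k).
  have /eqP := dz0 k; rewrite /dz subr_eq0 => /eqP <-.
  by field.
have W : wlim (2 * yk k) = (c k * alphaf (yk k) + betaf (yk k)) / 2 / (2 * yk k).
  have /eqP := dw0 k; rewrite /dw subr_eq0 => /eqP <-.
  by field.
have := tlim_shift (x2k0 k); rewrite -yk_shift ck yk_shift Z W oddsq_limE.
move=> /eqP; rewrite subr_eq => /eqP E.
rewrite /dj /vf -mulrA yk_shift E cS ykS alphaf_shift // betaf_shift //.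
have -> : 2 * yk k + 2 = 2 * (yk k + 1) by ring.
rewrite /vform; set p := pi; clearbody p.
by field; rewrite y1 y2.
Qed.

Lemma tlim_closed_form :
  4 * (2 * y) ^+ 2 * tlim (2 * y) =
  alphaf y ^+ 2 / 2 + betaf y ^+ 2 / 2 + cos (pi * y) * alphaf y * betaf y
  - pi ^+ 2 / 8 * (csc2 y - (y ^+ 2)^-1 - pi ^+ 2 / 3)
  + (4 * tnode_lim R - pi ^+ 4 / 24).
Proof.
have djE n : dj n = dj 0 by elim: n => // n <-; rewrite djS.
pose b k := (-1) ^+ k.+1 * betaf (yk k.+1).
have c1 : (fun k => dj k.+1) @ \oo --> 4 * tnode_lim R -
   vform (csc2 y - 0) (csc2 y / 2) (- cos (pi * y) * csc2 y / 2) (cos (pi * y)).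
  apply: cvgB.
    have : (fun k => 4 * ((x + 2 * k.+1%:R) ^+ 2 * tlim (x + 2 * k.+1%:R))) @ \oo -->
       4 * tnode_lim R.
      by apply: cvgM; [exact: cvg_cst | exact: cvg_tlim_along].
    by move=> H; apply: (cvgn_eq H) => i; rewrite mulrA -xk.
  have : (fun k => vform (csc2 y - (yk k.+1 ^+ 2)^-1) (alphaf (yk k.+1)) (b k) (cos (pi * y))) @ \oo -->
    vform (csc2 y - 0) (csc2 y / 2) (- cos (pi * y) * csc2 y / 2) (cos (pi * y)).
    rewrite /vform; apply: cvgB.
      apply: cvgD; last by apply: cvgM => //; apply: cvgM => //; exact: cvg_cst.
      by apply: cvgD; (apply: cvgM; last exact: cvg_cst); rewrite expr2;
         under eq_fun do rewrite expr2; exact: cvgM.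
    apply: cvgM; first exact: cvg_cst.
    by apply: cvgB; [apply: cvgB => //; exact: cvg_cst | exact: cvg_cst].
  move=> H; apply: (cvgn_eq H) => i; rewrite /vf /vform /b cE.
  have := sqrr_sign R i.+1; set e := (-1) ^+ i.+1 => e2.
  by rewrite exprMn e2 mul1r; ring.
have c2 : (fun k => dj k.+1) @ \oo --> dj 0.
  by under eq_fun do rewrite djE; exact: cvg_cst.
have E : dj 0 = 4 * tnode_lim R -
   vform (csc2 y - 0) (csc2 y / 2) (- cos (pi * y) * csc2 y / 2) (cos (pi * y)) := cvgn_unique c2 c1.
have : vform (csc2 y - 0) (csc2 y / 2) (- cos (pi * y) * csc2 y / 2) (cos (pi * y)) =
  pi ^+ 4 / 24.
  have -> : pi ^+ 4 / 24 = pi ^+ 2 * pi ^+ 2 / 24 :> R by rewrite -exprD.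
  by rewrite /vform -csc2_cos; field.
move=> V; rewrite V /dj /vf /vform /c /yk addr0 in E.
by move/(canRL (subrK _)): E => ->; ring.
Qed.

End Base.
End PeriodicIdentities.

(** * Expansions at 0 *)

Section Expansions.
Local Open Scope classical_set_scope.
Local Open Scope ring_scope.
Variable R : realType.
Implicit Types (u v y B K : R) (i j n N M k s : nat) (a b c : nat -> R) (f g : R -> R).

(* The germ of f at 0+ is asymptotic to the power series with coefficients a. *)
Definition has_exp f a := forall M, (0 < M)%N -> exists K, forall u, 0 < u <= 1 / 16 ->
  `|f u - \sum_(i < M) a i * u ^+ i| <= K * u ^+ M.

Definition conv a b n : R := \sum_(i < n.+1) a i * b (n - i)%N.

Lemma has_exp_ext f g a : (forall u, 0 < u <= 1 / 16 -> f u = g u) -> has_exp f a -> has_exp g a.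
Proof.
by move=> fg fa M M0; have [K HK] := fa M M0; exists K => u hu; rewrite -fg // HK.
Qed.

Lemma has_expD f g a b : has_exp f a -> has_exp g b ->
  has_exp (fun u => f u + g u) (fun i => a i + b i).
Proof.
move=> fa gb M M0; have [K HK] := fa M M0; have [L HL] := gb M M0.
exists (K + L) => u hu; under eq_bigr do rewrite mulrDl.
rewrite big_split /= opprD addrACA mulrDl (le_trans (ler_normD _ _)) // lerD ?HK ?HL //.
Qed.

Lemma has_expZ f a K : has_exp f a -> has_exp (fun u => K * f u) (fun i => K * a i).
Proof.
move=> fa M M0; have [L HL] := fa M M0; exists (`|K| * L) => u hu.
under eq_bigr do rewrite -mulrA.
by rewrite -mulr_sumr -mulrBr normrM -mulrA ler_wpM2l ?HL.
Qed.

Lemma has_exp_le_term u M (a : nat -> R) : 0 < u <= 1 / 16 ->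
  `|\sum_(i < M) a i * u ^+ i| <= \sum_(i < M) `|a i|.
Proof.
move=> /andP[u0 u1]; apply: le_trans (ler_norm_sum _ _ _) _; apply: ler_sum => i _.
rewrite normrM normrX (gtr0_norm u0) ler_piMr // exprn_ile1 //; lra.
Qed.

Lemma has_expM f g a b : has_exp f a -> has_exp g b ->
  has_exp (fun u => f u * g u) (conv a b).
Proof.
move=> fa gb M M0; have [K HK] := fa M M0; have [L HL] := gb M M0.
pose p := \poly_(i < M) a i; pose q := \poly_(i < M) b i.
pose S := \sum_(i < M) `|a i|; pose T := \sum_(i < M) `|b i|.
pose W := \sum_(i < M + M) `|(p * q)`_i|.
exists (`|K| * (T + `|L|) + S * `|L| + W) => u hu; have /andP[u0 u1] := hu.
have uM0 : 0 < u ^+ M by rewrite exprn_gt0.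
have uM1 : u ^+ M <= 1 by rewrite exprn_ile1 //; lra.
have pE : p.[u] = \sum_(i < M) a i * u ^+ i by rewrite horner_poly.
have qE : q.[u] = \sum_(i < M) b i * u ^+ i by rewrite horner_poly.
have := HK u hu; have := HL u hu; rewrite -pE -qE => HLu HKu.
have pS : `|p.[u]| <= S by rewrite pE has_exp_le_term.
have qT : `|q.[u]| <= T by rewrite qE has_exp_le_term.
have HL' : `|g u - q.[u]| <= `|L| * u ^+ M.
  by rewrite (le_trans HLu) // ler_wpM2r ?(ltW uM0) // ler_norm.
have HK' : `|f u - p.[u]| <= `|K| * u ^+ M.
  by rewrite (le_trans HKu) // ler_wpM2r ?(ltW uM0) // ler_norm.
have spq : (size (p * q)%R <= M + M)%N.
  apply: (leq_trans (size_polyMleq _ _)).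
  have sp : (size p <= M)%N := size_poly _ _.
  have sq : (size q <= M)%N := size_poly _ _.
  by rewrite (leq_trans (leq_pred _)) // leq_add.
have pq : `|p.[u] * q.[u] - \sum_(i < M) conv a b i * u ^+ i| <= W * u ^+ M.
  rewrite -hornerM (horner_coef_wide u spq) big_split_ord /=.
  have -> : \sum_(i < M) (p * q)`_i * u ^+ i = \sum_(i < M) conv a b i * u ^+ i.
    apply: eq_bigr => i _; congr (_ * _); rewrite coefM; apply: eq_bigr => j _.
    have jM : (j < M)%N by apply: leq_ltn_trans (ltn_ord i); rewrite -ltnS ltn_ord.
    have ijM : (i - j < M)%N by apply: leq_ltn_trans (ltn_ord i); exact: leq_subr.
    by rewrite !coef_poly jM ijM.
  rewrite addrAC subrr add0r /W big_split_ord /= mulrDl.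
  apply: (@le_trans _ _ ((\sum_(i < M) `|(p * q)`_(M + i)|) * u ^+ M)); last first.
    by rewrite lerDr mulr_ge0 ?sumr_ge0 ?(ltW uM0).
  rewrite mulr_suml; apply: le_trans (ler_norm_sum _ _ _) _; apply: ler_sum => i _.
  rewrite normrM normrX (gtr0_norm u0) exprD ler_wpM2l // ler_piMr ?(ltW uM0) //.
  by rewrite exprn_ile1 //; lra.
have gT : `|g u| <= T + `|L|.
  have := ler_normD (g u - q.[u]) q.[u]; rewrite subrK.
  have : `|L| * u ^+ M <= `|L| by rewrite ler_piMr.
  lra.
have -> : f u * g u - \sum_(i < M) conv a b i * u ^+ i =
  (f u - p.[u]) * g u + p.[u] * (g u - q.[u]) +
  (p.[u] * q.[u] - \sum_(i < M) conv a b i * u ^+ i) by ring.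
apply: le_trans (ler_normD _ _) _; rewrite [leRHS]mulrDl; apply: lerD => //.
apply: le_trans (ler_normD _ _) _; rewrite [leRHS]mulrDl; apply: lerD.
  by rewrite normrM mulrAC; apply: ler_pM.
by rewrite normrM -mulrA; apply: ler_pM.
Qed.

Lemma has_exp_uniq f a b : has_exp f a -> has_exp f b -> forall n, a n = b n.
Proof.
move=> fa fb; elim/ltn_ind => n IH.
have [K HK] := fa n.+1 isT; have [L HL] := fb n.+1 isT.
apply/eqP; rewrite -subr_eq0 -normr_le0; apply/ler_addgt0Pl => e e0; rewrite addr0.
pose u := Num.min (1 / 16) (e / (`|K| + `|L| + 1)).
have d0 : 0 < `|K| + `|L| + 1 by rewrite ltr_wpDl // addr_ge0.
have hu : 0 < u <= 1 / 16.
  by rewrite /u lt_min ge_min lexx divr_gt0 //= divr_gt0.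
have /andP[u0 u1] := hu.
have ue : u <= e / (`|K| + `|L| + 1) by rewrite /u ge_min lexx orbT.
have h1 := HK u hu; have h2 := HL u hu.
rewrite !big_ord_recr /= in h1 h2.
have E : \sum_(i < n) a i * u ^+ i = \sum_(i < n) b i * u ^+ i.
  by apply: eq_bigr => i _; rewrite IH.
rewrite E in h1; set s := \sum_(i < n) _ in h1 h2.
have h3 : `|a n - b n| * u ^+ n <= (K + L) * u ^+ n.+1.
  have un : `|u ^+ n| = u ^+ n by rewrite ger0_norm // exprn_ge0 // ltW.
  rewrite -[X in _ * X <= _]un -normrM.
  have -> : (a n - b n) * u ^+ n = (f u - (s + b n * u ^+ n)) - (f u - (s + a n * u ^+ n)).
    by ring.
  by rewrite (le_trans (ler_normB _ _)) // mulrDl [leRHS]addrC lerD.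
have u0n : 0 < u ^+ n by rewrite exprn_gt0.
rewrite exprS mulrA ler_pM2r // in h3.
apply: le_trans h3 _; apply: le_trans (_ : (`|K| + `|L| + 1) * u <= _).
  by rewrite ler_wpM2r ?(ltW u0) //; have := ler_norm K; have := ler_norm L; lra.
by rewrite mulrC -ler_pdivlMr.
Qed.

Lemma has_exp_monomial n : has_exp (fun u => u ^+ n) (fun i => (i == n)%:R).
Proof.
move=> M M0; exists 1 => u /andP[u0 u1]; rewrite mul1r.
have E : \sum_(i < M) (i == n :> nat)%:R * u ^+ i = if (n < M)%N then u ^+ n else 0.
  case: ltnP => nM.
    rewrite (bigD1 (Ordinal nM)) //= eqxx mul1r big1 ?addr0 // => i ni.
    by rewrite (_ : (i == n :> nat) = false) ?mul0r //; apply/negbTE; move: ni; rewrite -val_eqE.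
  rewrite big1 // => i _; rewrite ltn_eqF ?mul0r //.
  exact: leq_trans (ltn_ord i) nM.
rewrite E; case: ltnP => nM; first by rewrite subrr normr0 exprn_ge0 // ltW.
rewrite subr0 ger0_norm ?exprn_ge0 ?(ltW u0) //.
by rewrite ler_wiXn2l // ?(ltW u0) //; lra.
Qed.

Lemma has_exp_mulX f a : has_exp f a ->
  has_exp (fun u => u * f u) (fun i => if i is j.+1 then a j else 0).
Proof.
move=> fa; case=> // M _; case: (posnP M) => [->|M0].
  have [K HK] := fa 1 isT; exists (`|a 0%N| + `|K|) => u hu; have /andP[u0 u1] := hu.
  rewrite big_ord_recl big_ord0 mul0r addr0 subr0 expr1 normrM (gtr0_norm u0) mulrC.
  rewrite ler_wpM2r ?(ltW u0) //; have := HK u hu.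
  rewrite big_ord_recl big_ord0 addr0 expr0 mulr1 expr1 => h.
  have := ler_normD (f u - a 0%N) (a 0%N); rewrite subrK.
  have : K * u <= `|K|.
    apply: le_trans (ler_norm _) _; rewrite normrM ler_piMr // gtr0_norm //; lra.
  lra.
have [K HK] := fa M M0; exists K => u hu; have /andP[u0 u1] := hu.
rewrite big_ord_recl mul0r add0r.
have -> : \sum_(i < M) a i * u ^+ lift ord0 i = u * \sum_(i < M) a i * u ^+ i.
  by rewrite mulr_sumr; apply: eq_bigr => i _; rewrite lift0 exprS mulrCA.
rewrite -mulrBr normrM (gtr0_norm u0) exprS mulrCA ler_wpM2l ?(ltW u0) //.
exact: HK.
Qed.

Lemma has_exp_dilate f a : has_exp f a ->
  has_exp (fun u => f (u / 4)) (fun i => a i * (2 ^- (2 * i))).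
Proof.
move=> fa M M0; have [K HK] := fa M M0; exists `|K| => u hu; have /andP[u0 u1] := hu.
have hu4 : 0 < u / 4 <= 1 / 16 by lra.
have E i : a i * 2 ^- (2 * i) * u ^+ i = a i * (u / 4) ^+ i.
  rewrite -mulrA exprMn exprVn exprM; congr (_ * _); rewrite mulrC; congr (_ * (_ ^+ _)^-1).
  by rewrite expr2 -natrM.
under eq_bigr do rewrite E.
apply: le_trans (HK _ hu4) _.
apply: (@le_trans _ _ (`|K| * (u / 4) ^+ M)).
  by rewrite ler_wpM2r ?ler_norm // exprn_ge0 // divr_ge0 // ltW.
rewrite ler_wpM2l // ler_pXn2r ?nnegrE ?divr_ge0 ?(ltW u0) //; lra.
Qed.

Lemma has_exp_series f a B : (forall i, `|a i| <= B) ->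
  (forall u, 0 < u <= 1 / 16 -> (fun n => \sum_(i < n) a i * u ^+ i) @ \oo --> f u) ->
  has_exp f a.
Proof.
move=> aB fu M M0; exists (2 * B) => u hu; have /andP[u0 u1] := hu.
have B0 : 0 <= B := le_trans (normr_ge0 _) (aB 0%N).
rewrite distrC; apply: (cvgn_dist_le (k := M)) (fu u hu) _ => n /subnKC <-.
rewrite big_split_ord /= opprD addrA subrr sub0r normrN.
apply: le_trans (ler_norm_sum _ _ _) _.
apply: (@le_trans _ _ (\sum_(i < n - M) (B * u ^+ M) * u ^+ i)).
  apply: ler_sum => i _; rewrite normrM normrX (gtr0_norm u0) exprD mulrA.
  by rewrite ler_wpM2r ?exprn_ge0 ?(ltW u0) // ler_wpM2r ?exprn_ge0 ?(ltW u0).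
rewrite -mulr_sumr.
have h m : \sum_(i < m) u ^+ i <= 2 - 2 * u ^+ m.
  elim: m => [|m IH]; first by rewrite big_ord0 expr0 mulr1 subrr.
  rewrite big_ord_recr /= exprS; have : 0 <= u ^+ m by rewrite exprn_ge0 // ltW.
  by move=> h; nra.
have -> : 2 * B * u ^+ M = (B * u ^+ M) * 2 by ring.
rewrite ler_wpM2l ?mulr_ge0 ?exprn_ge0 ?(ltW u0) // (le_trans (h _)) //.
by rewrite gerBl mulr_ge0 // exprn_ge0 // ltW.
Qed.

Lemma has_exp_geom : has_exp (fun v => v / (1 - v)) (fun i => (0 < i)%N%:R).
Proof.
move=> M M0; exists 2 => v /andP[v0 v1].
have d0 : 1 - v != 0 by rewrite gt_eqF //; lra.
have E m : \sum_(i < m.+1) (0 < i)%N%:R * v ^+ i = (v - v ^+ m.+1) / (1 - v).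
  elim: m => [|m IH]; first by rewrite big_ord_recl big_ord0 mul0r addr0 expr1 subrr mul0r.
  by rewrite big_ord_recr /= IH mul1r [v ^+ m.+2]exprS; field.
case: M M0 => // m _; rewrite E.
have -> : v / (1 - v) - (v - v ^+ m.+1) / (1 - v) = v ^+ m.+1 / (1 - v) by field.
have vm : 0 <= v ^+ m.+1 by rewrite exprn_ge0 // ltW.
have i0 : 0 < (1 - v)^-1 by rewrite invr_gt0; lra.
rewrite ger0_norm ?mulr_ge0 ?(ltW i0) // mulrC ler_wpM2r //.
by rewrite -[leRHS]invrK lef_pV2 ?posrE ?invr_gt0 //; lra.
Qed.

Lemma has_exp_geom2 : has_exp (fun v => 2 * v / (1 - v) ^+ 2) (fun i => 2 * i%:R).
Proof.
move=> M M0; exists (4 * M%:R) => v /andP[v0 v1].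
have d0 : 1 - v != 0 by rewrite gt_eqF //; lra.
have E m : \sum_(i < m) 2 * i%:R * v ^+ i =
    2 * (v - m%:R * v ^+ m + (m%:R - 1) * v ^+ m.+1) / (1 - v) ^+ 2.
  elim: m => [|m IH]; first by rewrite big_ord0 mul0r expr1; field.
  rewrite big_ord_recr /= IH [v ^+ m.+2]exprS [v ^+ m.+1]exprS -[m.+1%:R]natr1.
  by move: (v ^+ m) (m%:R) => w r; field.
rewrite E.
have -> : 2 * v / (1 - v) ^+ 2 - 2 * (v - M%:R * v ^+ M + (M%:R - 1) * v ^+ M.+1) / (1 - v) ^+ 2
  = 2 * (M%:R - (M%:R - 1) * v) * v ^+ M / (1 - v) ^+ 2.
  by rewrite [v ^+ M.+1]exprS; move: (v ^+ M) (M%:R) => w r; field.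
have vM : 0 <= v ^+ M by rewrite exprn_ge0 // ltW.
have M1 : 1 <= M%:R :> R by rewrite ler1n.
have h0 : 0 <= M%:R - (M%:R - 1) * v <= M%:R by apply/andP; split; nra.
have /andP[h1 h2] := h0.
have e0 : 0 < ((1 - v) ^+ 2)^-1 by rewrite invr_gt0 exprn_gt0 //; lra.
have e1 : ((1 - v) ^+ 2)^-1 <= 2.
  by rewrite -[leRHS]invrK lef_pV2 ?posrE ?invr_gt0 ?exprn_gt0 //; nra.
rewrite ger0_norm; last first.
  by apply: mulr_ge0; [apply: mulr_ge0 => //; exact: mulr_ge0 | exact: ltW].
have -> : 4 * M%:R * v ^+ M = 2 * M%:R * v ^+ M * 2 by ring.
apply: ler_pM => //; [by apply: mulr_ge0 => //; exact: mulr_ge0 | exact: ltW |].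
by rewrite ler_wpM2r // ler_wpM2l.
Qed.

Lemma zeta_cvg s : (1 < s)%N -> (fun n => \sum_(k < n) (k.+1%:R ^+ s)^-1) @ \oo --> zeta R s.
Proof.
move=> s1; have -> : (fun n => \sum_(k < n) (k.+1%:R ^+ s)^-1 : R) =
  series (fun k : nat => (k.+1%:R : R) ^- s).
  by apply/funext => n; rewrite /series /= big_mkord.
apply: nondecreasing_is_cvgn.
  by apply: nondecreasing_series => k _ _; rewrite invr_ge0 exprn_ge0.
exists 2 => _ [n _ <-]; have := @trigamma_sum_le R 1 n ltr01.
rewrite expr1n invr1 => /(le_trans _); apply.
rewrite /series /= big_mkord; apply: ler_sum => k _.
rewrite natr1 lef_pV2 ?posrE ?exprn_gt0 // ler_weXn2l // ler1n //.
Qed.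

Lemma cvgn_sum M (F : nat -> nat -> R) (l : nat -> R) :
  (forall i, (i < M)%N -> F i @ \oo --> l i) ->
  (fun n => \sum_(i < M) F i n) @ \oo --> \sum_(i < M) l i.
Proof.
elim: M => [|M IH] Fl.
  by rewrite big_ord0; under eq_fun do rewrite big_ord0; exact: cvg_cst.
rewrite big_ord_recr /=; under eq_fun do rewrite big_ord_recr.
by apply: cvgD; [apply: IH => i iM; exact: Fl (leqW iM) | exact: Fl].
Qed.

Lemma has_exp_zeta_series f (phi : R -> R) c s :
  has_exp phi c -> c 0%N = 0 ->
  (forall u, 0 < u <= 1 / 16 ->
    (fun n => \sum_(k < n) (k.+1%:R ^+ s)^-1 * phi (u / k.+1%:R ^+ 2)) @ \oo --> f u) ->
  has_exp f (fun i => c i * zeta R (2 * i + s)).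
Proof.
move=> phic c0 fu M M0; have [K HK] := phic M M0.
exists (`|K| * zeta R (2 * M + s)) => u hu; have /andP[u0 u1] := hu.
have sM : (1 < 2 * M + s)%N by case: (M) M0 => // m _; rewrite mulnS -addnA add2n.
have c1 : (fun n => \sum_(i < M) c i * u ^+ i * \sum_(k < n) (k.+1%:R ^+ (2 * i + s))^-1)
    @ \oo --> \sum_(i < M) c i * zeta R (2 * i + s) * u ^+ i.
  apply: (cvgn_sum (F := fun i n => c i * u ^+ i * \sum_(k < n) (k.+1%:R ^+ (2 * i + s))^-1)
    (l := fun i => c i * zeta R (2 * i + s) * u ^+ i)) => i _; case: (posnP i) => [->|i0].
    rewrite c0 !mul0r; under eq_fun do rewrite mul0r; exact: cvg_cst.
  rewrite mulrAC; apply: cvgM; first exact: cvg_cst.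
  by apply: zeta_cvg; case: i i0 => // m _; rewrite mulnS -addnA add2n.
have Z : (fun n => `|K| * u ^+ M * \sum_(k < n) (k.+1%:R ^+ (2 * M + s))^-1) @ \oo -->
  `|K| * zeta R (2 * M + s) * u ^+ M.
  by rewrite mulrAC; apply: cvgM; [exact: cvg_cst | exact: zeta_cvg].
have c3 : (fun n => `|\sum_(k < n) (k.+1%:R ^+ s)^-1 * phi (u / k.+1%:R ^+ 2) -
    \sum_(i < M) c i * u ^+ i * \sum_(k < n) (k.+1%:R ^+ (2 * i + s))^-1|) @ \oo -->
    `|f u - \sum_(i < M) c i * zeta R (2 * i + s) * u ^+ i| by apply: cvg_norm; apply: cvgB c1; exact: fu.
apply: (ler_cvg_to c3 Z); near=> n.
have -> : \sum_(i < M) c i * u ^+ i * \sum_(k < n) (k.+1%:R ^+ (2 * i + s))^-1 =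
  \sum_(k < n) (k.+1%:R ^+ s)^-1 * \sum_(i < M) c i * (u / k.+1%:R ^+ 2) ^+ i.
  under eq_bigr do rewrite mulr_sumr.
  rewrite exchange_big /=; apply: eq_bigr => k _; rewrite mulr_sumr.
  apply: eq_bigr => i _; rewrite exprD exprM expr_div_n invfM; ring.
rewrite -sumrB (le_trans (ler_norm_sum _ _ _)) // mulr_sumr; apply: ler_sum => k _.
have k0 : 0 < k.+1%:R :> R by [].
rewrite -mulrBr normrM ger0_norm ?invr_ge0 ?exprn_ge0 ?(ltW k0) //.
have hv : 0 < u / k.+1%:R ^+ 2 <= 1 / 16.
  rewrite divr_gt0 ?exprn_gt0 //= ler_pdivrMr ?exprn_gt0 // (le_trans u1) //.
  by rewrite ler_peMr // exprn_ege1 // ler1n.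
apply: (@le_trans _ _ ((k.+1%:R ^+ s)^-1 * (`|K| * (u / k.+1%:R ^+ 2) ^+ M))).
  rewrite ler_wpM2l ?invr_ge0 ?exprn_ge0 ?(ltW k0) // (le_trans (HK _ hv)) //.
  by rewrite ler_wpM2r ?ler_norm // exprn_ge0 // ltW; case/andP: hv.
by rewrite exprD exprM expr_div_n invfM le_eqVlt; apply/orP; left; apply/eqP; ring.
Unshelve. all: by end_near. Qed.

End Expansions.

Section Coefficients.
Local Open Scope classical_set_scope.
Local Open Scope ring_scope.
Variable R : realType.
Implicit Types (u v x y : R) (i j n m M k : nat).
Local Notation o := (@odd_nat R).

(* [wcoef i n] and [tcoef i n] are (-1)^n times the coefficients of x^(2n) in
   [wsum x i] and [tsum x i]. *)
Fixpoint wcoef i n : R :=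
  if i is j.+1 then
    wcoef j n + (if n is m.+1 then wcoef j m / o j ^+ 2 else (o j ^+ 3)^-1)
  else 0.

Fixpoint tcoef i n : R := if i is j.+1 then tcoef j n + wcoef j n / o j ^+ 3 else 0.

Definition tval n := limn (tcoef ^~ n).

Lemma wcoefS0 j : wcoef j.+1 0 = wcoef j 0 + (o j ^+ 3)^-1. Proof. by []. Qed.
Lemma wcoefSS j m : wcoef j.+1 m.+1 = wcoef j m.+1 + wcoef j m / o j ^+ 2.
Proof. by []. Qed.
Lemma tcoefS j n : tcoef j.+1 n = tcoef j n + wcoef j n / o j ^+ 3. Proof. by []. Qed.

Lemma wcoef_ge0 i n : 0 <= wcoef i n.
Proof.
elim: i n => [|i IH] [|n] //; first by rewrite wcoefS0 addr_ge0 ?invr_odd_ge0.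
by rewrite wcoefSS addr_ge0 // mulr_ge0 ?invr_odd_ge0.
Qed.

Lemma wcoef_le i n : wcoef i n <= (3 / 2) ^+ n * oddsq R i.
Proof.
elim: i n => [|i IH] [|n]; rewrite ?mulr0 //.
  by rewrite wcoefS0 oddsqS expr0 mul1r lerD ?invr_odd3_le //; have := IH 0%N; rewrite mul1r.
rewrite wcoefSS oddsqS mulrDr lerD // ler_wpM2r ?invr_odd_ge0 //.
rewrite (le_trans (IH n)) // exprSr ler_wpM2l ?oddsq_le //.
Qed.

Lemma wcoef_bound i n : `|wcoef i n| <= (3 / 2) ^+ n.+1.
Proof.
rewrite ger0_norm ?wcoef_ge0 // (le_trans (wcoef_le i n)) // exprSr ler_wpM2l ?oddsq_le //.
Qed.

Lemma cvg_tcoef n : tcoef ^~ n @ \oo --> tval n.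
Proof. exact: (cube_sum_cvg (v := wcoef ^~ n) (wcoef_bound ^~ n)). Qed.

Lemma wsum_expansion x i M : 0 <= x <= 1 ->
  0 <= (-1) ^+ M * (wsum x i - \sum_(n < M) (- x ^+ 2) ^+ n * wcoef i n) <=
  (x ^+ 2) ^+ M * wcoef i M.
Proof.
move=> /andP[x0 x1]; set v := x ^+ 2.
have v0 : 0 <= v by exact: sqr_ge0.
elim: i => [|i IH].
  by rewrite big1 => [|n _]; rewrite /= ?subrr !mulr0 ?lexx.
have f0 : 0 <= 1 - v / o i ^+ 2.
  rewrite subr_ge0 ler_pdivrMr ?exprn_gt0 ?odd_nat_gt0 // mul1r.
  rewrite (@le_trans _ _ 1) ?exprn_ege1 ?odd_nat_ge1 //.
  by rewrite /v expr_le1.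
have f1 : 1 - v / o i ^+ 2 <= 1 by rewrite gerBl mulr_ge0 ?invr_odd_ge0.
have /andP[r0 r1] := IH; case: M r0 r1 {IH} => [|m] r0 r1.
  rewrite big_ord0 subr0 !expr0 !mul1r in r0 r1 *; rewrite wsumS wcoefS0.
  have h3 := invr_odd_ge0 R i 3; rewrite -/v big_ord0 subr0 addr_ge0 ?mulr_ge0 //= lerD2r.
  by apply: le_trans r1; exact: ler_piMl.
set r := (-1) ^+ m.+1 * (wsum x i - _) in r0 r1.
have -> : (-1) ^+ m.+1 * (wsum x i.+1 - \sum_(n < m.+1) (- v) ^+ n * wcoef i.+1 n) =
   (1 - v / o i ^+ 2) * r + v ^+ m.+1 * (wcoef i m / o i ^+ 2).
  have -> : \sum_(n < m.+1) (- v) ^+ n * wcoef i.+1 n =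
     \sum_(n < m.+1) (- v) ^+ n * wcoef i n + (o i ^+ 3)^-1
     - v / o i ^+ 2 * \sum_(n < m) (- v) ^+ n * wcoef i n.
    rewrite big_ord_recl wcoefS0 expr0 mul1r [in RHS]big_ord_recl expr0 mul1r.
    have -> : \sum_(n < m) (- v) ^+ lift ord0 n * wcoef i.+1 (lift ord0 n) =
      \sum_(n < m) (- v) ^+ lift ord0 n * wcoef i (lift ord0 n)
      - v / o i ^+ 2 * \sum_(n < m) (- v) ^+ n * wcoef i n.
      rewrite mulr_sumr -sumrB; apply: eq_bigr => n _.
      by rewrite lift0 wcoefSS exprS; ring.
    ring.
  rewrite /r [in RHS]big_ord_recr wsumS -/v /=.
  have E : (-1) ^+ m * (- v) ^+ m = v ^+ m :> R by rewrite -exprMn mulN1r opprK.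
  set s := \sum_(n < m) (- v) ^+ n * wcoef i n.
  have -> : \sum_(n < m.+1) (- v) ^+ n * wcoef i n = s + (- v) ^+ m * wcoef i m.
    by rewrite big_ord_recr.
  rewrite !exprS -E; ring.
have a0 := wcoef_ge0 i m; have h2 := invr_odd_ge0 R i 2.
have vm : 0 <= v ^+ m.+1 by exact: exprn_ge0.
have h0 : 0 <= v ^+ m.+1 * (wcoef i m / o i ^+ 2) by apply: mulr_ge0 => //; exact: mulr_ge0.
rewrite wcoefSS mulrDr (addr_ge0 (mulr_ge0 f0 r0) h0) lerD2r.
by apply: le_trans r1; exact: ler_piMl.
Qed.

Lemma tsum_expansion x i M : 0 <= x <= 1 ->
  `|tsum x i - \sum_(n < M) (- x ^+ 2) ^+ n * tcoef i n| <= (x ^+ 2) ^+ M * tcoef i M.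
Proof.
move=> x01; elim: i => [|i IH].
  by rewrite big1 => [|n _]; rewrite /= ?subrr ?mulr0 ?normr0.
have := wsum_expansion i M x01; set w := _ * (wsum x i - _) => /andP[w0 w1].
have W : `|wsum x i - \sum_(n < M) (- x ^+ 2) ^+ n * wcoef i n| <= (x ^+ 2) ^+ M * wcoef i M.
  have <- : `|w| = `|wsum x i - \sum_(n < M) (- x ^+ 2) ^+ n * wcoef i n|.
    by rewrite /w normrM normrX normrN1 expr1n mul1r.
  by rewrite ger0_norm.
rewrite tsumS (tcoefS i M); under eq_bigr do rewrite tcoefS mulrDr mulrA.
rewrite big_split /= -mulr_suml opprD addrACA [leRHS]mulrDr.
apply: le_trans (ler_normD _ _) _; apply: lerD => //.
rewrite -mulrBl normrM (ger0_norm (invr_odd_ge0 R i 3)) mulrA.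
by rewrite ler_wpM2r ?invr_odd_ge0.
Qed.

Lemma tlim_has_exp : has_exp (fun u => tlim (2 * Num.sqrt u)) (fun n => (- 4) ^+ n * tval n).
Proof.
move=> M _; exists (4 ^+ M * tval M) => u /andP[u0 u1].
set x := 2 * Num.sqrt u.
have xE : x ^+ 2 = 4 * u.
  by rewrite /x exprMn sqr_sqrtr ?ltW //; ring.
have x0 : 0 <= x by rewrite mulr_ge0 ?sqrtr_ge0.
have x1 : x <= 1.
  by rewrite -(@ler_pXn2r _ 2) ?nnegrE // xE expr1n; lra.
have c1 : (fun i => `|tsum x i - \sum_(n < M) (- x ^+ 2) ^+ n * tcoef i n|) @ \oo -->
  `|tlim x - \sum_(n < M) (- x ^+ 2) ^+ n * tval n|.
  apply: cvg_norm; apply: cvgB; first exact: cvg_tsum.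
  apply: (cvgn_sum (F := fun n i => (- x ^+ 2) ^+ n * tcoef i n)
    (l := fun n => (- x ^+ 2) ^+ n * tval n)) => n _.
  by apply: cvgM; [exact: cvg_cst | exact: cvg_tcoef].
have c2 : (fun i => (x ^+ 2) ^+ M * tcoef i M) @ \oo --> (x ^+ 2) ^+ M * tval M.
  by apply: cvgM; [exact: cvg_cst | exact: cvg_tcoef].
have := ler_cvg_to c1 c2; rewrite xE exprMn mulrAC => H.
have -> : \sum_(i < M) (- 4) ^+ i * tval i * u ^+ i = \sum_(n < M) (- (4 * u)) ^+ n * tval n.
  by apply: eq_bigr => n _; rewrite -mulNr exprMn mulrAC.
apply: H; near=> i; have := @tsum_expansion x i M; rewrite x0 x1 => /(_ isT).
by rewrite xE exprMn mulrAC.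
Unshelve. all: by end_near. Qed.

Lemma alphafE y : 0 < y < 1 -> alphaf y = (trigamma (1 - y) - trigamma (1 + y)) / 2.
Proof.
move=> y01; have /andP[y0 y1] := y01.
rewrite /alphaf /csc2 -trigamma_reflection // (trigamma_shift y0) [1 + y]addrC; lra.
Qed.

Lemma csc2E y : 0 < y < 1 -> csc2 y - (y ^+ 2)^-1 = trigamma (1 - y) + trigamma (1 + y).
Proof.
move=> y01; have /andP[y0 y1] := y01.
rewrite /csc2 -trigamma_reflection // (trigamma_shift y0) [1 + y]addrC; lra.
Qed.

Lemma betafE y : 0 < y < 1 -> betaf y = alphaf y - alphaf (y / 2) / 2.
Proof.
move=> y01; have /andP[y0 y1] := y01.
have h : csc2 (y / 2) = 2 * csc2 y * (1 + cos (pi * y)).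
  have E2 : pi * y = (pi * (y / 2)) *+ 2 :> R by rewrite mulr2n -mulrDr -splitr.
  rewrite /csc2 E2 sin_mulr2n cos_mulr2n !mulr2n.
  have s0 : sin (pi * (y / 2)) != 0 by rewrite gt_eqF // sin_pi_gt0 //; lra.
  have c0 : cos (pi * (y / 2)) != 0.
    rewrite gt_eqF // cos_gt0_pihalf //; have := @pi_gt0 R => p0.
    rewrite (@lt_trans _ _ 0) ?oppr_lt0 ?divr_gt0 ?mulr_gt0 //= ltr_pM2l //; lra.
  move: s0 c0; move: (sin _) (cos _) => S C s0 c0; set p := pi; clearbody p.
  by field; rewrite s0 -mulr2n mulrn_eq0 /= mulf_neq0.
rewrite /betaf /alphaf h /eta_trigamma.
have -> : (y + 1 + 1) / 2 = y / 2 + 1 by field.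
have -> : ((y / 2) ^+ 2)^-1 = 4 * (y ^+ 2)^-1 by field; rewrite gt_eqF.
lra.
Qed.

Let sqrt_itv u : 0 < u <= 1 / 16 -> 0 < Num.sqrt u <= 1 / 4 /\ Num.sqrt u ^+ 2 = u.
Proof.
move=> /andP[u0 u1]; have E : Num.sqrt u ^+ 2 = u by rewrite sqr_sqrtr // ltW.
split=> //; rewrite sqrtr_gt0 u0 /= -(@ler_pXn2r _ 2) ?nnegrE ?sqrtr_ge0 // E.
lra.
Qed.

Definition Aseries u := Num.sqrt u * alphaf (Num.sqrt u).
Definition Eseries u := u * (csc2 (Num.sqrt u) - u^-1) / 2.
Definition Bseries u := Num.sqrt u * betaf (Num.sqrt u).

Lemma Aseries_has_exp : has_exp Aseries (fun i => 2 * i%:R * zeta R (2 * i + 1)).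
Proof.
apply: has_exp_zeta_series (has_exp_geom2 R) _ _; first by rewrite mulr0.
move=> u hu; have [/andP[y0 y1] yE] := sqrt_itv hu; rewrite /Aseries.
set y := Num.sqrt u in y0 y1 yE *.
have c : (fun n => y * ((trigamma_sum (1 - y) n - trigamma_sum (1 + y) n) / 2)) @ \oo -->
   y * alphaf y.
  rewrite alphafE ?y0 /=; last lra.
  apply: cvgM; first exact: cvg_cst.
  apply: cvgM; last exact: cvg_cst.
  by apply: cvgB; apply: cvg_trigamma; lra.
apply: (cvgn_eq c) => n; rewrite /trigamma_sum -sumrB mulr_suml mulr_sumr.
apply: eq_bigr => k _; rewrite -yE.
have -> : k%:R + (1 - y) = k.+1%:R - y by rewrite -natr1; ring.
have -> : k%:R + (1 + y) = k.+1%:R + y by rewrite -natr1; ring.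
have : 1 <= k.+1%:R :> R by rewrite ler1n.
move: (k.+1%:R) => K K1.
have h1 : K != 0 by rewrite gt_eqF //; lra.
have h2 : K - y != 0 by rewrite gt_eqF //; lra.
have h3 : K + y != 0 by rewrite gt_eqF //; lra.
have -> : 1 - y ^+ 2 / K ^+ 2 = (K - y) * (K + y) / K ^+ 2 by field.
by field; rewrite h1 h2 h3.
Qed.

Lemma Eseries_has_exp :
  has_exp Eseries (fun i => (2 * i%:R - (0 < i)%N%:R) * zeta R (2 * i)).
Proof.
have ph : has_exp (fun v => 2 * v / (1 - v) ^+ 2 + (- 1) * (v / (1 - v)))
   (fun i => 2 * i%:R - (0 < i)%N%:R : R).
  have := has_expD (has_exp_geom2 R) (has_expZ (-1) (has_exp_geom R)).
  by congr has_exp; apply/funext => i; rewrite mulN1r.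
have : has_exp Eseries (fun i => (2 * i%:R - (0 < i)%N%:R) * zeta R (2 * i + 0)).
  apply: has_exp_zeta_series ph _ _; first by rewrite mulr0 subrr.
  move=> u hu; have [/andP[y0 y1] yE] := sqrt_itv hu; rewrite /Eseries.
  set y := Num.sqrt u in y0 y1 yE *.
  have -> : u * (csc2 y - u^-1) / 2 = u * (csc2 y - (y ^+ 2)^-1) / 2 by rewrite yE.
  have c : (fun n => u * (trigamma_sum (1 - y) n + trigamma_sum (1 + y) n) / 2) @ \oo -->
     u * (csc2 y - (y ^+ 2)^-1) / 2.
    rewrite csc2E ?y0 /=; last lra.
    apply: cvgM; last exact: cvg_cst.
    apply: cvgM; first exact: cvg_cst.
    by apply: cvgD; apply: cvg_trigamma; lra.
  apply: (cvgn_eq c) => n; rewrite /trigamma_sum -big_split /= mulr_sumr mulr_suml.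
  apply: eq_bigr => k _; rewrite -yE expr0 invr1 mul1r.
  have -> : k%:R + (1 - y) = k.+1%:R - y by rewrite -natr1; ring.
  have -> : k%:R + (1 + y) = k.+1%:R + y by rewrite -natr1; ring.
  have : 1 <= k.+1%:R :> R by rewrite ler1n.
  move: (k.+1%:R) => K K1.
  have h1 : K != 0 by rewrite gt_eqF //; lra.
  have h2 : K - y != 0 by rewrite gt_eqF //; lra.
  have h3 : K + y != 0 by rewrite gt_eqF //; lra.
  have -> : 1 - y ^+ 2 / K ^+ 2 = (K - y) * (K + y) / K ^+ 2 by field.
  by field; rewrite h1 h2 h3.
by congr has_exp; apply/funext => i; rewrite addn0.
Qed.

Lemma Bseries_has_exp :
  has_exp Bseries (fun i => 2 * i%:R * (1 - 2 ^- (2 * i)) * zeta R (2 * i + 1)).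
Proof.
have h := has_expD Aseries_has_exp (has_expZ (-1) (has_exp_dilate Aseries_has_exp)).
have : has_exp Bseries (fun i => 2 * i%:R * zeta R (2 * i + 1) +
   -1 * (2 * i%:R * zeta R (2 * i + 1) * 2 ^- (2 * i))).
  apply: has_exp_ext h => u hu; have [/andP[y0 y1] yE] := sqrt_itv hu.
  rewrite /Bseries /Aseries betafE ?y0 /=; last lra.
  have -> : Num.sqrt (u / 4) = Num.sqrt u / 2.
    rewrite sqrtrM; last by case/andP: hu => /ltW.
    congr (_ * _); have -> : 4^-1 = 2^-1 ^+ 2 :> R by field.
    by rewrite sqrtr_sqr ger0_norm.
  ring.
by congr has_exp; apply/funext => i; ring.
Qed.

Definition cospi_coef q : R := (-1) ^+ q * (pi ^+ (2 * q) / ((2 * q)`!)%:R).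

Lemma cospi_has_exp : has_exp (fun u => cos (pi * Num.sqrt u)) cospi_coef.
Proof.
have E x n : cos_coeff' (pi * x) n = cospi_coef n * (x ^+ 2) ^+ n :> R.
  rewrite /cos_coeff' /cospi_coef -exprnP -mul2n exprMn (exprM x).
  by rewrite -!mulrA; do 2 congr (_ * _); rewrite mulrC.
have [B HB] : exists B, forall i, `|cospi_coef i| <= B.
  have c0 : cvgn (series (@cos_coeff' R (pi * 1))) by apply: cvgP; exact: cvg_cos_coeff'.
  have [B HB] := cvg_has_ub (cvgP _ (cvg_series_cvg_0 c0)).
  exists B => i; have := HB _ (ex_intro2 _ _ i I erefl).
  by rewrite E !expr1n mulr1.
apply: (has_exp_series HB) => u hu; have [/andP[y0 y1] yE] := sqrt_itv hu.
have := @cvg_cos_coeff' R (pi * Num.sqrt u) => H; apply: (cvgn_eq H) => n.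
rewrite /series /= big_mkord; apply: eq_bigr => i _.
by rewrite E yE.
Qed.

End Coefficients.

Section CoefficientFormula.
Local Open Scope classical_set_scope.
Local Open Scope ring_scope.
Variable R : realType.
Implicit Types (u x y : R) (i j k m n q r s N : nat).

Lemma zeta2 : zeta R 2 = pi ^+ 2 / 6.
Proof.
rewrite -trigamma1; apply: (cvg_unique _ (@zeta_cvg R 2 isT)) => //.
apply: (cvgn_eq (cvg_trigamma (@ltr01 R))) => n.
by apply: eq_bigr => k _; rewrite natr1.
Qed.

Definition acoef r : R := 2 * r%:R * zeta R (2 * r + 1).
Definition bcoef r : R := 2 * r%:R * (1 - 2 ^- (2 * r)) * zeta R (2 * r + 1).

Lemma quadratic_form_expansion (kappa : R) :
  let F := fun u => Aseries u * Aseries u / 2 + Bseries u * Bseries u / 2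
    + cos (pi * Num.sqrt u) * (Aseries u * Bseries u)
    + (- (pi ^+ 2 / 4) * Eseries u + kappa * u) in
  has_exp F (fun m => conv acoef acoef m / 2 + conv bcoef bcoef m / 2
    + conv (@cospi_coef R) (conv acoef bcoef) m
    + (- (pi ^+ 2 / 4) * ((2 * m%:R - (0 < m)%N%:R) * zeta R (2 * m)) + kappa * (m == 1)%N%:R)).
Proof.
have hA : has_exp (@Aseries R) acoef := @Aseries_has_exp R.
have hB : has_exp (@Bseries R) bcoef := @Bseries_has_exp R.
have hAA := has_expZ 2^-1 (has_expM hA hA).
have hBB := has_expZ 2^-1 (has_expM hB hB).
have hC := has_expM (@cospi_has_exp R) (has_expM hA hB).
have hE := has_expD (has_expZ (- (pi ^+ 2 / 4)) (@Eseries_has_exp R))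
  (has_expZ kappa (has_exp_monomial R 1)).
have H := has_expD (has_expD (has_expD hAA hBB) hC) hE.
have {}H : has_exp (fun u => Aseries u * Aseries u / 2 + Bseries u * Bseries u / 2
    + cos (pi * Num.sqrt u) * (Aseries u * Bseries u)
    + (- (pi ^+ 2 / 4) * Eseries u + kappa * u)) (fun i =>
   2^-1 * conv acoef acoef i + 2^-1 * conv bcoef bcoef i
    + conv (@cospi_coef R) (conv acoef bcoef) i
    + (- (pi ^+ 2 / 4) * ((2 * i%:R - (0 < i)%N%:R) * zeta R (2 * i)) + kappa * (i == 1)%N%:R)).
  apply: has_exp_ext H => u _; rewrite expr1 ![2^-1 * _]mulrC; ring.
by congr has_exp: H; apply/funext => i; rewrite ![2^-1 * _]mulrC.
Qed.

Lemma tlim_expansion : exists kappa : R, forall m,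
  16 * (if m is k.+1 then if k is n.+1 then (- 4) ^+ n * tval R n else 0 else 0) =
  conv acoef acoef m / 2 + conv bcoef bcoef m / 2
    + conv (@cospi_coef R) (conv acoef bcoef) m
    + (- (pi ^+ 2 / 4) * ((2 * m%:R - (0 < m)%N%:R) * zeta R (2 * m)) + kappa * (m == 1)%N%:R).
Proof.
pose kappa : R := pi ^+ 2 / 8 * (pi ^+ 2 / 3) + (4 * tnode_lim R - pi ^+ 4 / 24).
exists kappa => m.
have H := has_expZ 16 (has_exp_mulX (has_exp_mulX (@tlim_has_exp R))).
have K : has_exp (fun u => 16 * (u * (u * tlim (2 * Num.sqrt u))))
    (fun m => conv acoef acoef m / 2 + conv bcoef bcoef m / 2
      + conv (@cospi_coef R) (conv acoef bcoef) m
      + (- (pi ^+ 2 / 4) * ((2 * m%:R - (0 < m)%N%:R) * zeta R (2 * m))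
         + kappa * (m == 1)%N%:R)); last exact: (has_exp_uniq H K m).
move: {m H} (quadratic_form_expansion kappa); apply: has_exp_ext => u /andP[u0 u1].
have yE : Num.sqrt u ^+ 2 = u by rewrite sqr_sqrtr // ltW.
have y0 : 0 < Num.sqrt u by rewrite sqrtr_gt0.
have y1 : Num.sqrt u < 1 / 2.
  rewrite -(@ltr_pXn2r _ 2) ?nnegrE ?sqrtr_ge0 // yE; lra.
have := @tlim_closed_form R (Num.sqrt u); rewrite y0 y1 => /(_ isT) E.
have -> : 16 * (u * (u * tlim (2 * Num.sqrt u))) =
  u * (4 * (2 * Num.sqrt u) ^+ 2 * tlim (2 * Num.sqrt u)).
  by rewrite exprMn yE; ring.
rewrite E /Aseries /Bseries /Eseries /kappa yE.
set y := Num.sqrt u in y0 y1 yE E *; set a := alphaf y; set b := betaf y.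
set c := cos _; set q := csc2 y; set p := pi; set T := tnode_lim R.
rewrite -yE; clearbody p; clear -y0.
by field; rewrite gt_eqF.
Qed.

Lemma conv_acoef m : conv acoef acoef m / 2 + conv bcoef bcoef m / 2 + conv acoef bcoef m =
  \sum_(r < m.+1) 2 * r%:R * (m - r)%:R * (2 - 2 ^- (2 * r)) * (2 - 2 ^- (2 * (m - r)))
    * zeta R (2 * r + 1) * zeta R (2 * (m - r) + 1).
Proof.
have -> : conv acoef bcoef m = (conv acoef bcoef m + conv bcoef acoef m) / 2.
  have -> : conv bcoef acoef m = conv acoef bcoef m.
    rewrite /conv (reindex_inj rev_ord_inj) /=; apply: eq_bigr => i _.
    by rewrite subSS mulrC subKn // -ltnS.
  by field.
rewrite -!mulrDl /conv -!big_split /= mulr_suml.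
apply: eq_bigr => i _; rewrite /acoef /bcoef.
move: (2 ^- (2 * i)) (2 ^- (2 * (m - i))) (zeta R _) (zeta R _) => v w y z.
by move: i%:R (m - i)%:R => a b; field.
Qed.

Lemma conv_acoef_bcoef m : conv acoef bcoef m =
  \sum_(r < m.+1) 2 * r%:R * (m - r)%:R * (2 - 2 ^- (2 * r) - 2 ^- (2 * (m - r)))
    * zeta R (2 * r + 1) * zeta R (2 * (m - r) + 1).
Proof.
have -> : conv acoef bcoef m = (conv acoef bcoef m + conv bcoef acoef m) / 2.
  have -> : conv bcoef acoef m = conv acoef bcoef m.
    rewrite /conv (reindex_inj rev_ord_inj) /=; apply: eq_bigr => i _.
    by rewrite subSS mulrC subKn // -ltnS.
  by field.
rewrite /conv -big_split /= mulr_suml.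
apply: eq_bigr => i _; rewrite /acoef /bcoef.
move: (2 ^- (2 * i)) (2 ^- (2 * (m - i))) (zeta R _) (zeta R _) => v w y z.
by move: i%:R (m - i)%:R => a b; field.
Qed.

Lemma sum_pick (G : nat -> R) k m N : G 0%N = 0 -> (m < N)%N ->
  \sum_(1 <= s < N | (k + s == m)%N) G s = if (k <= m)%N then G (m - k)%N else 0.
Proof.
move=> G0 mN.
have -> : \sum_(1 <= s < N | (k + s == m)%N) G s = \sum_(0 <= s < N | (k + s == m)%N) G s.
  rewrite [LHS]big_mkcond [RHS]big_mkcond [RHS]big_ltn ?(leq_trans _ mN) //.
  by rewrite G0 if_same /= add0r.
case: leqP => km; last first.
  by rewrite big1 // => s /eqP E; move: km; rewrite -E ltnNge leq_addr.
rewrite big_mkord.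
have h : (m - k < N)%N by rewrite (leq_ltn_trans (leq_subr _ _)).
rewrite (big_pred1 (Ordinal h)) // => s /=.
by rewrite -val_eqE /=; apply/eqP/eqP; lia.
Qed.

Lemma sum_pick2 (F : nat -> nat -> R) m N : (forall s, F 0%N s = 0) -> (forall r, F r 0%N = 0) ->
  (m < N)%N -> \sum_(1 <= r < N) \sum_(1 <= s < N | (r + s == m)%N) F r s =
  \sum_(r < m.+1) F r (m - r)%N.
Proof.
move=> F0 G0 mN.
under eq_bigr do rewrite sum_pick //.
have -> : \sum_(1 <= i < N) (if (i <= m)%N then F i (m - i)%N else 0) =
  \sum_(0 <= i < N) (if (i <= m)%N then F i (m - i)%N else 0).
  by rewrite [RHS]big_ltn ?(leq_trans _ mN) // F0 add0r.
rewrite (@big_cat_nat _ _ _ m.+1) //= [X in _ + X]big_nat_cond [X in _ + X]big1 ?addr0; last first.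
  by move=> i /andP[/andP[mi _] _]; rewrite leqNgt mi.
by rewrite big_mkord; apply: eq_bigr => i _; rewrite -ltnS ltn_ord.
Qed.

Lemma tval_formula n : tval R n =
  (- (1 / 4)) ^+ (n + 2) *
     (- ((9 + 6 * n%:R) / 2) * zeta R 2 * zeta R (2 * n + 4)
      + \sum_(1 <= q < n.+3) \sum_(1 <= r < n.+3)
          \sum_(1 <= s < n.+3 | (q + r + s == n + 2)%N)
            2 * r%:R * s%:R * (2 - 2 ^- (2 * r) - 2 ^- (2 * s))
              * zeta R (2 * r + 1) * zeta R (2 * s + 1)
              * ((- 1) ^+ q * (pi ^+ (2 * q) / ((2 * q)`!)%:R))
      + \sum_(1 <= r < n.+3) \sum_(1 <= s < n.+3 | (r + s == n + 2)%N)
          2 * r%:R * s%:R * (2 - 2 ^- (2 * r)) * (2 - 2 ^- (2 * s))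
            * zeta R (2 * r + 1) * zeta R (2 * s + 1)).
Proof.
have [kappa H] := tlim_expansion.
have {H} := H n.+2; rewrite [(n.+2 == 1)%N]/= mulr0 addr0 /=.
have -> : conv (@cospi_coef R) (conv acoef bcoef) n.+2 = conv acoef bcoef n.+2 +
    \sum_(q < n.+2) cospi_coef R q.+1 * conv acoef bcoef (n.+1 - q).
  rewrite {1}/conv big_ord_recl subn0 {1}/cospi_coef muln0 !expr0 fact0 divr1 !mul1r.
  by congr (_ + _); apply: eq_bigr => q _; rewrite lift0 subSS.
rewrite addrA conv_acoef => E.
have -> : tval R n = (- (1 / 4)) ^+ (n + 2) * (16 * ((- 4) ^+ n * tval R n)).
  rewrite exprD.
  have h : (- (1 / 4)) ^+ n * (- 4) ^+ n = 1 :> R.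
    by rewrite -exprMn (_ : - (1 / 4) * - 4 = 1 :> R) ?expr1n //; field.
  transitivity ((- (1 / 4)) ^+ n * (- 4) ^+ n * tval R n); first by rewrite h mul1r.
  by move: (_ ^+ n) (_ ^+ n) (tval R n) => a b c; field.
rewrite E addn2; congr (_ * _).
rewrite sum_pick2 //=; [| by move=> s; rewrite mulr0 !mul0r | by move=> r; rewrite mulr0 !mul0r].
have -> : \sum_(1 <= q < n.+3) \sum_(1 <= r < n.+3)
          \sum_(1 <= s < n.+3 | (q + r + s == n.+2)%N)
            2 * r%:R * s%:R * (2 - 2 ^- (2 * r) - 2 ^- (2 * s))
              * zeta R (2 * r + 1) * zeta R (2 * s + 1)
              * ((- 1) ^+ q * (pi ^+ (2 * q) / ((2 * q)`!)%:R)) =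
  \sum_(q < n.+2) cospi_coef R q.+1 * conv acoef bcoef (n.+1 - q).
  rewrite big_add1 big_mkord; apply: eq_bigr => q _.
  rewrite conv_acoef_bcoef -(@sum_pick2 (fun r s => 2 * r%:R * s%:R *
    (2 - 2 ^- (2 * r) - 2 ^- (2 * s)) * zeta R (2 * r + 1) * zeta R (2 * s + 1)) (n.+1 - q) n.+3);
    [| by move=> s; rewrite mulr0 !mul0r | by move=> r; rewrite mulr0 !mul0r |
     by rewrite ltnS (leq_trans (leq_subr _ _))].
  rewrite mulr_sumr; apply: eq_bigr => r _; rewrite mulr_sumr.
  apply: eq_big => s; last by move=> _; rewrite mulrC.
  by apply/eqP/eqP; have := ltn_ord q; lia.
have -> : - (pi ^+ 2 / 4) * ((2 * n.+2%:R - 1) * zeta R (2 * n.+2)) =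
  - ((9 + 6 * n%:R) / 2) * zeta R 2 * zeta R (2 * n + 4).
  rewrite zeta2 (_ : (2 * n.+2 = 2 * n + 4)%N); last lia.
  rewrite -[n.+2]addn2 natrD; move: (pi : R) (zeta R _) n%:R => p z m; by field.
by rewrite [LHS]addrC [X in _ + X = _]addrC addrA.
Qed.

End CoefficientFormula.

(** * Multiple t-values *)

Section MultipleT.
Local Open Scope classical_set_scope.
Local Open Scope ring_scope.
Variable R : realType.
Implicit Types (e : nat -> nat) (i j l n N : nat).
Local Notation o := (@odd_nat R).

Fixpoint nested_sum e l N : R :=
  if l is l'.+1 then
    (fix sum N := if N is N'.+1 then sum N' + nested_sum e l' N' / o N' ^+ e l' else 0) N
  else 1.

Lemma nested_sumS e l N :
  nested_sum e l.+1 N.+1 = nested_sum e l.+1 N + nested_sum e l N / o N ^+ e l.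
Proof. by []. Qed.

Lemma nested_sum_wcoef e N l : e 0%N = 3%N -> (forall i, (0 < i <= l)%N -> e i = 2%N) ->
  nested_sum e l.+1 N = wcoef R N l.
Proof.
move=> e0; elim: N l => [|N IH] [|l] e2 //.
  by rewrite nested_sumS wcoefS0 IH // e0 /= mul1r.
rewrite nested_sumS wcoefSS !IH ?e2 ?leqnn //.
by move=> i /andP[i0 il]; rewrite e2 // i0 ltnW.
Qed.

Lemma nested_sum_tcoef e N n : e 0%N = 3%N -> (forall i, (0 < i <= n)%N -> e i = 2%N) ->
  e n.+1 = 3%N -> nested_sum e n.+2 N = tcoef R N n.
Proof.
move=> e0 e2 e3; elim: N => [|N IH] //.
by rewrite nested_sumS tcoefS IH nested_sum_wcoef // e3.
Qed.

Definition tuple_term e l (k : l.-tuple nat) : R :=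
  \prod_(i < l) (2 * (tnth k i)%:R - 1) ^- e i.

Lemma tuple_term_rcons e l (k : l.-tuple nat) N :
  tuple_term e [tuple of rcons k N.+1] = tuple_term e k / o N ^+ e l.
Proof.
rewrite /tuple_term big_ord_recr /=; congr (_ * _).
  apply: eq_bigr => i _; rewrite !(tnth_nth 0%N) /= nth_rcons size_tuple ltn_ord //.
rewrite (tnth_nth 0%N) /= nth_rcons size_tuple ltnn eqxx odd_natE -natr1.
by congr (_ ^- _); ring.
Qed.

Lemma path_ltn_last s : path ltn 0%N s -> s != [::] -> (0 < last 0%N s)%N.
Proof.
case/lastP: s => // s x; rewrite rcons_path last_rcons => /andP[_ h] _.
exact: leq_ltn_trans h.
Qed.

Lemma path_ltn_ge s : path ltn 0%N s -> all (leq 1) s.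
Proof. exact: order_path_min ltn_trans. Qed.

Lemma tuple_term_ge0 e l (k : l.-tuple nat) : path ltn 0%N k -> 0 <= tuple_term e k.
Proof.
move=> /path_ltn_ge/allP k0; apply: prodr_ge0 => i _.
rewrite invr_ge0 exprn_ge0 // subr_ge0.
have : (1 <= tnth k i)%N by apply/k0/mem_tnth.
rewrite -(@ler_nat R) => h; lra.
Qed.

Definition bounded_tuples l N : set (l.-tuple nat) :=
  [set k | path ltn 0%N k /\ (last 0%N k <= N)%N].
Arguments bounded_tuples : clear implicits.

Lemma esum_EFinZl (T : choiceType) (S : set T) (c : R) (b : T -> R) : 0 <= c ->
  \esum_(x in S) (c * b x)%:E = (c%:E * \esum_(x in S) (b x)%:E)%E.
Proof.
move=> c0; rewrite /esum -ereal_supZl //; last first.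
  by apply/set0P; exists (\sum_(x \in set0) (b x)%:E)%E; exists set0 => //; exact: fsets_set0.
have E A : finite_set A -> (\sum_(x \in A) (c * b x)%:E = c%:E * \sum_(x \in A) (b x)%:E)%E.
  by move=> fA; rewrite !fsbig_finite // !sumEFin -EFinM mulr_sumr.
congr ereal_sup; apply/seteqP; split=> z /=.
  by move=> [A [fA AS] <-]; exists (\sum_(x \in A) (b x)%:E)%E; [exists A | rewrite E].
by move=> [_ [A [fA AS] <-] <-]; exists A; rewrite ?E.
Qed.

Lemma esum_bounded_tuples e l N :
  \esum_(k in bounded_tuples l N) (tuple_term e k)%:E = (nested_sum e l N)%:E.
Proof.
elim: l N => [|l IHl] N.
  have -> : bounded_tuples 0 N = [set [tuple]].
    by apply/seteqP; split=> k /=; rewrite /bounded_tuples /= [k]tuple0.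
  by rewrite esum_set1 /tuple_term big_ord0 // lee_fin.
elim: N => [|N IHN].
  have -> : bounded_tuples l.+1 0 = set0; last exact: esum_set0.
  apply/seteqP; split=> k //= -[pk]; rewrite leqNgt path_ltn_last //.
  by rewrite -size_eq0 size_tuple.
rewrite (esumID [set k | (last 0%N (val k) <= N)%N]); last first.
  by move=> k [pk _]; rewrite lee_fin tuple_term_ge0.
rewrite nested_sumS EFinD; congr (_ + _)%E.
  rewrite -IHN; congr esum; apply/seteqP; split=> k /=.
    by move=> [[pk _] h].
  by move=> [pk h]; split => //; split => //; exact: leqW.
pose f (k : l.-tuple nat) : l.+1.-tuple nat := [tuple of rcons k N.+1].
rewrite (@reindex_esum _ _ _ (bounded_tuples l N) _ f); last first.
  split.
  - move=> k [pk h] /=; rewrite /bounded_tuples /= rcons_path last_rcons pk.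
    by split; [split | rewrite ltnn].
  - move=> k k' _ _ /(congr1 val) /= /rcons_inj[h]; exact: val_inj.
  - move=> k [[pk h] /= /negP]; rewrite -ltnNge => h'.
    have lE : last 0%N (val k) = N.+1 by apply/eqP; rewrite eqn_leq h h'.
    have [s sE] : exists s, val k = rcons s N.+1.
      case/lastP: (val k) lE => // s x; rewrite last_rcons => ->; by exists s.
    have sl : size s == l by rewrite -eqSS -(size_rcons s N.+1) -sE size_tuple.
    move: pk; rewrite sE rcons_path => /andP[ps ls].
    by exists (Tuple sl); [split | apply: val_inj; rewrite /= -sE].
rewrite (eq_esum (b := fun k => ((o N ^+ e l)^-1 * tuple_term e k)%:E)); last first.
  by move=> k _; rewrite tuple_term_rcons mulrC.
by rewrite esum_EFinZl ?invr_odd_ge0 // IHl -EFinM mulrC.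
Qed.

Lemma finite_bounded l (A : set (l.-tuple nat)) : finite_set A ->
  exists N, forall k, A k -> (last 0%N k <= N)%N.
Proof.
move=> /finite_seqP[s ->]; exists (\max_(k <- s) last 0%N (val k))%N => k ks.
exact: (@leq_bigmax_seq _ s xpredT (fun k => last 0%N (val k)) k ks isT).
Qed.

Lemma nested_sum_ge0 e l N : 0 <= nested_sum e l N.
Proof.
elim: l N => [|l IHl] N; first exact: ler01.
elim: N => [|N IHN]; first exact: lexx.
by rewrite nested_sumS addr_ge0 // mulr_ge0 ?invr_odd_ge0.
Qed.

Lemma nested_sum_le e l N M : (N <= M)%N -> nested_sum e l N <= nested_sum e l M.
Proof.
elim: M => [|M IH]; first by rewrite leqn0 => /eqP ->.
rewrite leq_eqVlt ltnS => /orP[/eqP -> //|/IH NM]; apply: (le_trans NM).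
by case: l {NM IH} => // l; rewrite nested_sumS lerDl mulr_ge0 ?nested_sum_ge0 ?invr_odd_ge0.
Qed.

Lemma esum_tuples e l (L : R) : nested_sum e l @ \oo --> L ->
  \esum_(k in [set k : l.-tuple nat | path ltn 0%N k]) (tuple_term e k)%:E = L%:E.
Proof.
move=> cL; apply/eqP; rewrite eq_le; apply/andP; split.
  apply: ub_ereal_sup => _ [A [fA AS] <-].
  have [N hN] := finite_bounded fA.
  apply: (@le_trans _ _ (nested_sum e l N)%:E).
    rewrite -esum_bounded_tuples; apply: esum_ge; exists A => //; split => // k Ak.
    by split; [exact: AS | exact: hN].
  rewrite lee_fin; apply: (cvgn_ge (k := N) cL); exact: nested_sum_le.
have Hle N : ((nested_sum e l N)%:E <=
    \esum_(k in [set k : l.-tuple nat | path ltn 0%N k]) (tuple_term e k)%:E)%E.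
  rewrite -esum_bounded_tuples /esum; apply: le_ereal_sup => _ [A [fA AS] <-].
  by exists A => //; split => // k /AS[].
move: Hle; case: (esum _ _) => [r| |] Hle; first last.
- by have := Hle 0%N; rewrite leeNy_eq.
- by rewrite leey.
by rewrite lee_fin; apply: (cvgn_le (k := 0) cL) => N _; rewrite -lee_fin.
Qed.

Lemma multiple_t_tval n :
  multiple_t R (3%N :: rcons (nseq n 2%N) 3%N) = (tval R n)%:E.
Proof.
rewrite /multiple_t; set ns := _ :: _.
have sz : size ns = n.+2 by rewrite /= size_rcons size_nseq.
apply: (@esum_tuples (nth 0%N ns)); rewrite sz.
apply: (cvgn_eq (@cvg_tcoef R n)) => N; rewrite nested_sum_tcoef //=.
  by move=> [//|i] /= iN; rewrite nth_rcons size_nseq iN nth_nseq iN.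
by rewrite nth_rcons size_nseq ltnn eqxx.
Qed.

End MultipleT.

Section ZetaPolynomials.
Import (canonicals) mpoly.
Local Open Scope ring_scope.
Variables (R : realType) (m : nat).
Implicit Types (x y : R) (i j n : nat).

Definition zeta_span x := exists P : mpoly.mpoly m rat,
  x = mpoly.mmap (@ratr R) (fun i : 'I_m => zeta R (i + 2)) P.

Lemma zeta_span_polynomial x : zeta_span x -> polynomial_in_zeta_values x.
Proof.
move=> [P xE]; exists m, P, (fun i : 'I_m => i + 2)%N; split=> // i.
by rewrite addn2.
Qed.

Lemma zeta_spanD x y : zeta_span x -> zeta_span y -> zeta_span (x + y).
Proof. by move=> [P ->] [Q ->]; exists (P + Q); rewrite mpoly.mmapD. Qed.

Lemma zeta_spanM x y : zeta_span x -> zeta_span y -> zeta_span (x * y).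
Proof. by move=> [P ->] [Q ->]; exists (P * Q); rewrite rmorphM. Qed.

Lemma zeta_span_rat (q : rat) : zeta_span (ratr q).
Proof. by exists (mpoly.mpolyC m q); rewrite mpoly.mmapC. Qed.

Lemma zeta_span_zeta n : (1 < n < m + 2)%N -> zeta_span (zeta R n).
Proof.
move=> /andP[n1 nm]; have h : (n - 2 < m)%N by lia.
exists (mpoly.mpolyX rat (mpoly.mnm1 (Ordinal h))).
rewrite mpoly.mmapX mpoly.mmap1U /= subnK //.
Qed.

Lemma zeta_span_nat n : zeta_span n%:R.
Proof. by rewrite -[n%:R](ratr_nat R); exact: zeta_span_rat. Qed.

Lemma zeta_spanN x : zeta_span x -> zeta_span (- x).
Proof. by move=> [P ->]; exists (- P); rewrite mpoly.mmapN. Qed.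

Lemma zeta_spanV_nat n : zeta_span n%:R^-1.
Proof. by rewrite -[n%:R](ratr_nat R) -fmorphV; exact: zeta_span_rat. Qed.

Lemma zeta_spanX x n : zeta_span x -> zeta_span (x ^+ n).
Proof.
move=> hx; elim: n => [|n IH]; first exact: (zeta_span_nat 1).
by rewrite exprS; exact: zeta_spanM.
Qed.

Lemma zeta_span_sum (I : Type) (r : seq I) (P : pred I) (F : I -> R) :
  (forall k : I, P k -> zeta_span (F k)) -> zeta_span (\sum_(k <- r | P k) F k).
Proof.
move=> h; elim/big_rec: _ => [|i x Pi hx]; first exact: (zeta_span_nat 0).
exact: zeta_spanD (h i Pi) hx.
Qed.

Lemma zeta_span_expr2V n : zeta_span (2 ^- n).
Proof. by rewrite -natrX; exact: zeta_spanV_nat. Qed.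

Lemma zeta_span_pi n : (0 < m)%N -> zeta_span (pi ^+ (2 * n)).
Proof.
move=> m0; rewrite exprM; apply: zeta_spanX.
have -> : (pi : R) ^+ 2 = 6 * zeta R 2 by rewrite zeta2 mulrC mulfVK // pnatr_eq0.
by apply: zeta_spanM; [exact: zeta_span_nat | apply: zeta_span_zeta; lia].
Qed.

End ZetaPolynomials.

Theorem mainTheorem6 (R : realType) (n : nat) :
  multiple_t R (3%N :: rcons (nseq n 2%N) 3%N) =
    ((- (1 / 4)) ^+ (n + 2) *
     (- ((9 + 6 * n%:R) / 2) * zeta R 2 * zeta R (2 * n + 4)
      + \sum_(1 <= q < n.+3) \sum_(1 <= r < n.+3)
          \sum_(1 <= s < n.+3 | (q + r + s == n + 2)%N)
            2 * r%:R * s%:R * (2 - 2 ^- (2 * r) - 2 ^- (2 * s))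
              * zeta R (2 * r + 1) * zeta R (2 * s + 1)
              * ((- 1) ^+ q * (pi ^+ (2 * q) / ((2 * q)`!)%:R))
      + \sum_(1 <= r < n.+3) \sum_(1 <= s < n.+3 | (r + s == n + 2)%N)
          2 * r%:R * s%:R * (2 - 2 ^- (2 * r)) * (2 - 2 ^- (2 * s))
            * zeta R (2 * r + 1) * zeta R (2 * s + 1)))%:E
  /\ exists2 x : R,
       multiple_t R (3%N :: rcons (nseq n 2%N) 3%N) = x%:E
       & polynomial_in_zeta_values x.
Proof.
rewrite multiple_t_tval -tval_formula; split=> //; exists (tval R n) => //.
apply: (@zeta_span_polynomial R (2 * n + 6)%N); rewrite tval_formula.
have hN k : zeta_span (2 * n + 6) (k%:R : R) by exact: zeta_span_nat.
have hV k : zeta_span (2 * n + 6) ((k%:R)^-1 : R) by exact: zeta_spanV_nat.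
have hW k : zeta_span (2 * n + 6) (- 2 ^- k : R).
  by apply: zeta_spanN; exact: zeta_span_expr2V.
have hpi k : zeta_span (2 * n + 6) ((pi : R) ^+ (2 * k)) by apply: zeta_span_pi; lia.
apply: zeta_spanM; first by apply/zeta_spanX/zeta_spanN/zeta_spanM; [exact: (hN 1) | exact: hV].
apply: zeta_spanD; first apply: zeta_spanD.
- do 2! [apply: zeta_spanM; last by apply: zeta_span_zeta; lia].
  apply/zeta_spanN/zeta_spanM; last exact: hV.
  by apply: zeta_spanD; [exact: hN | apply: zeta_spanM; exact: hN].
- apply: zeta_span_sum => q _; rewrite big_nat_cond.
  apply: zeta_span_sum => r /andP[/andP[r0 r1] _]; rewrite big_nat_cond.
  apply: zeta_span_sum => s /andP[/andP[s0 s1] /eqP h].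
  apply: zeta_spanM; last first.
    by apply: zeta_spanM; [apply/zeta_spanX/zeta_spanN/(hN 1) | apply: zeta_spanM].
  do 2! [apply: zeta_spanM; last by apply: zeta_span_zeta; lia].
  by repeat (exact: hN || exact: hW || apply: zeta_spanD || apply: zeta_spanM).
- rewrite big_nat_cond; apply: zeta_span_sum => r /andP[/andP[r0 r1] _]; rewrite big_nat_cond.
  apply: zeta_span_sum => s /andP[/andP[s0 s1] /eqP h].
  do 2! [apply: zeta_spanM; last by apply: zeta_span_zeta; lia].
  by repeat (exact: hN || exact: hW || apply: zeta_spanD || apply: zeta_spanM).
Qed.
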